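(* Let $n\ge 1$ and $\alpha\in[-1/2,\infty)^n$. Let $a\ge 1$, $\sigma>0$, $1<p\le q<\infty$, $1\le r\le\infty$, $t<n/p'$, $s<n/q$, $t+s\ge 0$, where $1/p+1/p'=1$. For $j\ge 0$ write $\alpha+aj=(\alpha_1+aj,\dots,\alpha_n+aj)$. (i) If $\sigma\ge n/2$, then there exists a constant $C$ depending only on $\sigma$ and $\alpha$ such that $$\Big\|\Big(\sum_{j=0}^\infty|(L_{\alpha+aj}^{H})^{-\sigma}(f_j)|^r\Big)^{1/r}\Big\|_{L^q(\mathbb{R}_+^n,\,|x|^{-sq}dx)}\le C\Big\|\Big(\sum_{j=0}^\infty|f_j|^r\Big)^{1/r}\Big\|_{L^p(\mathbb{R}_+^n,\,|x|^{tp}dx)}$$ for all $f_j\in L^p(\mathbb{R}_+^n,|x|^{tp}dx)$. (ii) If $\sigma<n/2$, then the same boundedness holds under the additional condition $$\frac1q\ge\frac1p-\frac{2\sigma-t-s}{n}.$$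
   Context: $\mathbb{R}^n_+=(0,\infty)^n$ and $\mathbb{N}=\{0,1,2,\dots\}$. For $r=\infty$ the $\ell^r$ sum is replaced by the supremum over $j$. For $\alpha\in[-1/2,\infty)^n$ and $k\in\mathbb{N}^n$, the Laguerre functions of Hermite type are $\varphi_k^\alpha(x)=\prod_{i=1}^n\varphi_{k_i}^{\alpha_i}(x_i)$, $x\in\mathbb{R}^n_+$, where $$\varphi_{k_i}^{\alpha_i}(x_i)=\Big(\frac{2\Gamma(k_i+1)}{\Gamma(k_i+\alpha_i+1)}\Big)^{1/2}L_{k_i}^{\alpha_i}(x_i^2)\,x_i^{\alpha_i+1/2}e^{-x_i^2/2},$$ and $L_m^{b}$ is the Laguerre polynomial of degree $m$ and order $b$. They form an orthonormal basis of $L^2(\mathbb{R}^n_+,dx)$ and are eigenfunctions of $L_\alpha^H=-\Delta+|x|^2+\sum_{i=1}^n x_i^{-2}(\alpha_i^2-\tfrac14)$ with eigenvalues $4|k|+2|\alpha|+2n$, where $|k|=k_1+\dots+k_n$ and $|\alpha|=\alpha_1+\dots+\alpha_n$. For $\sigma>0$ the fractional integral is $$(L_\alpha^H)^{-\sigma}f=\sum_{m=0}^\infty(4m+2|\alpha|+2n)^{-\sigma}\sum_{|k|=m}\Big(\int_{\mathbb{R}^n_+}f\varphi_k^\alpha\,dx\Big)\varphi_k^\alpha.$$ It coincides on $L^2(\mathbb{R}^n_+,dx)$ with the integral operator $f\mapsto\int_{\mathbb{R}^n_+}\mathcal{H}^H_{\alpha,\sigma}(x,y)f(y)\,dy$,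 where $$\mathcal{H}^H_{\alpha,\sigma}(x,y)=\frac1{\Gamma(\sigma)}\int_0^\infty G^H_{\alpha,t}(x,y)t^{\sigma-1}dt,\qquad G^H_{\alpha,t}(x,y)=\sum_{m=0}^\infty e^{-t(4m+2|\alpha|+2n)}\sum_{|k|=m}\varphi_k^\alpha(x)\varphi_k^\alpha(y),$$ and on functions outside $L^2$ the operator $(L_\alpha^H)^{-\sigma}$ is understood as this integral operator.
   Formalization: The constant C may also depend on p, q, s and t, not only on σ and α (it is uniform in a, r and the f_j); independence of the exponents fails, e.g. for n=1, α=-1/2, p=q=2, t=0, f_0=1_(0,1) as s→1/2. *)

(* Defs.v *)
From HB Require Import structures.
From mathcomp Require Import all_boot all_order all_algebra.
From mathcomp Require Import all_classical all_reals all_analysis.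
Set Implicit Arguments.
Unset Strict Implicit.
Unset Printing Implicit Defensive.
Import Order.TTheory GRing.Theory Num.Theory.
Import numFieldNormedType.Exports.
Local Open Scope classical_set_scope.
Local Open Scope ring_scope.

(* Points of R^n are tuples, which carry the product Borel sigma-algebra. *)
Notation "''R[' R ]^ n" := (n.-tuple (measurableTypeR R))
  (at level 8, n at level 2, format "''R[' R ]^ n").

(* The library has this instance, but inference only finds the one for
   subprobability measures. *)
Lemma product_measure1_sigma_finite d1 d2 (T1 : measurableType d1)
    (T2 : measurableType d2) (R : realType)
    (m1 : {sigma_finite_measure set T1 -> \bar R})
    (m2 : {sigma_finite_measure set T2 -> \bar R}) :
  sigma_finite setT (m1 \x m2)%E.
Proof.
have /sigma_finiteP[F [TF ndF Foo]] := sigma_finiteT m1.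
have /sigma_finiteP[G [TG ndG Goo]] := sigma_finiteT m2.
exists (fun i => F i `*` G i).
  rewrite -setXTT TF TG predeqE => -[x y]; split.
    move=> [/= [i _ Fix] [k _ Gky]]; exists (maxn i k) => //; split.
    - by move: x Fix; exact/subsetPset/ndF/leq_maxl.
    - by move: y Gky; exact/subsetPset/ndG/leq_maxr.
  by move=> [i _ []/= ? ?]; split; exists i.
move=> k; have [? ?] := Foo k; have [? ?] := Goo k.
split; first exact: measurableX.
by rewrite product_measure1E// lte_mul_pinfty// ge0_fin_numE.
Qed.

(* Lebesgue measure on R^(n+1) is the image of the product of the Lebesgue
   measures on R and R^n under (x, t) |-> x :: t. *)
Section lebesgue_step.
Context {R : realType} (n : nat).
Variable mu : {sigma_finite_measure set 'R[R]^n -> \bar R}.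

Definition cons_pair (z : measurableTypeR R * 'R[R]^n) : 'R[R]^n.+1 :=
  [the n.+1.-tuple (measurableTypeR R) of z.1 :: z.2].

Definition uncons_pair (x : 'R[R]^n.+1) : measurableTypeR R * 'R[R]^n :=
  (tnth x ord0, [tuple of behead x]).

Lemma cons_pairK : cancel cons_pair uncons_pair.
Proof.
by move=> [x t]; congr pair => //; apply: val_inj.
Qed.

Lemma measurable_cons_pair : measurable_fun setT cons_pair.
Proof.
by apply: measurable_cons; [exact: measurable_fst|exact: measurable_snd].
Qed.

Lemma measurable_uncons_pair : measurable_fun setT uncons_pair.
Proof.
apply/measurable_fun_pairP; split.
  exact: (measurable_tnth (ord0 : 'I_n.+1)).
exact: measurable_behead.
Qed.

Definition lebesgue_cons : set 'R[R]^n.+1 -> \bar R :=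
  pushforward (lebesgue_measure \x mu)%E cons_pair.

Let mprod : {measure set (measurableTypeR R * 'R[R]^n)%type -> \bar R} :=
  (lebesgue_measure \x mu)%E.

Let lebesgue_cons0 : lebesgue_cons set0 = 0%E.
Proof. by rewrite /lebesgue_cons /pushforward preimage_set0 measure0. Qed.

Let lebesgue_cons_ge0 A : (0 <= lebesgue_cons A)%E.
Proof. exact: (measure_ge0 mprod). Qed.

Let lebesgue_cons_sigma_additive : semi_sigma_additive lebesgue_cons.
Proof.
have mf := measurable_cons_pair.
move=> F mF tF mUF; rewrite /lebesgue_cons /pushforward preimage_bigcup.
apply: (measure_semi_sigma_additive (s := mprod)).
- by move=> i; rewrite -[X in measurable X]setTI; exact: mf.
- apply/trivIsetP => /= i j _ _ ij; rewrite -preimage_setI.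
  by move/trivIsetP : tF => /(_ _ _ _ _ ij) ->//; rewrite preimage_set0.
- by rewrite -preimage_bigcup -[X in measurable X]setTI; exact: mf.
Qed.

HB.instance Definition _ := isMeasure.Build _ _ _ lebesgue_cons
  lebesgue_cons0 lebesgue_cons_ge0 lebesgue_cons_sigma_additive.

Let lebesgue_cons_sigma_finite : sigma_finite setT lebesgue_cons.
Proof.
have [F UF Foo] := product_measure1_sigma_finite lebesgue_measure mu.
exists (fun i => uncons_pair @^-1` F i).
  by rewrite -preimage_bigcup -UF preimage_setT.
move=> i; have [mFi Fi] := Foo i; split.
  rewrite -[X in measurable X]setTI.
  exact: measurable_uncons_pair.
rewrite /lebesgue_cons /pushforward -comp_preimage.
suff -> : uncons_pair \o cons_pair = id by [].
by apply/funext => z; exact: cons_pairK.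
Qed.

HB.instance Definition _ := Measure_isSigmaFinite.Build _ _ _ lebesgue_cons
  lebesgue_cons_sigma_finite.

End lebesgue_step.

Fixpoint lebesgue {R : realType} (n : nat) :
    {sigma_finite_measure set 'R[R]^n -> \bar R} :=
  match n with
  | 0 => \d_([tuple] : 'R[R]^0)
  | n'.+1 => lebesgue_cons (lebesgue n')
  end.

Section laguerre.
Context {R : realType}.
Implicit Types (x y : R) (b z : R).

Definition Gamma z : R :=
  \int[lebesgue_measure]_(t in `]0, +oo[) (t `^ (z - 1) * expR (- t)).

Definition gbinom z (k : nat) : R := (\prod_(i < k) (z - i%:R)) / k`!%:R.

(* L_m^b(x) = sum_(i <= m) (-1)^i binom(m + b, m - i) x^i / i! *)
Definition Laguerre_poly b (m : nat) : {poly R} :=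
  \poly_(i < m.+1) ((-1) ^+ i * gbinom (m%:R + b) (m - i) / i`!%:R).

Definition Laguerre_fun1 b (k : nat) x : R :=
  Num.sqrt (2 * Gamma (k%:R + 1) / Gamma (k%:R + b + 1))
  * (Laguerre_poly b k).[x ^+ 2] * x `^ (b + 2^-1) * expR (- (x ^+ 2 / 2)).

End laguerre.

Section fractional_integral.
Context {R : realType} {n : nat}.
Implicit Types (alpha : 'I_n -> R) (x y : 'R[R]^n) (sigma t : R).

Definition Rplus : set 'R[R]^n := [set x | forall i, 0 < tnth x i].

Definition enorm x : R := Num.sqrt (\sum_(i < n) tnth x i ^+ 2).

Definition Laguerre_fun alpha (k : 'I_n -> nat) x : R :=
  \prod_(i < n) Laguerre_fun1 (alpha i) (k i) (tnth x i).

(* A multi-index with |k| = m has all its entries in {0, ..., m}. *)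
Definition heat_coef alpha (m : nat) x y : R :=
  \sum_(k : {ffun 'I_n -> 'I_m.+1} | (\sum_(i < n) k i == m)%N)
    Laguerre_fun alpha (fun i => k i) x * Laguerre_fun alpha (fun i => k i) y.

Definition eigenvalue_LH alpha (m : nat) : R :=
  4 * m%:R + 2 * (\sum_(i < n) alpha i) + 2 * n%:R.

Definition heat_kernel alpha t x y : R :=
  limn (series (fun m =>
    expR (- (t * eigenvalue_LH alpha m)) * heat_coef alpha m x y)).

(* Extended-real valued: it equals +oo on the diagonal for small sigma. *)
Definition potential_kernel alpha sigma x y : \bar R :=
  ((Gamma sigma)^-1%:E *
   \int[lebesgue_measure]_(t in `]0%R, +oo[)
     (heat_kernel alpha t x y * t `^ (sigma - 1))%:E)%E.

(* (L_alpha^H)^(-sigma) as the integral operator with kernel potential_kernel.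
   The integral is extended-real valued, and infinite in absolute value when
   it does not converge absolutely (by convention +oo - oo = -oo). A bound on
   a norm of fracint f thus includes absolute convergence a.e. *)
Definition fracint alpha sigma (f : 'R[R]^n -> R) x : \bar R :=
  (\int[lebesgue n]_(y in Rplus) (potential_kernel alpha sigma x y * (f y)%:E))%E.

(* Norm of L^p(R^n_+, |x|^w dx) *)
Definition wLnorm (p w : R) (g : 'R[R]^n -> \bar R) : \bar R :=
  ((\int[lebesgue n]_(x in Rplus) (`|g x| `^ p * (enorm x `^ w)%:E)) `^ p^-1)%E.

Definition in_wLp (p w : R) (f : 'R[R]^n -> R) : Prop :=
  measurable_fun Rplus f /\ (wLnorm p w (EFin \o f) < +oo)%E.

End fractional_integral.

(* l^r norm, as the L^r norm for the counting measure on nat; for r = +oo it is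
   the supremum since only set0 is negligible. *)
Definition lr_norm {R : realType} (r : \bar R) (u : nat -> \bar R) : \bar R :=
  'N[counting]_r [u]%E.

(* The inequality for one choice of a, r and C, and all sequences (f_j) *)
Definition vector_valued_bound {R : realType} {n : nat} (alpha : 'I_n -> R)
    (a sigma p q s t : R) (r : \bar R) (C : R) : Prop :=
  forall f : nat -> 'R[R]^n -> R,
    (forall j, in_wLp p (t * p) (f j)) ->
    (wLnorm q (- (s * q)) (fun x => lr_norm r
        (fun j => fracint (fun i => (alpha i + a * j%:R)%R) sigma (f j) x))
     <= C%:E * wLnorm p (t * p) (fun x => lr_norm r (fun j => (f j x)%:E)))%E.

(* Main.v *)
Require Import Defs.
From mathcomp Require Import all_boot all_order all_algebra.
From mathcomp Require Import all_classical all_reals all_analysis.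
From mathcomp Require Import measurable_realfun ess_sup_inf ring lra.
Set Implicit Arguments.
Unset Strict Implicit.
Unset Printing Implicit Defensive.
Import Order.TTheory GRing.Theory Num.Theory.
Import numFieldNormedType.Exports.

(** The idea is to forget the order and the spectral decomposition: the kernel of
    the fractional integral is dominated, uniformly over all orders at least
    - 1/2, by a power of |x - y|, and this leaves a weighted inequality of
    Stein-Weiss for a positive kernel.

    Uniform kernel bound. The Hille-Hardy formula [hille_hardy] sums the heat
    kernel in one dimension: it is a Gaussian in x and y times a modified Bessel
    function of x y / sinh (2t). The uniform Stirling bound [Gamma_stirling_le],
    u^m e^(- u) <= C Gamma (m + 1/2), bounds that Bessel function by C e^z /
    sqrt z with a constant that does not depend on the order
    ([le_bessel_series]). Hence the heat kernel is at most
    C sinh (2t)^(- n/2) exp (- coth (2t) |x - y|^2 / 2) ([heat_kernel_le]), and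
    integration against t^(sigma - 1) gives |K(x, y)| <= C |x - y|^(- lam) for
    every lam > 0 with lam >= n - 2 sigma ([potential_kernel_le]). Because the
    heat kernel decays exponentially in t, larger exponents are allowed too,
    which is why sigma >= n/2 needs no relation between p and q.

    Weighted inequality. Scaling invariance forces the exponent
    lam = n/q + n/p' - (s + t) ([sw_exponent]), which is positive by the
    conditions on s and t, and lam >= n - 2 sigma is automatic in case (i) and
    the additional condition in case (ii). The inequality
    is proved as a bound for the bilinear form of nonnegative normalized f and g
    ([form_le]). The kernel |x|^(-s) |x - y|^(-lam) |y|^(-t) is split according
    to whether |x| and |y| are comparable ([form_le_stein_weiss]). If they are
    not, a Hardy operator or its dual appears ([form_le_hardy]). If they are, it
    is a Hardy-Littlewood-Sobolev kernel for p < q ([form_le_hls]) and Schur's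
    test suffices for p = q; for p = q and s + t = 0 the exponent is n, and one
    uses that the kernel is also below a power less than n and one greater than
    n. All these estimates have the same form: a product such as g k f is at most
    a sum of terms whose integral in one of the variables is a multiple of f^p or
    g^q', by a weighted inequality between geometric and arithmetic means
    ([geometric_mean3_le]). Duality returns to operators ([kernel_integral_Lp]).

    Sequences. The dominating kernel is positive and the same for all j, so
    Minkowski's inequality, with a factor 2 that is independent of r
    ([lr_norm_integral_le]), reduces the vector-valued inequality to the scalar
    one for the function y |-> ||(f_j(y))_j||. The distance and the norms are
    those of the supremum norm, which makes the measure of balls explicit. *)

Local Open Scope classical_set_scope.
Local Open Scope ring_scope.

(** * Integrals of nonnegative functions *)

Section integral_bounds.
Context d (T : measurableType d) (R : realType).
Variable mu : {measure set T -> \bar R}.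
Implicit Types (D : set T) (f g : T -> \bar R).
Local Open Scope ereal_scope.

(** The integral of a nonnegative function is a supremum over the simple
    functions below it, so it is monotone without any measurability. *)
Lemma ge0_le_integral_nonmeas D f g : (forall x, D x -> 0 <= f x) ->
  (forall x, D x -> f x <= g x) ->
  \int[mu]_(x in D) f x <= \int[mu]_(x in D) g x.
Proof.
move=> f0 fg; rewrite !ge0_integralE//; last first.
  by move=> x Dx; exact: le_trans (f0 _ Dx) (fg _ Dx).
apply: ereal_sup_le => _ [h /= hf <-]; exists h => // x.
apply: le_trans (hf x) _; rewrite /patch; case: ifPn => //.
by rewrite inE => Dx; exact: fg.
Qed.

Lemma abse_integral_le_nonmeas D f g : (forall x, D x -> `|f x| <= g x) ->
  `|\int[mu]_(x in D) f x| <= \int[mu]_(x in D) g x.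
Proof.
move=> fg; rewrite integralE.
have g0 x : D x -> 0 <= g x by move=> Dx; exact: le_trans (fg _ Dx).
set a := integral _ _ _; set b := integral _ _ _; set c := integral _ _ _.
have a0 : 0 <= a by exact: integral_ge0.
have b0 : 0 <= b by exact: integral_ge0.
have ac : a <= c.
  apply: ge0_le_integral_nonmeas => // x Dx.
  rewrite funepos.unlock; apply: le_trans (fg _ Dx); rewrite ge_max abse_ge0 andbT.
  exact: lee_abs.
have bc : b <= c.
  apply: ge0_le_integral_nonmeas => // x Dx.
  rewrite funeneg.unlock; apply: le_trans (fg _ Dx); rewrite ge_max abse_ge0 andbT.
  by rewrite -abseN; exact: lee_abs.
move: a b c a0 b0 ac bc => [a||] [b||] [c||] //=.
rewrite !lee_fin => a0 b0 ac bc; rewrite ler_norml; apply/andP; split; lra.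
all: by rewrite ?leey.
Qed.

End integral_bounds.

(** * Integrals of powers of a distance *)

Lemma powR_le (R : realType) (r x y : R) : 0 <= r -> 0 <= x -> x <= y ->
  x `^ r <= y `^ r.
Proof.
by move=> r0 x0 xy; apply: ge0_ler_powR; rewrite ?nnegrE// (le_trans x0).
Qed.

Lemma powR_lt (R : realType) (r x y : R) : 0 < r -> 0 <= x -> x < y ->
  x `^ r < y `^ r.
Proof.
move=> r0 x0 xy; apply: gt0_ltr_powR; rewrite ?nnegrE//.
by rewrite (le_trans x0)// ltW.
Qed.

Lemma powR_le_comparable (R : realType) (c x y b : R) : 1 <= c -> 0 < x ->
  0 < y -> y <= c * x -> x <= c * y -> x `^ b <= c `^ `|b| * y `^ b.
Proof.
move=> c1 x0 y0 yx xy; have c0 : 0 <= c by rewrite (le_trans ler01).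
have [b0|b0] := leP 0 b.
  by rewrite ger0_norm// -powRM// ?powR_le// ltW.
rewrite ltr0_norm// -[in leLHS](opprK b) -[in X in _ * X](opprK b) !(powRN _ (- b)).
rewrite ler_pdivlMr ?powR_gt0// mulrC ler_pdivrMr ?powR_gt0//.
by rewrite -powRM ?(ltW x0)// powR_le ?oppr_ge0// ltW.
Qed.

Section power_integrals.
Context d (T : measurableType d) (R : realType).
Variable mu : {measure set T -> \bar R}.

Lemma geometric_sum_le (a : R) (N : nat) : 0 <= a < 1 ->
  \sum_(0 <= k < N) a ^+ k <= (1 - a)^-1.
Proof.
move=> /andP[a0 a1]; rewrite -[leRHS]mul1r ler_pdivlMr ?subr_gt0// big_mkord.
by rewrite mulrC -[1 - a]opprB mulNr -subrX1 opprB lerBlDr lerDl exprn_ge0.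
Qed.

(** Layers whose contributions decay geometrically add up. *)
Lemma integral_le_geometric_layers (phi u : T -> R) (A B nu theta : R)
    (a rho : nat -> R) :
  measurable_fun setT u -> 0 <= A -> 0 <= theta < 1 ->
  (forall r : R, 0 < r -> (mu [set y | (u y < r)%R] <= (A * r `^ nu)%:E)%E) ->
  (forall k, 0 <= a k) -> (forall k, 0 < rho k) ->
  (forall k, a k * rho k `^ nu <= B * theta ^+ k) ->
  (forall y, 0 <= phi y) ->
  (forall y, phi y = 0 \/ exists k, u y < rho k /\ phi y <= a k) ->
  (\int[mu]_y (phi y)%:E <= (A * B / (1 - theta))%:E)%E.
Proof.
move=> mu_ A0 /andP[th0 th1] ball a0 rho0 ab phi0 phia.
have mU k : measurable [set y | u y < rho k].
  have := mu_ measurableT _ (measurable_itv `]-oo, rho k[).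
  by rewrite setTI; congr measurable; apply/seteqP; split => y; rewrite /= in_itv.
pose F k y : \bar R := ((a k)%:E * (\1_[set z | (u z < rho k)%R] y)%:E)%E.
have F0 k y : (0 <= F k y)%E by rewrite mule_ge0 ?lee_fin.
have mF k : measurable_fun setT (F k).
  by apply: measurable_funeM; apply/measurable_EFinP; exact: measurable_indic.
apply: (@le_trans _ _ (\int[mu]_y (\sum_(k <oo) F k y))%E).
  apply: ge0_le_integral_nonmeas => y _; first by rewrite lee_fin.
  have [->|[k [uk pk]]] := phia y; first by apply: nneseries_ge0.
  apply: (@le_trans _ _ (\sum_(0 <= i < k.+1) F i y)%E); last first.
    by apply: nneseries_lim_ge => *; exact: F0.
  rewrite big_nat_recr//= /F indicE mem_set//= mule1.
  apply: (@le_trans _ _ (a k)%:E); first by rewrite lee_fin.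
  by rewrite leeDr//; apply: sume_ge0 => i _; exact: F0.
rewrite integral_nneseries//.
apply: lime_le.
  by apply: is_cvg_nneseries => k _ _; exact: integral_ge0.
apply: nearW => N.
apply: (@le_trans _ _ (\sum_(0 <= k < N) (A * B * theta ^+ k)%:E)%E).
  apply: lee_sum => k _; rewrite /F ge0_integralZl_EFin//; last first.
    by apply/measurable_EFinP; exact: measurable_indic.
  rewrite integral_indic// setIT.
  apply: le_trans (lee_wpmul2l _ (ball _ (rho0 k))) _; first by rewrite lee_fin.
  rewrite -EFinM lee_fin mulrCA -mulrA ler_wpM2l//.
rewrite sumEFin lee_fin -mulr_sumr ler_wpM2l ?geometric_sum_le ?th0//.
rewrite mulr_ge0//; have := ab 0%N; rewrite expr0 mulr1; apply: le_trans.
by rewrite mulr_ge0 ?powR_ge0.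
Qed.

Section powers.
Variables (nu A : R).
Hypothesis A0 : 0 <= A.
Hypothesis nu0 : 0 < nu.

(** The constant comes from the measure of the balls only, so it is the same for
    the distances to all points. *)
Lemma integral_powR_near (b : R) : b < nu -> exists2 C : R, 0 < C &
  forall u : T -> R, measurable_fun setT u -> (forall y, 0 <= u y) ->
  (forall r : R, 0 < r -> (mu [set y | (u y < r)%R] <= (A * r `^ nu)%:E)%E) ->
  forall r : R, 0 < r ->
  (\int[mu]_y (u y `^ (- b) * (u y < r)%R%:R)%:E <= (C * r `^ (nu - b))%:E)%E.
Proof.
move=> bnu; pose h : R := 2^-1.
have h0 : 0 < h by rewrite invr_gt0.
have h1 : h < 1 by rewrite invf_lt1// ltr1n.
pose th := h `^ (nu - b).
have th0 : 0 < th by exact: powR_gt0.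
have th1 : th < 1.
  by rewrite -[ltRHS](congr1 (@^~ (nu - b)) (@powR1 R)) powR_lt ?subr_gt0// ltW.
exists ((A + 1) * 2 `^ `|b| / (1 - th)).
  by rewrite divr_gt0 ?subr_gt0// mulr_gt0 ?powR_gt0// ltr_wpDl.
move=> u mu_ u0 ball r r0.
apply: (@le_trans _ _ _ _ _ (@integral_le_geometric_layers
  (fun y => u y `^ (- b) * (u y < r)%R%:R) u A
  (2 `^ `|b| * r `^ (nu - b)) nu th
  (fun k => 2 `^ `|b| * (r * h ^+ k) `^ (- b)) (fun k => r * h ^+ k)
  _ _ _ _ _ _ _ _ _)) => //.
- by rewrite (ltW th0) th1.
- by move=> k; rewrite mulr_ge0 ?powR_ge0.
- by move=> k; rewrite mulr_gt0 ?exprn_gt0.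
- move=> k; rewrite -!mulrA ler_wpM2l ?powR_ge0//.
  have rh0 : r * h ^+ k != 0 by rewrite mulf_neq0 ?expf_neq0 ?gt_eqF.
  rewrite -powRD; last by rewrite rh0 implybT.
  rewrite [- b + nu]addrC powRM ?exprn_ge0 ?(ltW h0) ?(ltW r0)//.
  by rewrite -(powR_mulrn k (ltW h0)) -(powR_mulrn k (ltW th0)) powRAC.
- by move=> y; rewrite mulr_ge0 ?powR_ge0.
- move=> y; have [ur|ur] := ltP (u y) r; last by left; rewrite mulr0.
  right; rewrite mulr1.
  have [uy0|uy0] := eqVneq (u y) 0.
    exists 0%N; rewrite expr0 mulr1; split => //; rewrite uy0.
    have [->|b0] := eqVneq b 0.
      by rewrite !(oppr0, powRr0, normr0, mulr1).
    by rewrite powR0 ?oppr_eq0// mulr_ge0 ?powR_ge0.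
  have {}uy0 : 0 < u y by rewrite lt_neqAle eq_sym uy0 u0.
  have ex : exists k, r * h ^+ k.+1 <= u y.
    exists (Num.bound (r / u y)); rewrite exprVn ler_pdivrMr ?exprn_gt0//.
    rewrite mulrC -ler_pdivrMr//.
    have ub := @archi_boundP _ (r / u y) (divr_ge0 (ltW r0) (ltW uy0)).
    by rewrite (le_trans (ltW ub))// -natrX ler_nat ltnW// ltnW// ltn_expl.
  have := ex_minnP ex => -[k hk kmin].
  have uk : u y < r * h ^+ k.
    case: k hk kmin => [|k] hk kmin; first by rewrite expr0 mulr1.
    by rewrite ltNge; apply/negP => /kmin; rewrite ltnn.
  exists k; split => //.
  have rk0 : 0 < r * h ^+ k by rewrite mulr_gt0 ?exprn_gt0.
  rewrite -[`|b|]normrN; apply: powR_le_comparable => //; first by rewrite ler1n.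
    by move: hk; rewrite exprSr mulrA /h; lra.
  by rewrite (le_trans (ltW uk))// ler_peMl ?ltW// ltr1n.
- rewrite lee_fin -subr_ge0 (_ : _ - _ = 2 `^ `|b| * r `^ (nu - b) / (1 - th)).
    by rewrite divr_ge0 ?subr_ge0 ?(ltW th1)// mulr_ge0 ?powR_ge0.
  by rewrite !mulrDl mul1r; ring.
Qed.

Lemma integral_powR_far (b : R) : nu < b -> exists2 C : R, 0 < C &
  forall u : T -> R, measurable_fun setT u -> (forall y, 0 <= u y) ->
  (forall r : R, 0 < r -> (mu [set y | (u y < r)%R] <= (A * r `^ nu)%:E)%E) ->
  forall r : R, 0 < r ->
  (\int[mu]_y (u y `^ (- b) * (r <= u y)%R%:R)%:E <= (C * r `^ (nu - b))%:E)%E.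
Proof.
move=> nub.
pose th : R := 2 `^ (nu - b).
have th0 : 0 < th by exact: powR_gt0.
have th1 : th < 1.
  rewrite /th -opprB powRN invf_lt1 ?powR_gt0//.
  rewrite -[ltLHS](congr1 (@^~ (b - nu)) (@powR1 R)) powR_lt ?subr_gt0//.
  by rewrite ltr1n.
exists ((A + 1) * 2 `^ nu / (1 - th)).
  by rewrite divr_gt0 ?subr_gt0// mulr_gt0 ?powR_gt0// ltr_wpDl.
move=> u mu_ u0 ball r r0.
apply: (@le_trans _ _ _ _ _ (@integral_le_geometric_layers
  (fun y => u y `^ (- b) * (r <= u y)%R%:R) u A
  (2 `^ nu * r `^ (nu - b)) nu th
  (fun k => (r * 2 ^+ k) `^ (- b)) (fun k => r * 2 ^+ k.+1)
  _ _ _ _ _ _ _ _ _)) => //.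
- by rewrite (ltW th0) th1.
- by move=> k; rewrite powR_ge0.
- by move=> k; rewrite mulr_gt0 ?exprn_gt0.
- move=> k; rewrite exprSr mulrA [in X in _ * X]powRM ?mulr_ge0 ?exprn_ge0 ?(ltW r0)//.
  have rh0 : r * 2 ^+ k != 0 by rewrite mulf_neq0 ?expf_neq0 ?gt_eqF.
  rewrite mulrA -powRD; last by rewrite rh0 implybT.
  rewrite [- b + nu]addrC powRM ?exprn_ge0 ?(ltW r0)//.
  by rewrite -!powR_mulrn ?(ltW th0)// powRAC [leLHS]mulrC mulrA.
- by move=> y; rewrite mulr_ge0 ?powR_ge0.
- move=> y; have [ur|ur] := leP r (u y); last by left; rewrite mulr0.
  right; rewrite mulr1.
  have uy0 : 0 < u y by exact: lt_le_trans ur.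
  have ex : exists k, u y < r * 2 ^+ k.+1.
    exists (Num.bound (u y / r)); rewrite mulrC -ltr_pdivrMr//.
    have ub := @archi_boundP _ (u y / r) (divr_ge0 (ltW uy0) (ltW r0)).
    by rewrite (lt_le_trans ub)// -natrX ler_nat ltnW// ltnW// ltn_expl.
  have := ex_minnP ex => -[k hk kmin].
  have uk : r * 2 ^+ k <= u y.
    case: k hk kmin => [|k] hk kmin; first by rewrite expr0 mulr1.
    by rewrite leNgt; apply/negP => /kmin; rewrite ltnn.
  exists k; split => //.
  have rk0 : 0 < r * 2 ^+ k by rewrite mulr_gt0 ?exprn_gt0.
  have b0 : 0 <= b by rewrite ltW// (lt_trans nu0).
  by rewrite !powRN lef_pV2 ?posrE ?powR_gt0// powR_le// ltW.
- rewrite lee_fin -subr_ge0 (_ : _ - _ = 2 `^ nu * r `^ (nu - b) / (1 - th)).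
    by rewrite divr_ge0 ?subr_ge0 ?(ltW th1)// mulr_ge0 ?powR_ge0.
  by rewrite !mulrDl mul1r; ring.
Qed.

End powers.
End power_integrals.

(** * Positive bilinear forms and integral operators *)

Section measurability_lemmas.
Context d (T : measurableType d) (R : realType).

Lemma measurable_fun_nat_bool (D : set T) (b : T -> bool) :
  measurable_fun D b -> measurable_fun D (fun x => (b x)%:R : R).
Proof. by move=> mb; apply: (measurableT_comp (f := fun c : bool => c%:R : R)). Qed.

Lemma measurable_fun_powR (D : set T) (f : T -> R) (a : R) :
  measurable_fun D f -> measurable_fun D (fun x => f x `^ a).
Proof.
by move=> mf; apply: (measurableT_comp (f := fun x : R => x `^ a)).
Qed.

Lemma measurable_fun_expR (D : set T) (f : T -> R) :
  measurable_fun D f -> measurable_fun D (fun x => expR (f x)).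
Proof. by move=> mf; apply: (measurableT_comp (f := expR)). Qed.

Lemma measurable_fun_inv (D : set T) (f : T -> R) :
  measurable_fun D f -> measurable_fun D (fun x => (f x)^-1).
Proof.
move=> mf; rewrite (_ : (fun x => _) = (fun x => f x * (f x * f x) `^ (-1))).
  apply: measurable_funM => //; apply: measurable_fun_powR.
  exact: measurable_funM.
apply/funext => x; rewrite powR_inv1 -?expr2 ?sqr_ge0//.
have [->|f0] := eqVneq (f x) 0; first by rewrite invr0 mul0r.
by rewrite expr2 invfM mulrA mulfV// mul1r.
Qed.

End measurability_lemmas.

Ltac measurability := repeat first
  [ assumption
  | lazymatch goal with
    | |- measurable_fun _ (fun x => EFin (@?f x)) => apply/measurable_EFinP
    | |- measurable_fun _ (fun x => GRing.mul (@?f x) (@?g x)) =>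
        apply: (@measurable_funM _ _ _ _ f g)
    | |- measurable_fun _ (fun x => GRing.add (@?f x) (@?g x)) =>
        apply: (@measurable_funD _ _ _ _ f g)
    | |- measurable_fun _ (fun x => GRing.opp (@?f x)) =>
        apply: (@measurable_funN _ _ _ _ f)
    | |- measurable_fun _ (fun x => GRing.inv (@?f x)) =>
        apply: (@measurable_fun_inv _ _ _ _ f)
    | |- measurable_fun _ (fun x => expR (@?f x)) =>
        apply: (@measurable_fun_expR _ _ _ _ f)
    | |- measurable_fun _ (fun x => powR (@?f x) ?a) =>
        apply: (@measurable_fun_powR _ _ _ _ f a)
    | |- measurable_fun _ (fun x => (nat_of_bool (@?b x))%:R) =>
        apply: (@measurable_fun_nat_bool _ _ _ _ b)
    | |- measurable_fun _ (fun x => andb (@?a x) (@?b x)) =>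
        apply: (@measurable_and _ _ _ a b)
    | |- measurable_fun _ (fun x => Order.lt (@?f x) (@?g x)) =>
        apply: (@measurable_fun_ltr _ _ _ _ f g)
    | |- measurable_fun _ (fun x => Order.le (@?f x) (@?g x)) =>
        apply: (@measurable_fun_ler _ _ _ _ f g)
    | |- measurable_fun _ (fun x => ?c) => exact: measurable_cst
    | |- measurable_fun _ (fun x => x) => exact: measurable_id
    | |- measurable_fun _ fst => exact: measurable_fst
    | |- measurable_fun _ snd => exact: measurable_snd
    end ].

(** A weighted geometric mean is at most the largest of its entries. *)
Lemma geometric_mean3_le (R : realType) (a b c u v w : R) :
  0 <= a -> 0 <= b -> 0 <= c -> 0 <= u -> 0 <= v -> 0 <= w ->
  u + v + w = 1 -> a `^ u * b `^ v * c `^ w <= a + b + c.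
Proof.
move=> a0 b0 c0 u0 v0 w0 uvw.
have [s0|s0] := eqVneq (a + b + c) 0.
  have [-> -> ->] : [/\ a = 0, b = 0 & c = 0] by split; lra.
  have [u_|u_] := eqVneq u 0; last by rewrite powR0// !mul0r !addr0.
  have [v_|v_] := eqVneq v 0; last by rewrite (powR0 v_) mulr0 mul0r !addr0.
  by rewrite (@powR0 _ w) ?mulr0 ?addr0//; apply/eqP; lra.
rewrite -[leRHS]powRr1 ?addr_ge0// -uvw !powRD; [|by rewrite s0 implybT..].
by rewrite !ler_pM ?mulr_ge0 ?powR_ge0// powR_le//; lra.
Qed.

Section forms.
Context d (T : measurableType d) (R : realType).
Variable mu : {sigma_finite_measure set T -> \bar R}.
Implicit Types (k H : T -> T -> R) (f g : T -> R) (p q C : R).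

(** The bound that duality turns into an estimate from L^p to L^q. *)
Definition form_le p q' k C := forall f g,
  measurable_fun setT f -> measurable_fun setT g ->
  (forall x, 0 <= f x) -> (forall x, 0 <= g x) ->
  (\int[mu]_y (f y `^ p)%:E <= 1)%E -> (\int[mu]_x (g x `^ q')%:E <= 1)%E ->
  (\int[(mu \x mu)%E]_z (g z.1 * k z.1 z.2 * f z.2)%:E <= C%:E)%E.

Definition measurable_kernel k :=
  measurable_fun setT (fun z : T * T => k z.1 z.2).

Lemma measurable_kernel1 k x : measurable_kernel k -> measurable_fun setT (k x).
Proof. by move=> mk; have := measurable_fun_pair2 x mk. Qed.

Lemma measurable_kernel2 k y :
  measurable_kernel k -> measurable_fun setT (k ^~ y).
Proof. by move=> mk; have := measurable_fun_pair1 y mk. Qed.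

Lemma prod_integral_le1 (F : T * T -> R) (psi : T -> R) C :
  measurable_fun setT F -> (forall z, 0 <= F z) ->
  measurable_fun setT psi -> (forall x, 0 <= psi x) -> 0 <= C ->
  (forall x, (\int[mu]_y (F (x, y))%:E <= (C * psi x)%:E)%E) ->
  (\int[mu]_x (psi x)%:E <= 1)%E ->
  (\int[(mu \x mu)%E]_z (F z)%:E <= C%:E)%E.
Proof.
move=> mF F0 mpsi psi0 C0 Fpsi psi1.
rewrite (fubini_tonelli1 (EFin \o F))//; last exact/measurable_EFinP.
apply: (@le_trans _ _ (\int[mu]_x (C * psi x)%:E)%E).
  apply: ge0_le_integral_nonmeas => x _; last exact: Fpsi.
  by apply: integral_ge0 => y _; rewrite lee_fin.
under eq_integral do rewrite EFinM.
rewrite ge0_integralZl_EFin//; [|by move=> x _; rewrite lee_fin|exact/measurable_EFinP].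
by rewrite -[leRHS]mule1 lee_wpmul2l// lee_fin.
Qed.

Lemma prod_integral_le2 (F : T * T -> R) (psi : T -> R) C :
  measurable_fun setT F -> (forall z, 0 <= F z) ->
  measurable_fun setT psi -> (forall x, 0 <= psi x) -> 0 <= C ->
  (forall y, (\int[mu]_x (F (x, y))%:E <= (C * psi y)%:E)%E) ->
  (\int[mu]_x (psi x)%:E <= 1)%E ->
  (\int[(mu \x mu)%E]_z (F z)%:E <= C%:E)%E.
Proof.
move=> mF F0 mpsi psi0 C0 Fpsi psi1.
rewrite (fubini_tonelli2 (EFin \o F))//; last exact/measurable_EFinP.
apply: (@le_trans _ _ (\int[mu]_x (C * psi x)%:E)%E).
  apply: ge0_le_integral_nonmeas => x _; last exact: Fpsi.
  by apply: integral_ge0 => y _; rewrite lee_fin.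
under eq_integral do rewrite EFinM.
rewrite ge0_integralZl_EFin//; [|by move=> x _; rewrite lee_fin|exact/measurable_EFinP].
by rewrite -[leRHS]mule1 lee_wpmul2l// lee_fin.
Qed.

Lemma integral_sum_le d' (T' : measurableType d')
    (nu : {measure set T' -> \bar R}) n (F : T' -> R) (G : 'I_n -> T' -> R)
    (C : 'I_n -> R) :
  (forall i, measurable_fun setT (G i)) -> (forall i z, 0 <= G i z) ->
  (forall z, 0 <= F z <= \sum_(i < n) G i z) ->
  (forall i, (\int[nu]_z (G i z)%:E <= (C i)%:E)%E) ->
  (\int[nu]_z (F z)%:E <= (\sum_(i < n) C i)%:E)%E.
Proof.
move=> mG G0 FG GC.
apply: (@le_trans _ _ (\int[nu]_z (\sum_(i < n) (G i z)%:E))%E).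
  apply: ge0_le_integral_nonmeas => z _; have /andP[F0 FGz] := FG z.
    by rewrite lee_fin.
  by rewrite sumEFin lee_fin.
rewrite ge0_integral_sum//; last 2 first.
- by move=> i; exact/measurable_EFinP.
- by move=> i z _; rewrite lee_fin.
by rewrite -sumEFin; apply: lee_sum.
Qed.

Lemma form_le_sum p q' n k (K : 'I_n -> T -> T -> R) (C : 'I_n -> R) :
  (forall i, measurable_kernel (K i)) -> (forall i x y, 0 <= K i x y) ->
  (forall x y, 0 <= k x y <= \sum_(i < n) K i x y) ->
  (forall i, form_le p q' (K i) (C i)) -> form_le p q' k (\sum_(i < n) C i).
Proof.
move=> mK K0 kK KC f g mf mg f0 g0 f1 g1.
apply: (integral_sum_le (G := fun i z => g z.1 * K i z.1 z.2 * f z.2)).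
- move=> i; apply: measurable_funM; last exact: measurableT_comp.
  by apply: measurable_funM; [exact: measurableT_comp|exact: mK].
- by move=> i z; rewrite !mulr_ge0.
- move=> z; have /andP[k0 kz] := kK z.1 z.2; rewrite !mulr_ge0//=.
  by rewrite -mulr_suml -mulr_sumr ler_wpM2r// ler_wpM2l.
- by move=> i; exact: KC.
Qed.

(** Schur's test. The kernel splits into two factors, of which one is
    integrable in each variable; the excess of the exponent [q] over [p] is
    carried by the product of the two normalized functions. *)
Lemma form_le_schur p q p' q' k H1 H2 (c A B : R) :
  1 < p -> p <= q -> p^-1 + p'^-1 = 1 -> q^-1 + q'^-1 = 1 ->
  0 <= c -> 0 <= A -> 0 <= B ->
  measurable_kernel H1 -> measurable_kernel H2 ->
  (forall x y, 0 <= H1 x y) -> (forall x y, 0 <= H2 x y) ->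
  (forall x y, 0 <= k x y <= c * (H1 x y `^ q^-1 * H2 x y `^ p'^-1)) ->
  (forall y, (\int[mu]_x (H1 x y)%:E <= A%:E)%E) ->
  (forall x, (\int[mu]_y (H2 x y)%:E <= B%:E)%E) ->
  form_le p q' k (c * (A + B + 1)).
Proof.
move=> p1 pq pp' qq' c0 A0 B0 mH1 mH2 H10 H20 kH HA HB f g mf mg f0 g0 f1 g1.
have p0 : 0 < p by lra.
have q0 : 0 < q by lra.
have pV1 : p^-1 < 1 by rewrite invf_lt1.
have pV0 : 0 < p^-1 by rewrite invr_gt0.
have qV0 : 0 < q^-1 by rewrite invr_gt0.
have qpV : q^-1 <= p^-1 by rewrite lef_pV2.
have q'V0 : 0 < q'^-1 by lra.
have q'0 : 0 < q' by rewrite -invr_gt0.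
have mf2 : measurable_fun setT (fun z : T * T => f z.2) by exact: measurableT_comp.
have mg1 : measurable_fun setT (fun z : T * T => g z.1) by exact: measurableT_comp.
pose G (i : 'I_3) (z : T * T) : R :=
  [tuple c * (f z.2 `^ p * H1 z.1 z.2); c * (g z.1 `^ q' * H2 z.1 z.2);
         c * (f z.2 `^ p * g z.1 `^ q')]`_i.
pose C' (i : 'I_3) : R := [tuple c * A; c * B; c]`_i.
have -> : c * (A + B + 1) = \sum_(i < 3) C' i.
  by rewrite !big_ord_recl big_ord0 /C'/=; ring.
apply: (integral_sum_le (G := G)).
- by move=> [[|[|[|i]]] i3]//; rewrite /G/=; measurability.
- by move=> [[|[|[|i]]] i3] z//; rewrite /G/= !mulr_ge0 ?powR_ge0.
- move=> z; have /andP[k0 kz] := kH z.1 z.2; rewrite !mulr_ge0//=.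
  rewrite !big_ord_recl big_ord0 /G/= addr0 addrA -!mulrDr.
  set a := H1 _ _; set b := H2 _ _; set F := f z.2; set h := g z.1.
  have a0 : 0 <= a by exact: H10.
  have b0 : 0 <= b by exact: H20.
  have F0 : 0 <= F by exact: f0.
  have h0 : 0 <= h by exact: g0.
  have -> : h * k z.1 z.2 * F = (h * F) * k z.1 z.2 by ring.
  apply: (@le_trans _ _ (h * F * (c * (a `^ q^-1 * b `^ p'^-1)))).
    by rewrite ler_wpM2l ?mulr_ge0.
  rewrite mulrCA ler_wpM2l//.
  apply: le_trans (@geometric_mean3_le _ (F `^ p * a) (h `^ q' * b)
    (F `^ p * h `^ q') q^-1 p'^-1 (p^-1 - q^-1) _ _ _ _ _ _ _).
  + rewrite !powRM ?powR_ge0 -?powRrM//.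
    rewrite le_eqVlt; apply/orP; left; apply/eqP.
    have E1 : p / q + p * (p^-1 - q^-1) = 1 by field; rewrite ?gt_eqF.
    have E2 : q' / p' + q' * (p^-1 - q^-1) = 1.
      rewrite -mulrDr (_ : p'^-1 + _ = q'^-1); last by lra.
      by rewrite mulfV ?gt_eqF.
    transitivity (F `^ (p / q + p * (p^-1 - q^-1)) *
      h `^ (q' / p' + q' * (p^-1 - q^-1)) * (a `^ q^-1 * b `^ p'^-1)).
      by rewrite E1 E2 !powRr1// [h * F]mulrC.
    rewrite !powRD; [by ring|by rewrite E2 oner_eq0|by rewrite E1 oner_eq0].
  + by rewrite mulr_ge0 ?powR_ge0.
  + by rewrite mulr_ge0 ?powR_ge0.
  + by rewrite mulr_ge0 ?powR_ge0.
  + exact: ltW.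
  + lra.
  + lra.
  + lra.
- move=> [[|[|[|i]]] i3]//; rewrite /G /C'/=.
  + apply: (prod_integral_le2 (psi := fun y => f y `^ p)) => //.
    * by measurability.
    * by move=> z; rewrite !mulr_ge0 ?powR_ge0.
    * exact: measurable_fun_powR.
    * by move=> y; rewrite powR_ge0.
    * by rewrite mulr_ge0.
    * move=> y /=; under eq_integral do rewrite mulrA EFinM.
      rewrite ge0_integralZl_EFin ?mulr_ge0 ?powR_ge0//.
      - rewrite (_ : c * A * _ = c * f y `^ p * A); last by ring.
        by rewrite [leRHS]EFinM lee_wpmul2l// lee_fin mulr_ge0 ?powR_ge0.
      - by move=> x _; rewrite lee_fin.
      - by apply/measurable_EFinP; exact: measurable_kernel2.
  + apply: (prod_integral_le1 (psi := fun y => g y `^ q')) => //.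
    * by measurability.
    * by move=> z; rewrite !mulr_ge0 ?powR_ge0.
    * exact: measurable_fun_powR.
    * by move=> y; rewrite powR_ge0.
    * by rewrite mulr_ge0.
    * move=> x /=; under eq_integral do rewrite mulrA EFinM.
      rewrite ge0_integralZl_EFin ?mulr_ge0 ?powR_ge0//.
      - rewrite (_ : c * B * _ = c * g x `^ q' * B); last by ring.
        by rewrite [leRHS]EFinM lee_wpmul2l// lee_fin mulr_ge0 ?powR_ge0.
      - by move=> y _; rewrite lee_fin.
      - by apply/measurable_EFinP; exact: measurable_kernel1.
  + apply: (prod_integral_le1 (psi := fun y => g y `^ q')) => //.
    * by measurability.
    * by move=> z; rewrite !mulr_ge0 ?powR_ge0.
    * exact: measurable_fun_powR.
    * by move=> y; rewrite powR_ge0.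
    * move=> x /=; under eq_integral do rewrite mulrCA mulrC EFinM.
      rewrite ge0_integralZl_EFin ?mulr_ge0 ?powR_ge0//.
      - by rewrite -[leRHS]mule1 lee_wpmul2l// lee_fin mulr_ge0 ?powR_ge0.
      - by move=> y _; rewrite lee_fin powR_ge0.
      - by apply/measurable_EFinP; exact: measurable_fun_powR.
Qed.

End forms.

(** * The Hardy-Littlewood-Sobolev inequality *)

Section hls.
Context d (T : measurableType d) (R : realType).
Variable mu : {sigma_finite_measure set T -> \bar R}.
Variables (nu A : R).
Hypotheses (nu0 : 0 < nu) (A0 : 0 <= A).

(** Functions that look like the distance to a point, as far as the measure of
    balls is concerned. *)
Definition ball_regular (u : T -> R) := [/\ measurable_fun setT u,
  (forall y, 0 <= u y) &
  (forall r : R, 0 < r -> (mu [set y | (u y < r)%R] <= (A * r `^ nu)%:E)%E)].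

(** For a fixed value [c] of one of the two functions, the distance is cut at the
    radius whose ball has volume about [c^(- p)]; the powers of [c] are those for
    which both pieces scale like [c^p]. *)
Lemma hls_levels (lam p q q' : R) : 1 < p -> 1 < q -> q^-1 + q'^-1 = 1 ->
  0 < lam < nu -> q^-1 = p^-1 + lam / nu - 1 ->
  exists2 C : R, 0 < C & forall u, ball_regular u -> forall c : R, 0 <= c ->
  (\int[mu]_y (c `^ ((1 - p / q') * q) * (u y `^ (- (lam * q)) *
     (1 <= u y `^ nu * c `^ p)%R%:R))%:E <= (C * c `^ p)%:E)%E /\
  (\int[mu]_y (c `^ (1 + p / q') * (u y `^ (- lam) *
     (u y `^ nu * c `^ p < 1)%R%:R))%:E <= (C * c `^ p)%:E)%E.
Proof.
move=> p1 q1 qq' /andP[lam0 lamnu] rel.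
have p0 : 0 < p by lra.
have q0 : 0 < q by lra.
have far : nu < lam * q.
  have pV1 : p^-1 < 1 by rewrite invf_lt1.
  have : q^-1 < lam / nu by lra.
  by rewrite ltr_pdivlMr// mulrC ltr_pdivrMr.
have [C1 C10 HC1] := integral_powR_far mu A0 nu0 far.
have [C2 C20 HC2] := integral_powR_near mu A0 lamnu.
have relq' : q'^-1 = 1 - q^-1 by lra.
have pV : p * p^-1 = 1 by rewrite mulfV ?gt_eqF.
have qV : q * q^-1 = 1 by rewrite mulfV ?gt_eqF.
exists (C1 + C2); first by rewrite addr_gt0.
move=> u [mu_ u0 ball] c c0; have [->|cN0] := eqVneq c 0.
  rewrite (powR0 (lt0r_neq0 p0)) !mulr0; split.
    under eq_integral do rewrite mulr0 ler10 !mulr0.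
    by rewrite integral0.
  under eq_integral.
    move=> y _; rewrite mulr0 powR0 ?mul0r; first over.
    rewrite relq' lt0r_neq0// addr_gt0// mulr_gt0// subr_gt0 invf_lt1//.
  by rewrite integral0.
have {cN0} c0 : 0 < c by rewrite lt_neqAle eq_sym cN0.
have cp0 : 0 < c `^ p by exact: powR_gt0.
pose rho := c `^ (- (p / nu)).
have rho0 : 0 < rho by exact: powR_gt0.
have rhonu : rho `^ nu = (c `^ p)^-1.
  by rewrite -powRrM mulNr divfK ?gt_eqF// powRN.
have condE y : (1 <= u y `^ nu * c `^ p) = (rho <= u y).
  rewrite -ler_pdivrMr// mul1r -rhonu; apply/idP/idP => [|ur].
    by apply: contra_le => ur; exact: powR_lt.
  by apply: powR_le => //; exact: ltW.
have cE a b : a + - (p / nu) * b = p -> c `^ a * rho `^ b = c `^ p.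
  by move=> <-; rewrite powRD ?powRrM// (gt_eqF c0) implybT.
split.
- under eq_integral do rewrite condE EFinM.
  rewrite ge0_integralZl_EFin ?powR_ge0//; last 2 first.
  + by move=> y _; rewrite lee_fin mulr_ge0 ?powR_ge0.
  + by measurability.
  apply: (@le_trans _ _ (c `^ ((1 - p / q') * q) *
                         (C1 * rho `^ (nu - lam * q)))%:E).
    by rewrite EFinM lee_wpmul2l ?lee_fin ?powR_ge0// HC1.
  rewrite lee_fin mulrCA cE; first by rewrite ler_wpM2r ?(ltW cp0)// lerDl ltW.
  have -> : (1 - p / q') * q + - (p / nu) * (nu - lam * q) =
    q - p * q * q'^-1 - p * (nu / nu) + p * q * (lam / nu) by ring.
  rewrite divff ?gt_eqF// (_ : lam / nu = 1 + q^-1 - p^-1); last by lra.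
  rewrite relq'.
  transitivity (q + p * (q * q^-1) * 2 - p - q * (p * p^-1)); first by ring.
  by rewrite pV qV; ring.
- under eq_integral do rewrite ltNge condE -ltNge EFinM.
  rewrite ge0_integralZl_EFin ?powR_ge0//; last 2 first.
  + by move=> y _; rewrite lee_fin mulr_ge0 ?powR_ge0.
  + by measurability.
  apply: (@le_trans _ _ (c `^ (1 + p / q') * (C2 * rho `^ (nu - lam)))%:E).
    by rewrite EFinM lee_wpmul2l ?lee_fin ?powR_ge0// HC2.
  rewrite lee_fin mulrCA cE; first by rewrite ler_wpM2r ?(ltW cp0)// lerDr ltW.
  have -> : (1 + p / q') + - (p / nu) * (nu - lam) =
    1 + p * q'^-1 - p * (nu / nu) + p * (lam / nu) by ring.
  rewrite divff ?gt_eqF// (_ : lam / nu = 1 + q^-1 - p^-1); last by lra.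
  rewrite relq'.
  transitivity (1 + p - p * p^-1); first by ring.
  by rewrite pV; ring.
Qed.

(** The first four terms compare the volume of the ball of radius [D], the distance
    between the points, with the two functions; integrated in the other
    variable they become a multiple of [f^p] or [g^q']. Where both functions are
    small relative to that ball, the larger one decides. *)
Lemma hls_pointwise (p q p' q' lam D f g : R) : 0 < p -> 0 < q ->
  0 < p' -> 0 < q' -> p^-1 + p'^-1 = 1 -> q^-1 + q'^-1 = 1 ->
  0 <= D -> 0 <= f -> 0 <= g ->
  g * D `^ (- lam) * f <=
    f `^ ((1 - p / q') * q) * (D `^ (- (lam * q)) * (1 <= D `^ nu * f `^ p)%R%:R)
  + g `^ ((1 - q' / p) * p') *
      (D `^ (- (lam * p')) * (1 <= D `^ nu * g `^ q')%R%:R)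
  + f `^ (1 + p / q') * (D `^ (- lam) * (D `^ nu * f `^ p < 1)%R%:R)
  + g `^ (1 + q' / p) * (D `^ (- lam) * (D `^ nu * g `^ q' < 1)%R%:R)
  + f `^ p * g `^ q'.
Proof.
move=> p0 q0 p'0 q'0 pp' qq' D0 f0 g0; set K := D `^ (- lam).
have K0 : 0 <= K by exact: powR_ge0.
have case1 (P Q P' Q' F G : R) : 0 < P -> 0 < Q -> 0 < Q' ->
    Q^-1 + Q'^-1 = 1 -> 0 <= F -> 0 <= G ->
    G * K * F <= F `^ ((1 - P / Q') * Q) * D `^ (- (lam * Q)) + F `^ P * G `^ Q'.
  move=> P0 Q0 Q'0 QQ' F0 G0.
  have Qn : Q != 0 by rewrite gt_eqF.
  have Q'n : Q' != 0 by rewrite gt_eqF.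
  set a := F `^ _ * _; set b := F `^ P * _.
  have a0 : 0 <= a by rewrite mulr_ge0 ?powR_ge0.
  have b0 : 0 <= b by rewrite mulr_ge0 ?powR_ge0.
  have QV0 : 0 <= Q^-1 by rewrite invr_ge0 ltW.
  have Q'V0 : 0 <= Q'^-1 by rewrite invr_ge0 ltW.
  have uvw : Q^-1 + Q'^-1 + 0 = 1 by rewrite addr0.
  have := geometric_mean3_le a0 b0 (lexx 0) QV0 Q'V0 (lexx 0) uvw.
  rewrite powRr0 mulr1 addr0; apply: le_trans; rewrite /a /b.
  rewrite !powRM ?powR_ge0 -?powRrM// mulfK// mulfV// powRr1//.
  rewrite (_ : - (lam * Q) / Q = - lam) -/K; last by rewrite mulNr mulfK.
  rewrite le_eqVlt; apply/orP; left; apply/eqP.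
  transitivity (F `^ (1 - P / Q' + P / Q') * (K * G)).
    by rewrite subrK powRr1//; ring.
  rewrite powRD; first by ring.
  by rewrite subrK oner_eq0.
have case2 (P Q' F G : R) : 0 < P -> 0 < Q' -> 0 <= F -> 0 <= G ->
    G `^ Q' <= F `^ P -> G * K * F <= F `^ (1 + P / Q') * K.
  move=> P0 Q'0 F0 G0 GF.
  rewrite powRD; last by rewrite gt_eqF// addr_gt0// divr_gt0.
  rewrite powRr1// mulrC -mulrA ler_wpM2l// ler_wpM2r//.
  rewrite -(@powRr1 _ G)// -(@mulfV _ Q') ?gt_eqF// !powRrM.
  by rewrite powR_le ?invr_ge0 ?powR_ge0// ltW.
have t0 (b : bool) (a x y : R) : 0 <= x `^ a * (y `^ (- lam) * b%:R).
  by rewrite !mulr_ge0 ?powR_ge0.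
have t1 (b : bool) (a x y c : R) : 0 <= x `^ a * (y `^ (- c) * b%:R).
  by rewrite !mulr_ge0 ?powR_ge0.
have t2 : 0 <= f `^ p * g `^ q' by rewrite mulr_ge0 ?powR_ge0.
have [hf|hf] := leP 1 (D `^ nu * f `^ p).
  rewrite mulr1 ?mulr0 ?addr0; have := case1 p q p' q' f g p0 q0 q'0 qq' f0 g0.
  move=> H; apply: le_trans H _; rewrite -!addrA lerD2l.
  by rewrite !addrA lerDr !addr_ge0// ?mulr0// ?t1// t0.
have [hg|hg] := leP 1 (D `^ nu * g `^ q').
  have := case1 q' p' q p g f q'0 p'0 p0 _ g0 f0.
  rewrite addrC pp' => /(_ erefl); rewrite [f * K * g]mulrC [g * (f * K)]mulrCA.
  rewrite [f * (g * K)]mulrC [g `^ q' * _]mulrC => H; apply: le_trans H _.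
  rewrite !mulr0 !mulr1 add0r addr0 lerD2r lerDl.
  by rewrite mulr_ge0 ?mulr_ge0 ?powR_ge0.
rewrite !mulr0 !add0r !mulr1.
have [gf|fg] := leP (g `^ q') (f `^ p).
  apply: le_trans (case2 p q' f g p0 q'0 f0 g0 gf) _.
  by rewrite -addrA lerDl addr_ge0// mulr_ge0 ?powR_ge0.
have := case2 q' p g f q'0 p0 g0 f0 (ltW fg).
rewrite [f * K * g]mulrC [g * (f * K)]mulrCA [f * (g * K)]mulrC => H.
apply: le_trans H _; rewrite [leRHS]addrAC lerDr addr_ge0// mulr_ge0 ?powR_ge0//.
Qed.

(** For normalized functions the integrand is bounded pointwise by terms with
    integral at most a constant, so neither interpolation nor maximal functions
    are needed. *)
Lemma form_le_hls (dist : T -> T -> R) (lam p q p' q' : R) :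
  measurable_kernel dist -> (forall x, ball_regular (dist x)) ->
  (forall y, ball_regular (dist^~ y)) ->
  1 < p -> 1 < q -> p^-1 + p'^-1 = 1 -> q^-1 + q'^-1 = 1 ->
  0 < lam < nu -> q^-1 = p^-1 + lam / nu - 1 ->
  exists2 C : R, 0 < C &
    form_le mu p q' (fun x y => dist x y `^ (- lam)) C.
Proof.
move=> mdist ball1 ball2 p1 q1 pp' qq' lamP rel.
have p0 : 0 < p by lra.
have q0 : 0 < q by lra.
have pV1 : p^-1 < 1 by rewrite invf_lt1.
have qV1 : q^-1 < 1 by rewrite invf_lt1.
have pV0 : 0 < p^-1 by rewrite invr_gt0.
have qV0 : 0 < q^-1 by rewrite invr_gt0.
have p'V0 : 0 < p'^-1 by lra.
have p'0 : 0 < p' by rewrite -invr_gt0.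
have q'V0 : 0 < q'^-1 by lra.
have q'0 : 0 < q' by rewrite -invr_gt0.
have p'1 : 1 < p' by rewrite -invf_lt1//; lra.
have q'1 : 1 < q' by rewrite -invf_lt1//; lra.
have [C1 C10 HC1] := hls_levels p1 q1 qq' lamP rel.
have [C2 C20 HC2] : exists2 C : R, 0 < C & forall u, ball_regular u ->
  forall c : R, 0 <= c ->
  (\int[mu]_y (c `^ ((1 - q' / p) * p') * (u y `^ (- (lam * p')) *
     (1 <= u y `^ nu * c `^ q')%R%:R))%:E <= (C * c `^ q')%:E)%E /\
  (\int[mu]_y (c `^ (1 + q' / p) * (u y `^ (- lam) *
     (u y `^ nu * c `^ q' < 1)%R%:R))%:E <= (C * c `^ q')%:E)%E.
  apply: hls_levels => //; first by rewrite addrC.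
  have -> : p'^-1 = 1 - p^-1 by lra.
  have -> : q'^-1 = 1 - q^-1 by lra.
  by rewrite rel; ring.
exists (C1 + C2 + C1 + C2 + 1); first by rewrite !addr_gt0.
move=> f g mf mg f0 g0 f1 g1.
have mf2 : measurable_fun setT (fun z : T * T => f z.2) by exact: measurableT_comp.
have mg1 : measurable_fun setT (fun z : T * T => g z.1) by exact: measurableT_comp.
have mD : measurable_fun setT (fun z : T * T => dist z.1 z.2) by exact: mdist.
have D0 x y : 0 <= dist x y by have [_ + _] := ball1 x; exact.
pose G (i : 'I_5) (z : T * T) : R := [tuple
  f z.2 `^ ((1 - p / q') * q) * (dist z.1 z.2 `^ (- (lam * q)) *
    (1 <= dist z.1 z.2 `^ nu * f z.2 `^ p)%R%:R);
  g z.1 `^ ((1 - q' / p) * p') * (dist z.1 z.2 `^ (- (lam * p')) *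
    (1 <= dist z.1 z.2 `^ nu * g z.1 `^ q')%R%:R);
  f z.2 `^ (1 + p / q') * (dist z.1 z.2 `^ (- lam) *
    (dist z.1 z.2 `^ nu * f z.2 `^ p < 1)%R%:R);
  g z.1 `^ (1 + q' / p) * (dist z.1 z.2 `^ (- lam) *
    (dist z.1 z.2 `^ nu * g z.1 `^ q' < 1)%R%:R);
  f z.2 `^ p * g z.1 `^ q']`_i.
pose C' (i : 'I_5) : R := [tuple C1; C2; C1; C2; 1]`_i.
have -> : C1 + C2 + C1 + C2 + 1 = \sum_(i < 5) C' i.
  by rewrite !big_ord_recl big_ord0 /C'/=; ring.
apply: (integral_sum_le (G := G)).
- by move=> [[|[|[|[|[|i]]]]] i5]//; rewrite /G/=; measurability.
- by move=> [[|[|[|[|[|i]]]]] i5] z//; rewrite /G/= !mulr_ge0 ?powR_ge0.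
- move=> z; rewrite !mulr_ge0 ?powR_ge0//=.
  rewrite !big_ord_recl big_ord0 /G/= addr0 !addrA.
  exact: hls_pointwise.
- have mfp : measurable_fun setT (fun y => f y `^ p) by measurability.
  have mgq : measurable_fun setT (fun x => g x `^ q') by measurability.
  move=> [[|[|[|[|[|i]]]]] i5]//; rewrite /G /C'/=.
  + apply: (prod_integral_le2 (psi := fun y => f y `^ p)) => //.
    * by measurability.
    * by move=> z; rewrite !mulr_ge0 ?powR_ge0.
    * by move=> y; rewrite powR_ge0.
    * exact: ltW.
    * by move=> y /=; have [] := HC1 _ (ball2 y) _ (f0 y).
  + apply: (prod_integral_le1 (psi := fun x => g x `^ q')) => //.
    * by measurability.
    * by move=> z; rewrite !mulr_ge0 ?powR_ge0.
    * by move=> y; rewrite powR_ge0.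
    * exact: ltW.
    * by move=> x /=; have [] := HC2 _ (ball1 x) _ (g0 x).
  + apply: (prod_integral_le2 (psi := fun y => f y `^ p)) => //.
    * by measurability.
    * by move=> z; rewrite !mulr_ge0 ?powR_ge0.
    * by move=> y; rewrite powR_ge0.
    * exact: ltW.
    * by move=> y /=; have [] := HC1 _ (ball2 y) _ (f0 y).
  + apply: (prod_integral_le1 (psi := fun x => g x `^ q')) => //.
    * by measurability.
    * by move=> z; rewrite !mulr_ge0 ?powR_ge0.
    * by move=> y; rewrite powR_ge0.
    * exact: ltW.
    * by move=> x /=; have [] := HC2 _ (ball1 x) _ (g0 x).
  + apply: (prod_integral_le1 (psi := fun x => g x `^ q')) => //.
    * by measurability.
    * by move=> z; rewrite !mulr_ge0 ?powR_ge0.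
    * by move=> y; rewrite powR_ge0.
    * move=> x /=; under eq_integral do rewrite mulrC EFinM.
      rewrite ge0_integralZl_EFin ?powR_ge0//.
      - rewrite mul1r -[leRHS]mule1 lee_wpmul2l// lee_fin powR_ge0//.
      - by move=> y _; rewrite lee_fin powR_ge0.
      - by apply/measurable_EFinP.
Qed.

End hls.

(** * From bilinear forms to operators *)

Section duality.
Context d (T : measurableType d) (R : realType).
Variable mu : {sigma_finite_measure set T -> \bar R}.
Variables (p q q' C : R) (k : T -> T -> R).
Hypotheses (p0 : 0 < p) (q1 : 1 < q) (qq' : q^-1 + q'^-1 = 1) (C0 : 0 < C).
Hypotheses (mk : measurable_kernel k) (k0 : forall x y, 0 <= k x y).
Hypothesis formC : form_le mu p q' k C.

Let q0 : 0 < q. Proof. exact: lt_trans q1. Qed.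
Let q'0 : 0 < q'.
Proof.
have qV1 : q^-1 < 1 by rewrite invf_lt1.
by rewrite -invr_gt0 -(ltrD2l q^-1) qq' addr0.
Qed.

Definition kernel_integral (f : T -> R) (x : T) : \bar R :=
  (\int[mu]_y (k x y * f y)%:E)%E.

Lemma kernel_integral_ge0 (f : T -> R) : (forall y, 0 <= f y) ->
  forall x, (0 <= kernel_integral f x)%E.
Proof. by move=> f0 x; apply: integral_ge0 => y _; rewrite lee_fin mulr_ge0. Qed.

Lemma measurable_kernel_integral (f : T -> R) : measurable_fun setT f ->
  (forall y, 0 <= f y) -> measurable_fun setT (kernel_integral f).
Proof.
move=> mf f0.
apply: (measurable_fun_fubini_tonelli_F
  (fun z : T * T => (k z.1 z.2 * f z.2)%:E)).
  apply/measurable_EFinP; apply: measurable_funM => //.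
  exact: (measurableT_comp mf measurable_snd).
by move=> z; rewrite lee_fin mulr_ge0.
Qed.

(** Testing the form against the (q - 1)-st power of a bounded function below
    the image, supported on a set of finite measure. *)
Lemma truncated_integral_le (f u : T -> R) : measurable_fun setT f ->
  (forall y, 0 <= f y) -> (\int[mu]_y (f y `^ p)%:E <= 1)%E ->
  measurable_fun setT u -> (forall x, 0 <= u x) ->
  (forall x, ((u x)%:E <= kernel_integral f x)%E) ->
  (\int[mu]_x (u x `^ q)%:E < +oo)%E ->
  (\int[mu]_x (u x `^ q)%:E <= (C `^ q)%:E)%E.
Proof.
move=> mf f0 f1 mu_ u0 uh Uoo; set U := (\int[mu]_x (u x `^ q)%:E)%E in Uoo *.
have U0 : (0 <= U)%E by apply: integral_ge0 => x _; rewrite lee_fin powR_ge0.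
have Ufin : U \is a fin_num by rewrite ge0_fin_numE.
have [V UE] : exists V, U = V%:E by exists (fine U); rewrite fineK.
rewrite UE lee_fin; rewrite UE lee_fin in U0.
have [->|V0] := eqVneq V 0; first by rewrite powR_ge0.
have {U0}V0 : 0 < V by rewrite lt_neqAle eq_sym V0.
have q'q : (q - 1) * q' = q.
  have : q * q' * (q^-1 + q'^-1) = q * q' by rewrite qq' mulr1.
  rewrite mulrDr mulrAC mulfV ?gt_eqF// -mulrA mulfV ?gt_eqF//; lra.
pose c := V `^ (- q'^-1).
have c0 : 0 < c by exact: powR_gt0.
pose g x := c * u x `^ (q - 1).
have mg : measurable_fun setT g by rewrite /g; measurability.
have g0 x : 0 <= g x by rewrite mulr_ge0 ?powR_ge0.
have cq' : c `^ q' = V^-1.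
  by rewrite -powRrM mulNr mulVf ?gt_eqF// powR_inv1// ltW.
have g1 : (\int[mu]_x (g x `^ q')%:E <= 1)%E.
  under eq_integral.
    move=> x _; rewrite powRM ?powR_ge0 ?ltW// -powRrM q'q cq' EFinM; over.
  rewrite ge0_integralZl_EFin ?invr_ge0 ?(ltW V0)//; last 2 first.
  - by move=> x _; rewrite lee_fin powR_ge0.
  - by measurability.
  by rewrite -/U UE -EFinM lee_fin mulVf ?gt_eqF.
have := formC mf mg f0 g0 f1 g1.
rewrite (fubini_tonelli1 (fun z : T * T => (g z.1 * k z.1 z.2 * f z.2)%:E))/=; last 2 first.
- have mf2 : measurable_fun setT (fun z : T * T => f z.2) by exact: measurableT_comp.
  have mg1 : measurable_fun setT (fun z : T * T => g z.1) by exact: measurableT_comp.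
  have mk' : measurable_fun setT (fun z : T * T => k z.1 z.2) by exact: mk.
  by measurability.
- by move=> z; rewrite lee_fin mulr_ge0// mulr_ge0.
move=> H.
have : (\int[mu]_x (c%:E * (u x `^ q)%:E) <= C%:E)%E.
  apply: le_trans H; apply: ge0_le_integral_nonmeas => x _.
    by rewrite mule_ge0// lee_fin ?powR_ge0// ltW.
  rewrite /fubini_F/=; under eq_integral do rewrite -mulrA EFinM.
  rewrite ge0_integralZl_EFin//; last 2 first.
  - by move=> y _; rewrite lee_fin mulr_ge0.
  - apply/measurable_EFinP; apply: measurable_funM => //.
    exact: measurable_kernel1.
  rewrite -(mulr_powRB1 (u0 x) q0) mulrC EFinM muleA -EFinM -/(g x).
  by rewrite EFinM lee_wpmul2l// ?lee_fin//; exact: uh.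
rewrite ge0_integralZl_EFin ?(ltW c0)//; last 2 first.
- by move=> x _; rewrite lee_fin powR_ge0.
- by measurability.
rewrite -/U UE -EFinM lee_fin => cV.
have -> : V = (c * V) `^ q.
  rewrite -[X in c * X]powRr1 ?(ltW V0)// -powRD ?(gt_eqF V0) ?implybT//.
  rewrite -powRrM (_ : _ * q = 1) ?powRr1 ?(ltW V0)//.
  by rewrite (_ : - q'^-1 + 1 = q^-1) ?mulVf ?gt_eqF//; have := qq'; lra.
by rewrite powR_le ?mulr_ge0// ltW.
Qed.

(** The truncations exhaust the image, and have the finite integrals by which
    [truncated_integral_le] has to divide. *)
Lemma kernel_integral_Lp_unit (f : T -> R) : measurable_fun setT f ->
  (forall y, 0 <= f y) -> (\int[mu]_y (f y `^ p)%:E <= 1)%E ->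
  (\int[mu]_x (kernel_integral f x `^ q) <= (C `^ q)%:E)%E.
Proof.
move=> mf f0 f1; set h := kernel_integral f.
have h0 : forall x, (0 <= h x)%E by exact: kernel_integral_ge0.
have mh : measurable_fun setT h by exact: measurable_kernel_integral.
have /sigma_finiteP[E [TE ndE Eoo]] := sigma_finiteT mu.
pose u N x : R := fine (mine (h x) N%:R%:E) * \1_(E N) x.
have minfin N x : mine (h x) N%:R%:E \is a fin_num.
  rewrite ge0_fin_numE; first by rewrite gt_min ltry orbT.
  by rewrite le_min h0 lee_fin ler0n.
have min0 N x : (0 <= mine (h x) N%:R%:E)%E by rewrite le_min h0 lee_fin ler0n.
have u0 N x : 0 <= u N x by rewrite mulr_ge0// fine_ge0.
have mE N : measurable (E N) by have [] := Eoo N.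
have mu_ N : measurable_fun setT (u N).
  apply: measurable_funM; last exact: measurable_indic.
  apply: (measurableT_comp (f := fine)) => //.
  by apply: measurable_mine => //; exact: measurable_cst.
have uh N x : ((u N x)%:E <= h x)%E.
  rewrite /u EFinM fineK// indicE; case: (_ \in _).
    by rewrite mule1 ge_min lexx.
  by rewrite mule0.
have uN N x : u N x <= N%:R * \1_(E N) x.
  rewrite ler_wpM2r// -lee_fin fineK//.
  by rewrite ge_min lexx orbT.
have Uoo N : (\int[mu]_x (u N x `^ q)%:E < +oo)%E.
  apply: (@le_lt_trans _ _ (\int[mu]_x ((N%:R `^ q)%:E * (\1_(E N) x)%:E))%E).
    apply: ge0_le_integral_nonmeas => x _; first by rewrite lee_fin powR_ge0.
    rewrite -EFinM lee_fin.
    apply: (@le_trans _ _ ((N%:R * \1_(E N) x) `^ q)); first by rewrite powR_le// ltW.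
    rewrite powRM// ler_wpM2l ?powR_ge0// indicE; case: (_ \in _).
      by rewrite powR1.
    by rewrite powR0 ?gt_eqF.
  rewrite ge0_integralZl_EFin ?powR_ge0//; last first.
    by apply/measurable_EFinP; exact: measurable_indic.
  rewrite integral_indic// setIT; have [_] := Eoo N.
  by move=> Elt; rewrite lte_mul_pinfty// ?lee_fin ?powR_ge0.
have HN N := truncated_integral_le mf f0 f1 (mu_ N) (u0 N) (uh N) (Uoo N).
have ndu x : nondecreasing_seq (fun N => (u N x `^ q)%:E).
  move=> N M NM; rewrite lee_fin powR_le ?(ltW q0)//.
  rewrite -lee_fin /u !EFinM !fineK//.
  have EE : E N `<=` E M by apply/subsetPset; exact: ndE.
  rewrite !indicE; case: (boolP (x \in E N)) => [xN|_]; last first.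
    by rewrite mule0 mule_ge0// lee_fin.
  rewrite (_ : x \in E M) ?mule1; last by rewrite inE; apply: EE; rewrite inE in xN.
  by rewrite le_min ge_min lexx/= ge_min lee_fin ler_nat NM orbT.
apply: (@le_trans _ _ (\int[mu]_x (limn (fun N => (u N x `^ q)%:E)))%E); last first.
  rewrite monotone_convergence => [|//|N|N x _|x _]; last 3 first.
  - by measurability; exact: mu_.
  - by rewrite lee_fin powR_ge0.
  - exact: ndu.
  apply: lime_le; last by apply: nearW.
  apply: ereal_nondecreasing_is_cvgn => N M NM; apply: ge0_le_integral_nonmeas => x _.
    by rewrite lee_fin powR_ge0.
  exact: ndu.
apply: ge0_le_integral_nonmeas => x _; first exact: poweR_ge0.
have lim_ge N : ((u N x `^ q)%:E <= limn (fun N => (u N x `^ q)%:E))%E.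
  rewrite (cvg_lim _ (ereal_nondecreasing_cvgn (ndu x)))//.
  by apply: ereal_sup_ubound; exists N.
have [N0 xN0] : exists N0, x \in E N0.
  have : [set: T] x by [].
  by rewrite TE => -[N _ EN]; exists N; rewrite inE.
have xE N : (N0 <= N)%N -> x \in E N.
  move=> N0N; rewrite inE; have EE : E N0 `<=` E N by apply/subsetPset; exact: ndE.
  by apply: EE; rewrite inE in xN0.
case hx : (h x) (h0 x) => [r| |]//.
- rewrite lee_fin => r0; pose N := maxn N0 (Num.bound r).
  apply: le_trans (lim_ge N); rewrite poweR_EFin lee_fin powR_le ?(ltW q0)//.
  rewrite -lee_fin /u EFinM fineK// hx indicE xE ?leq_maxl// mule1 le_min lexx/=.
  rewrite lee_fin (le_trans (ltW (archi_boundP r0)))// ler_nat leq_maxr//.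
- move=> _; rewrite poweRyr ?gt_eqF// leye_eq; apply/eqP/eqyP => M M0.
  pose N := maxn N0 (Num.bound (M `^ q^-1)).
  apply: le_trans (lim_ge N); rewrite lee_fin.
  rewrite -[leLHS]powRr1 ?(ltW M0)// -(@mulVf _ q) ?gt_eqF// powRrM.
  rewrite powR_le ?powR_ge0 ?(ltW q0)//.
  rewrite -lee_fin /u EFinM fineK// hx indicE xE ?leq_maxl// mule1 le_min leey/=.
  rewrite lee_fin (le_trans (ltW (archi_boundP (powR_ge0 _ _))))// ler_nat leq_maxr//.
Qed.

Lemma kernel_integral_Lp (f : T -> R) : measurable_fun setT f -> (forall y, 0 <= f y) ->
  (\int[mu]_x (kernel_integral f x `^ q) <=
    (C `^ q)%:E * (\int[mu]_y (f y `^ p)%:E) `^ (q / p))%E.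
Proof.
move=> mf f0; set F := (\int[mu]_y (f y `^ p)%:E)%E.
have F0 : (0 <= F)%E by apply: integral_ge0 => y _; rewrite lee_fin powR_ge0.
have scaled (M : R) : 0 < M -> (F <= (M `^ p)%:E)%E ->
    (\int[mu]_x (kernel_integral f x `^ q) <= (C `^ q * M `^ q)%:E)%E.
  move=> M0 FM; have MV0 : 0 <= M^-1 by rewrite invr_ge0 ltW.
  pose f1 y := M^-1 * f y.
  have mf1 : measurable_fun setT f1 by rewrite /f1; measurability.
  have f10 y : 0 <= f1 y by rewrite mulr_ge0.
  have f11 : (\int[mu]_y (f1 y `^ p)%:E <= 1)%E.
    under eq_integral do rewrite powRM// EFinM.
    rewrite ge0_integralZl_EFin ?powR_ge0//; last 2 first.
    - by move=> x _; rewrite lee_fin powR_ge0.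
    - by measurability.
    apply: (@le_trans _ _ ((M^-1 `^ p)%:E * (M `^ p)%:E)%E).
      by rewrite lee_wpmul2l// lee_fin powR_ge0.
    by rewrite -EFinM -powRM ?(ltW M0)// mulVf ?gt_eqF// powR1.
  have H := kernel_integral_Lp_unit mf1 f10 f11.
  have KE x : kernel_integral f x = (M%:E * kernel_integral f1 x)%E.
    rewrite /kernel_integral -ge0_integralZl_EFin ?(ltW M0)//; last 2 first.
    - by move=> y _; rewrite lee_fin mulr_ge0.
    - apply/measurable_EFinP; apply: measurable_funM => //.
      exact: measurable_kernel1.
    apply: eq_integral => y _; rewrite -EFinM; congr EFin.
    by rewrite /f1 mulrCA [M * _]mulrA mulfV ?gt_eqF// mul1r.
  under eq_integral.
    move=> x _; rewrite KE poweRM ?lee_fin ?(ltW M0)//; last exact: kernel_integral_ge0.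
    rewrite poweR_EFin; over.
  rewrite ge0_integralZl_EFin ?powR_ge0//; last 2 first.
  - by move=> x _; exact: poweR_ge0.
  - apply: (measurableT_comp (f := fun x => (x `^ q)%E)).
      exact: measurable_poweR.
    exact: measurable_kernel_integral.
  by rewrite mulrC EFinM lee_wpmul2l// lee_fin powR_ge0.
case FE : F F0 => [r| |]//; last first.
  move=> _; rewrite poweRyr; last by rewrite gt_eqF// divr_gt0.
  by rewrite gt0_muley ?leey// lte_fin powR_gt0.
rewrite lee_fin => r0; rewrite poweR_EFin -EFinM.
have [r_|r_] := eqVneq r 0; last first.
  have {r_}r0 : 0 < r by rewrite lt_neqAle eq_sym r_.
  rewrite mulrC powRrM powRAC -powRrM; have := scaled (r `^ p^-1).
  rewrite powR_gt0// -!powRrM mulVf ?gt_eqF// powRr1 ?(ltW r0)// FE lexx.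
  by rewrite [p^-1 * q]mulrC [X in (_ <= X%:E)%E]mulrC => ->.
rewrite r_ powR0 ?mulr0; last by rewrite gt_eqF// divr_gt0.
apply/lee_addgt0Pr => e e0; rewrite add0e.
have Cq0 : 0 < C `^ q by exact: powR_gt0.
have := scaled ((e / C `^ q) `^ q^-1).
rewrite powR_gt0 ?divr_gt0// FE r_ lee_fin powR_ge0 => /(_ isT isT).
rewrite -powRrM mulVf ?gt_eqF// powRr1 ?divr_ge0 ?(ltW e0) ?(ltW Cq0)//.
by rewrite mulrC divfK ?gt_eqF.
Qed.

End duality.

(** * The Stein-Weiss inequality *)

Section form_operations.
Context d (T : measurableType d) (R : realType).
Variable mu : {sigma_finite_measure set T -> \bar R}.
Implicit Types (k H : T -> T -> R) (p q C c A : R).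

Lemma form_le_scale p q' k k' C c : measurable_kernel k -> 0 < c ->
  (forall x y, 0 <= k' x y <= c * k x y) ->
  form_le mu p q' k C -> form_le mu p q' k' (c * C).
Proof.
move=> mk c0 kk' kC f g mf mg f0 g0 f1 g1.
have mf2 : measurable_fun setT (fun z : T * T => f z.2) by exact: measurableT_comp.
have mg1 : measurable_fun setT (fun z : T * T => g z.1) by exact: measurableT_comp.
have mk' : measurable_fun setT (fun z : T * T => k z.1 z.2) by exact: mk.
have k0 x y : 0 <= k x y.
  by have /andP[k0 k1] := kk' x y; rewrite -(pmulr_rge0 _ c0) (le_trans k0).
have := kC f g mf mg f0 g0 f1 g1.
rewrite -(@lee_pmul2l _ c%:E) ?lte_fin// -EFinM; apply: le_trans.
rewrite -ge0_integralZl_EFin ?(ltW c0)//; last 2 first.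
- by move=> z _; rewrite lee_fin mulr_ge0// mulr_ge0.
- by measurability.
apply: ge0_le_integral_nonmeas => z _; have /andP[k'0 k'1] := kk' z.1 z.2.
  by rewrite lee_fin mulr_ge0// mulr_ge0.
by rewrite -EFinM lee_fin mulrA ler_wpM2r// mulrCA ler_wpM2l.
Qed.

Lemma form_le_transpose p q k C : measurable_kernel k ->
  (forall x y, 0 <= k x y) ->
  form_le mu p q k C -> form_le mu q p (fun x y => k y x) C.
Proof.
move=> mk k0 kC f g mf mg f0 g0 f1 g1.
have := kC g f mg mf g0 f0 g1 f1; apply: le_trans.
have mk' : measurable_fun setT (fun z : T * T => k z.1 z.2) by exact: mk.
have mF (h h' : T -> R) : measurable_fun setT h -> measurable_fun setT h' ->
    measurable_fun setT (fun z : T * T => (h z.1 * k z.1 z.2 * h' z.2)%:E).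
  move=> mh mh'.
  have mf2 : measurable_fun setT (fun z : T * T => h' z.2) by exact: measurableT_comp.
  have mg1 : measurable_fun setT (fun z : T * T => h z.1) by exact: measurableT_comp.
  by measurability.
rewrite (fubini_tonelli2 _ (mF _ _ mf mg)); last first.
  by move=> z; rewrite lee_fin mulr_ge0// mulr_ge0.
rewrite (fubini_tonelli1 (fun z : T * T => (g z.1 * k z.2 z.1 * f z.2)%:E)); last 2 first.
- have mks : measurable_fun setT (fun z : T * T => k z.2 z.1).
    exact: (measurableT_comp mk' (@measurable_swap _ _ T T)).
  have mf2 : measurable_fun setT (fun z : T * T => f z.2) by exact: measurableT_comp.
  have mg1 : measurable_fun setT (fun z : T * T => g z.1) by exact: measurableT_comp.
  by measurability.
- by move=> z; rewrite lee_fin mulr_ge0// mulr_ge0.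
rewrite le_eqVlt; apply/orP; left; apply/eqP; apply: eq_integral => y _.
by apply: eq_integral => x _; rewrite /= mulrC mulrA mulrAC.
Qed.

(** Schur's test at p = q, for two majorants, each integrable in one of the
    variables. *)
Lemma form_le_schur_diag p p' k H1 H2 c A : 1 < p -> p^-1 + p'^-1 = 1 ->
  0 < c -> 0 <= A -> measurable_kernel H1 -> measurable_kernel H2 ->
  (forall x y, 0 <= H1 x y) -> (forall x y, 0 <= H2 x y) ->
  (forall x y, 0 <= k x y) ->
  (forall x y, k x y <= c * H1 x y) -> (forall x y, k x y <= c * H2 x y) ->
  (forall y, (\int[mu]_x (H1 x y)%:E <= A%:E)%E) ->
  (forall x, (\int[mu]_y (H2 x y)%:E <= A%:E)%E) ->
  form_le mu p p' k (c * (A + A + 1)).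
Proof.
move=> p1 pp' c0 A0 mH1 mH2 H10 H20 k0 kH1 kH2 HA1 HA2.
have p0 : 0 < p by lra.
have pV1 : p^-1 < 1 by rewrite invf_lt1.
have pV0 : 0 < p^-1 by rewrite invr_gt0.
have p'V0 : 0 < p'^-1 by lra.
have cE (a : R) : 0 <= a -> a = a `^ p^-1 * a `^ p'^-1.
  by move=> a0; rewrite -powRD ?pp' ?powRr1// oner_eq0.
apply: (form_le_schur p1 (lexx p) pp' pp' (ltW c0) A0 A0 mH1 mH2 H10 H20 _ HA1 HA2).
move=> x y; rewrite k0/= (cE (k x y))// [X in X * (_ * _)](cE c) ?(ltW c0)//.
rewrite mulrACA -!powRM ?(ltW c0)//.
by rewrite ler_pM ?powR_ge0// powR_le// ltW.
Qed.

End form_operations.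

Section stein_weiss.
Context d (T : measurableType d) (R : realType).
Variable mu : {sigma_finite_measure set T -> \bar R}.
Variables (nu A : R) (dist : T -> T -> R) (o : T).
Hypotheses (nu0 : 0 < nu) (A0 : 0 <= A).
Hypothesis mdist : measurable_kernel dist.
Hypothesis ball_dist : forall x, ball_regular mu nu A (dist x).
Hypothesis distC : forall x y, dist x y = dist y x.
Hypothesis dist_triangle : forall x y z, dist x z <= dist x y + dist y z.

Local Notation N := (dist o).

Let dist_ge0 x y : 0 <= dist x y.
Proof. by have [_ + _] := ball_dist x; exact. Qed.

Let mN1 : measurable_fun setT (fun z : T * T => N z.1).
Proof. exact: (measurableT_comp (measurable_kernel1 o mdist)). Qed.

Let mN2 : measurable_fun setT (fun z : T * T => N z.2).
Proof. exact: (measurableT_comp (measurable_kernel1 o mdist)). Qed.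

Let mN : measurable_fun setT N.
Proof. exact: measurable_kernel1. Qed.

(** The Hardy operator, which only sees points closer to the origin: Schur's test
    with a power of [N] whose exponent [b] lies strictly between [t] and
    [nu / p']. *)
Lemma form_le_hardy (p q p' q' a t : R) : 1 < p -> p <= q ->
  p^-1 + p'^-1 = 1 -> q^-1 + q'^-1 = 1 ->
  t < nu / p' -> a + t = nu / q + nu / p' ->
  exists2 C : R, 0 < C & form_le mu p q' (fun x y =>
    N x `^ (- a) * N y `^ (- t) * ((0 < N y) && (N y < N x))%R%:R) C.
Proof.
move=> p1 pq pp' qq' tp' at_.
have p0 : 0 < p by lra.
have q0 : 0 < q by lra.
have pV1 : p^-1 < 1 by rewrite invf_lt1.
have p'V0 : 0 < p'^-1 by lra.
have p'0 : 0 < p' by rewrite -invr_gt0.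
pose b := (t + nu / p') / 2.
have tb : t < b by rewrite /b; lra.
have bp' : b * p' < nu by rewrite -ltr_pdivlMr// /b; lra.
pose e := nu + q * (b - t).
have e_nu : nu < e by rewrite /e ltrDl mulr_gt0// subr_gt0.
have [C1 C10 HC1] := integral_powR_far mu A0 nu0 e_nu.
have [C2 C20 HC2] := integral_powR_near mu A0 bp'.
pose I x y : R := ((0 < N y) && (N y < N x))%R%:R.
pose H1 x y := N y `^ (e - nu) * (N x `^ (- e) * I x y).
pose H2 x y := N x `^ (b * p' - nu) * (N y `^ (- (b * p')) * I x y).
have mI : measurable_kernel I by rewrite /measurable_kernel /I/=; measurability.
have mI' : measurable_fun setT (fun z : T * T => I z.1 z.2) by exact: mI.
exists (1 * (C1 + C2 + 1)); first by rewrite mul1r !addr_gt0.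
apply: (form_le_schur (H1 := H1) (H2 := H2) p1 pq pp' qq' ler01 (ltW C10) (ltW C20)).
- by rewrite /measurable_kernel /H1; measurability.
- by rewrite /measurable_kernel /H2; measurability.
- by move=> x y; rewrite !mulr_ge0 ?powR_ge0.
- by move=> x y; rewrite !mulr_ge0 ?powR_ge0.
- move=> x y; rewrite !mulr_ge0 ?powR_ge0//= mul1r /H1 /H2 /I.
  have [/andP[y0 yx]|_] := boolP ((0 < N y) && (N y < N x)); last first.
    by rewrite !mulr0 mulr_ge0 ?powR_ge0.
  have x0 : 0 < N x by exact: lt_trans yx.
  rewrite !mulr1 !powRM ?powR_ge0// -!powRrM.
  have aE : a = nu / q + nu / p' - t by lra.
  have qn : q != 0 by rewrite gt_eqF.
  have p'n : p' != 0 by rewrite gt_eqF.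
  have -> : N x `^ (- a) = N x `^ (- e / q) * N x `^ ((b * p' - nu) / p').
    rewrite -powRD ?(gt_eqF x0) ?implybT//; congr powR.
    by rewrite aE /e; field; rewrite p'n qn.
  have -> : N y `^ (- t) = N y `^ ((e - nu) / q) * N y `^ (- (b * p') / p').
    rewrite -powRD ?(gt_eqF y0) ?implybT//; congr powR.
    by rewrite /e; field; rewrite p'n qn.
  by rewrite le_eqVlt; apply/orP; left; apply/eqP; ring.
- move=> y; have [y0|y0] := ltP 0 (N y); last first.
    under eq_integral do rewrite /H1 /I ltNge y0/= !mulr0.
    by rewrite integral0 lee_fin ltW.
  apply: (@le_trans _ _ (\int[mu]_x ((N y `^ (e - nu))%:E *
      (N x `^ (- e) * (N y <= N x)%R%:R)%:E))%E).
    apply: ge0_le_integral_nonmeas => x _.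
      by rewrite lee_fin !mulr_ge0 ?powR_ge0.
    rewrite -EFinM lee_fin !ler_wpM2l ?powR_ge0// /I y0/= ler_nat.
    by case: ltP => // /ltW ->.
  rewrite ge0_integralZl_EFin ?powR_ge0//; last 2 first.
  + by move=> x _; rewrite lee_fin mulr_ge0 ?powR_ge0.
  + by measurability.
  have [m_ n0 bl] := ball_dist o.
  apply: (@le_trans _ _ ((N y `^ (e - nu))%:E * (C1 * N y `^ (nu - e))%:E)%E).
    by rewrite lee_wpmul2l ?lee_fin ?powR_ge0// HC1.
  rewrite -EFinM lee_fin mulrCA -powRD ?(gt_eqF y0) ?implybT//.
  by rewrite addrC subrKA subrr powRr0 mulr1.
- move=> x; have [x0|x0] := ltP 0 (N x); last first.
    under eq_integral.
      move=> y _; rewrite /H2 /I (_ : _ && _ = false) ?mulr0; first over.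
      apply/negbTE/negP => /andP[y0 yx].
      by have := lt_trans y0 yx; rewrite ltNge x0.
    by rewrite integral0 lee_fin ltW.
  apply: (@le_trans _ _ (\int[mu]_y ((N x `^ (b * p' - nu))%:E *
      (N y `^ (- (b * p')) * (N y < N x)%R%:R)%:E))%E).
    apply: ge0_le_integral_nonmeas => y _.
      by rewrite lee_fin !mulr_ge0 ?powR_ge0.
    rewrite -EFinM lee_fin !ler_wpM2l ?powR_ge0// /I ler_nat.
    by case: (_ < _) => //; case: (_ < _).
  rewrite ge0_integralZl_EFin ?powR_ge0//; last 2 first.
  + by move=> y _; rewrite lee_fin mulr_ge0 ?powR_ge0.
  + by measurability.
  have [m_ n0 bl] := ball_dist o.
  apply: (@le_trans _ _ ((N x `^ (b * p' - nu))%:E * (C2 * N x `^ (nu - b * p'))%:E)%E).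
    by rewrite lee_wpmul2l ?lee_fin ?powR_ge0// HC2.
  rewrite -EFinM lee_fin mulrCA -powRD ?(gt_eqF x0) ?implybT//.
  by rewrite addrC subrKA subrr powRr0 mulr1.
Qed.

Section weighted_kernel.
Variables (p q p' q' s t : R) (kappa : R -> R).
Hypotheses (p1 : 1 < p) (pq : p <= q).
Hypotheses (pp' : p^-1 + p'^-1 = 1) (qq' : q^-1 + q'^-1 = 1).
Hypotheses (tp' : t < nu / p') (sq : s < nu / q) (ts0 : 0 <= t + s).
Hypotheses (mkappa : measurable_fun setT kappa).
Hypotheses (kappa_ge0 : forall r, 0 <= kappa r) (kappa0 : kappa 0 = 0).

(** The homogeneity that the kernel must have for scaling invariance. *)
Definition sw_exponent : R := nu / q + nu / p' - (s + t).

Hypothesis kappa_le : forall r, 0 < r -> kappa r <= r `^ (- sw_exponent).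

(** At the exponent [nu], where the power is not integrable at the origin nor at
    infinity, integrability has to come from elsewhere. *)
Hypothesis kappa_integrable : sw_exponent = nu ->
  exists2 l1, l1 < nu & exists2 l2, nu < l2 &
  forall r, 0 < r -> kappa r <= r `^ (- l1) /\ kappa r <= r `^ (- l2).

Definition sw_kernel x y : R :=
  N x `^ (- s) * kappa (dist x y) * N y `^ (- t) *
  ((0 < N x) && (0 < N y))%R%:R.

Local Notation lam := sw_exponent.

Let p0 : 0 < p. Proof. exact: lt_trans p1. Qed.
Let q0 : 0 < q. Proof. exact: lt_le_trans pq. Qed.
Let q1 : 1 < q. Proof. exact: lt_le_trans pq. Qed.
Let pV1 : p^-1 < 1. Proof. by rewrite invf_lt1. Qed.
Let qV1 : q^-1 < 1. Proof. by rewrite invf_lt1. Qed.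
Let pV0 : 0 < p^-1. Proof. by rewrite invr_gt0. Qed.
Let qV0 : 0 < q^-1. Proof. by rewrite invr_gt0. Qed.
Let p'V0 : 0 < p'^-1. Proof. by have := pp'; have := pV1; lra. Qed.
Let q'V0 : 0 < q'^-1. Proof. by have := qq'; have := qV1; lra. Qed.
Let p'0 : 0 < p'. Proof. by rewrite -invr_gt0. Qed.
Let q'0 : 0 < q'. Proof. by rewrite -invr_gt0. Qed.
Let q'1 : 1 < q'.
Proof. by rewrite -invf_lt1//; have := qq'; have := qV0; lra. Qed.
Let lam0 : 0 < lam.
Proof. by rewrite /sw_exponent; have := tp'; have := sq; lra. Qed.

Let distN x y : dist x y <= N x + N y.
Proof. by rewrite [N x]distC dist_triangle. Qed.

Let distN1 x y : N x <= N y + dist x y.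
Proof. by rewrite [dist x y]distC dist_triangle. Qed.

Let mdist' : measurable_fun setT (fun z : T * T => dist z.1 z.2).
Proof. exact: mdist. Qed.

Let mkd : measurable_fun setT (fun z : T * T => kappa (dist z.1 z.2)).
Proof. exact: (measurableT_comp mkappa mdist'). Qed.

Let kappa_dist x y : kappa (dist x y) <= dist x y `^ (- lam).
Proof.
have [d0|d0] := ltP 0 (dist x y); first exact: kappa_le.
have -> : dist x y = 0 by apply/eqP; rewrite eq_le d0 dist_ge0.
by rewrite kappa0 powR_ge0.
Qed.

Let kappa_far x y (X : R) : 0 < X -> X / 2 <= dist x y ->
  kappa (dist x y) <= 2 `^ lam * X `^ (- lam).
Proof.
move=> X0 Xd; apply: le_trans (kappa_dist x y) _.
apply: (@le_trans _ _ ((X / 2) `^ (- lam))).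
  by rewrite !powRN lef_pV2 ?posrE ?powR_gt0 ?divr_gt0//; [
     apply: powR_le => //; rewrite ?divr_ge0// ltW|lra].
rewrite powRM ?(ltW X0)// mulrC -(@powR_inv1 _ 2)// -powRrM mulN1r opprK.
by [].
Qed.

Let form_le_lower : exists2 C : R, 0 < C & form_le mu p q'
  (fun x y => sw_kernel x y * (2 * N y <= N x)%R%:R) C.
Proof.
have at_ : (lam + s) + t = nu / q + nu / p' by rewrite /sw_exponent; ring.
have [C C0 HC] := form_le_hardy p1 pq pp' qq' tp' at_.
exists (2 `^ lam * C); first by rewrite mulr_gt0 ?powR_gt0.
apply: form_le_scale HC; first by rewrite /measurable_kernel; measurability.
  by rewrite powR_gt0.
move=> x y; rewrite !mulr_ge0 ?powR_ge0//= /sw_kernel.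
have [/andP[x0 y0]|_] := boolP ((0 < N x) && (0 < N y)); last first.
  by rewrite mulr0 mul0r !mulr_ge0 ?powR_ge0.
have [yx|_] := leP (2 * N y) (N x); last first.
  by rewrite mulr0 !mulr_ge0 ?powR_ge0.
rewrite y0 (_ : (N y < N x)%R)/=; last by lra.
have dx : N x / 2 <= dist x y by have := distN1 x y; lra.
have d0 : 0 < dist x y by lra.
rewrite !mulr1 opprD (@powRD _ (N x)) ?(gt_eqF x0) ?implybT//.
apply: (@le_trans _ _
    (N x `^ (- s) * (2 `^ lam * N x `^ (- lam)) * N y `^ (- t))).
  by rewrite ler_wpM2r ?powR_ge0// ler_wpM2l ?powR_ge0// kappa_far.
by rewrite le_eqVlt; apply/orP; left; apply/eqP; ring.
Qed.

(** The dual of the Hardy operator for the exponents [q'], [p'] and [s]. *)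
Let form_le_upper : exists2 C : R, 0 < C & form_le mu p q'
  (fun x y => sw_kernel x y * (2 * N x <= N y)%R%:R) C.
Proof.
have at_ : (lam + t) + s = nu / p' + nu / q by rewrite /sw_exponent; ring.
have q'q : q'^-1 + q^-1 = 1 by rewrite addrC.
have p'p : p'^-1 + p^-1 = 1 by rewrite addrC.
have q'p' : q' <= p'.
  rewrite -lef_pV2 ?posrE//.
  by have : q^-1 <= p^-1 by [rewrite lef_pV2]; have := pp'; have := qq'; lra.
have [C C0] := form_le_hardy q'1 q'p' q'q p'p sq at_.
move/form_le_transpose => HC.
exists (2 `^ lam * C); first by rewrite mulr_gt0 ?powR_gt0.
apply: form_le_scale (HC _ _); first by rewrite /measurable_kernel; measurability.
- by rewrite powR_gt0.
- move=> x y; rewrite !mulr_ge0 ?powR_ge0//= /sw_kernel.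
  have [/andP[x0 y0]|_] := boolP ((0 < N x) && (0 < N y)); last first.
    by rewrite mulr0 mul0r !mulr_ge0 ?powR_ge0.
  have [yx|_] := leP (2 * N x) (N y); last first.
    by rewrite mulr0 !mulr_ge0 ?powR_ge0.
  rewrite x0 (_ : (N x < N y)%R)/=; last by lra.
  have dx : N y / 2 <= dist x y by have := distN1 y x; rewrite [dist y x]distC; lra.
  have d0 : 0 < dist x y by lra.
  rewrite !mulr1 opprD (@powRD _ (N y)) ?(gt_eqF y0) ?implybT//.
  apply: (@le_trans _ _
      (N x `^ (- s) * (2 `^ lam * N y `^ (- lam)) * N y `^ (- t))).
    by rewrite ler_wpM2r ?powR_ge0// ler_wpM2l ?powR_ge0// kappa_far.
  by rewrite le_eqVlt; apply/orP; left; apply/eqP; ring.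
- by rewrite /measurable_kernel; measurability.
- by move=> x y; rewrite !mulr_ge0 ?powR_ge0.
Qed.

Definition comparable x y : R := ((N x < 2 * N y) && (N y < 2 * N x))%R%:R.

Let sw_kernel_ge0 x y : 0 <= sw_kernel x y.
Proof. by rewrite /sw_kernel !mulr_ge0 ?powR_ge0. Qed.

Let comparable_le1 x y : sw_kernel x y * comparable x y <=
  2 `^ `|t| * (N x `^ (- (s + t)) * kappa (dist x y) * (dist x y < 4 * N x)%R%:R).
Proof.
rewrite /sw_kernel /comparable.
have [/andP[x0 y0]|_] := boolP ((0 < N x) && (0 < N y)); last first.
  by rewrite mulr0 mul0r !mulr_ge0 ?powR_ge0.
have [/andP[xy yx]|_] := boolP ((N x < 2 * N y) && (N y < 2 * N x)); last first.
  by rewrite mulr0 !mulr_ge0 ?powR_ge0.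
have -> : dist x y < 4 * N x by have := distN x y; lra.
have yx' : N y `^ (- t) <= 2 `^ `|t| * N x `^ (- t).
  by rewrite -[`|t|]normrN; apply: powR_le_comparable => //; lra.
rewrite !mulr1 opprD (@powRD _ (N x)) ?(gt_eqF x0) ?implybT//.
apply: (@le_trans _ _
  (N x `^ (- s) * kappa (dist x y) * (2 `^ `|t| * N x `^ (- t)))).
  by rewrite ler_wpM2l// mulr_ge0 ?powR_ge0.
by rewrite le_eqVlt; apply/orP; left; apply/eqP; ring.
Qed.

Let comparable_le2 x y : sw_kernel x y * comparable x y <=
  2 `^ `|s| * (N y `^ (- (s + t)) * kappa (dist x y) * (dist x y < 4 * N y)%R%:R).
Proof.
rewrite /sw_kernel /comparable.
have [/andP[x0 y0]|_] := boolP ((0 < N x) && (0 < N y)); last first.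
  by rewrite mulr0 mul0r !mulr_ge0 ?powR_ge0.
have [/andP[xy yx]|_] := boolP ((N x < 2 * N y) && (N y < 2 * N x)); last first.
  by rewrite mulr0 !mulr_ge0 ?powR_ge0.
have -> : dist x y < 4 * N y by have := distN x y; lra.
have yx' : N x `^ (- s) <= 2 `^ `|s| * N y `^ (- s).
  by rewrite -[`|s|]normrN; apply: powR_le_comparable => //; lra.
rewrite !mulr1 opprD (@powRD _ (N y)) ?(gt_eqF y0) ?implybT//.
apply: (@le_trans _ _
  (2 `^ `|s| * N y `^ (- s) * kappa (dist x y) * N y `^ (- t))).
  by rewrite ler_wpM2r ?powR_ge0// ler_wpM2r.
by rewrite le_eqVlt; apply/orP; left; apply/eqP; ring.
Qed.

(** The distance between comparable points is at most a multiple of their norm,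
    so [N^(- (s + t))] is at most a multiple of that power of the distance. *)
Let form_le_comparable_hls : p < q -> exists2 C : R, 0 < C & form_le mu p q'
  (fun x y => sw_kernel x y * comparable x y) C.
Proof.
move=> ltpq; pose l := lam + (s + t).
have lE : l = nu * (q^-1 + p'^-1) by rewrite /l /sw_exponent; ring.
have qp : q^-1 < p^-1 by rewrite ltf_pV2.
have lP : 0 < l < nu.
  rewrite lE mulr_gt0 ?addr_gt0//= gtr_pMr//.
  by have := pp'; lra.
have rel : q^-1 = p^-1 + l / nu - 1.
  by rewrite lE mulrC mulKf ?gt_eqF//; have := pp'; lra.
have ball2 y : ball_regular mu nu A (dist ^~ y).
  by rewrite (_ : dist ^~ y = dist y)//; apply/funext => x; exact: distC.
have [C C0 HC] := form_le_hls nu0 A0 mdist ball_dist ball2 p1 q1 pp' qq' lP rel.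
exists (2 `^ `|t| * 4 `^ (s + t) * C); first by rewrite !mulr_gt0 ?powR_gt0.
apply: form_le_scale HC; first by rewrite /measurable_kernel; measurability.
  by rewrite mulr_gt0 ?powR_gt0.
move=> x y; rewrite mulr_ge0//=; apply: le_trans (comparable_le1 x y) _.
rewrite -[leRHS]mulrA ler_wpM2l ?powR_ge0//.
have [dx|_] := ltP (dist x y) (4 * N x); last by rewrite mulr0 !mulr_ge0 ?powR_ge0.
have [d0|d0] := ltP 0 (dist x y); last first.
  have -> : dist x y = 0 by apply/eqP; rewrite eq_le d0 dist_ge0.
  by rewrite kappa0 mulr0 mul0r mulr_ge0 ?powR_ge0.
have x0 : 0 < N x by lra.
have -> : - l = - lam + - (s + t) by rewrite /l opprD.
rewrite mulr1 (@powRD _ (dist x y)) ?(gt_eqF d0) ?implybT//.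
rewrite [X in _ <= _ * X]mulrC mulrA ler_pM ?powR_ge0//.
rewrite !powRN ler_pdivlMr ?powR_gt0// mulrC ler_pdivrMr ?powR_gt0//.
by rewrite -powRM// ?(ltW x0)// powR_le// ?(ltW dx)// addrC.
Qed.

(** Here [lam + s + t = nu], and the remaining power of the distance, with
    exponent [lam < nu], is integrable over a ball of radius about [N]. *)
Let form_le_comparable_near : p = q -> 0 < s + t ->
  exists2 C : R, 0 < C & form_le mu p q'
  (fun x y => sw_kernel x y * comparable x y) C.
Proof.
move=> epq st0.
have q'E : q' = p'.
  by apply: invr_inj; have := pp'; have := qq'; rewrite -epq; lra.
have lE : lam + (s + t) = nu.
  rewrite /sw_exponent subrK -epq -mulrDr pp' mulr1//.
have lnu : lam < nu by rewrite -lE ltrDl.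
have [C C0 HC] := integral_powR_near mu A0 lnu.
rewrite q'E.
pose H2 x y := N x `^ (lam - nu) * (dist x y `^ (- lam) * (dist x y < 4 * N x)%R%:R).
pose H1 x y := N y `^ (lam - nu) * (dist x y `^ (- lam) * (dist x y < 4 * N y)%R%:R).
have H12 x y : H1 x y = H2 y x by rewrite /H1 /H2 (distC x y).
pose c : R := 2 `^ (`|s| + `|t|).
have c0 : 0 < c by exact: powR_gt0.
have HB x : (\int[mu]_y (H2 x y)%:E <= (C * 4 `^ (nu - lam))%:E)%E.
  have [x0|x0] := ltP 0 (N x); last first.
    have -> : H2 x = cst 0.
      apply/funext => y; rewrite /H2 (_ : N x = 0) ?powR0 ?mul0r//.
        by rewrite subr_eq0 lt_eqF.
      by apply/eqP; rewrite eq_le x0 dist_ge0.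
    by rewrite integral0 lee_fin mulr_ge0 ?powR_ge0// ltW.
  have [mx x0' bx] := ball_dist x.
  rewrite /H2; under eq_integral do rewrite EFinM.
  rewrite ge0_integralZl_EFin ?powR_ge0//; last 2 first.
  + by move=> y _; rewrite lee_fin mulr_ge0 ?powR_ge0.
  + by measurability.
  apply: (@le_trans _ _ ((N x `^ (lam - nu))%:E *
      (C * (4 * N x) `^ (nu - lam))%:E)%E).
    by rewrite lee_wpmul2l ?lee_fin ?powR_ge0// HC// mulr_gt0.
  rewrite -EFinM lee_fin mulrCA ler_wpM2l ?(ltW C0)//.
  rewrite powRM ?(ltW x0)// mulrCA -powRD ?(gt_eqF x0) ?implybT//.
  by rewrite (_ : lam - nu + (nu - lam) = 0) ?powRr0 ?mulr1//; ring.
have mN1' := mN1; have mN2' := mN2.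
exists (c * (C * 4 `^ (nu - lam) + C * 4 `^ (nu - lam) + 1)).
  by rewrite mulr_gt0// addr_gt0// addr_gt0// mulr_gt0// powR_gt0.
apply: (form_le_schur_diag (H1 := H1) (H2 := H2)) => //.
- by rewrite mulr_ge0 ?powR_ge0// ltW.
- by rewrite /measurable_kernel /H1; measurability.
- by rewrite /measurable_kernel /H2; measurability.
- by move=> x y; rewrite !mulr_ge0 ?powR_ge0.
- by move=> x y; rewrite !mulr_ge0 ?powR_ge0.
- by move=> x y; rewrite mulr_ge0.
- move=> x y; apply: le_trans (comparable_le2 x y) _.
  apply: ler_pM; rewrite ?powR_ge0 ?mulr_ge0 ?powR_ge0//.
    by rewrite ler_powR ?lerDl// ler1n.
  rewrite /H1 (_ : - (s + t) = lam - nu); last by rewrite -lE; ring.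
  by rewrite -mulrA ler_wpM2l ?powR_ge0// ler_wpM2r.
- move=> x y; apply: le_trans (comparable_le1 x y) _.
  apply: ler_pM; rewrite ?powR_ge0 ?mulr_ge0 ?powR_ge0//.
    by rewrite ler_powR ?lerDr// ler1n.
  rewrite /H2 (_ : - (s + t) = lam - nu); last by rewrite -lE; ring.
  by rewrite -mulrA ler_wpM2l ?powR_ge0// ler_wpM2r.
- by move=> y; under eq_integral do rewrite H12; exact: HB.
Qed.

(** The weights cancel, and Schur's test applies to the integrable kernel. *)
Let form_le_comparable_integrable : p = q -> s + t = 0 ->
  exists2 C : R, 0 < C & form_le mu p q'
  (fun x y => sw_kernel x y * comparable x y) C.
Proof.
move=> epq st0.
have q'E : q' = p'.
  by apply: invr_inj; have := pp'; have := qq'; rewrite -epq; lra.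
have lE : lam = nu by rewrite /sw_exponent st0 subr0 -epq -mulrDr pp' mulr1.
have [l1 l1nu [l2 l2nu Hk]] := kappa_integrable lE.
have [C1 C10 HC1] := integral_powR_near mu A0 l1nu.
have [C2 C20 HC2] := integral_powR_far mu A0 nu0 l2nu.
rewrite q'E; pose c : R := 2 `^ (`|s| + `|t|).
have c0 : 0 < c by exact: powR_gt0.
have HB x : (\int[mu]_y (kappa (dist x y))%:E <= (C1 + C2)%:E)%E.
  have [mx x0' bx] := ball_dist x.
  have := @integral_sum_le R _ _ mu 2 (fun y => kappa (dist x y))
    (fun i y => if i == ord0 then dist x y `^ (- l1) * (dist x y < 1)%R%:R
                else dist x y `^ (- l2) * (1 <= dist x y)%R%:R)
    (fun i => if i == ord0 then C1 else C2).
  rewrite !big_ord_recl big_ord0/= addr0; apply.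
  - by move=> i; case: (i == ord0); measurability.
  - by move=> i y; case: (i == ord0); rewrite mulr_ge0 ?powR_ge0.
  - move=> y; rewrite kappa_ge0/= !big_ord_recl big_ord0/= addr0.
    have [d0|d0] := ltP 0 (dist x y); last first.
      have -> : dist x y = 0 by apply/eqP; rewrite eq_le d0 dist_ge0.
      by rewrite kappa0 addr_ge0// mulr_ge0 ?powR_ge0.
    have [k1 k2] := Hk _ d0.
    by case: ltP => _; rewrite ?mulr1 ?mulr0 ?addr0 ?add0r.
  - move=> i; case: (i == ord0).
      by have := HC1 _ mx x0' bx 1 ltr01; rewrite powR1 mulr1.
    by have := HC2 _ mx x0' bx 1 ltr01; rewrite powR1 mulr1.
exists (c * (C1 + C2 + (C1 + C2) + 1)).
  by rewrite mulr_gt0// addr_gt0// !addr_gt0.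
have kc x : 0 <= kappa x <= c * kappa x.
  by rewrite kappa_ge0/= ler_peMl// -[leLHS](powRr0 2) ler_powR ?ler1n// addr_ge0.
apply: (form_le_schur_diag (H1 := fun x y => kappa (dist x y))
    (H2 := fun x y => kappa (dist x y))) => //.
- by rewrite addr_ge0// ltW.
- by move=> x y; rewrite mulr_ge0.
- move=> x y; apply: le_trans (comparable_le2 x y) _.
  apply: ler_pM; rewrite ?powR_ge0 ?mulr_ge0 ?powR_ge0//.
    by rewrite ler_powR ?lerDl// ler1n.
  by rewrite st0 oppr0 powRr0 mul1r ler_piMr// lern1 leq_b1.
- move=> x y; apply: le_trans (comparable_le1 x y) _.
  apply: ler_pM; rewrite ?powR_ge0 ?mulr_ge0 ?powR_ge0//.
    by rewrite ler_powR ?lerDr// ler1n.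
  by rewrite st0 oppr0 powRr0 mul1r ler_piMr// lern1 leq_b1.
- by move=> y; under eq_integral do rewrite distC; exact: HB.
Qed.

(** The kernel splits according to which of the two points is much closer to
    the origin. If neither is, the weights combine to a nonnegative power of
    the distance to the origin, hence of the distance between the points. *)
Theorem form_le_stein_weiss :
  exists2 C : R, 0 < C & form_le mu p q' sw_kernel C.
Proof.
have [C1 C10 HC1] := form_le_lower.
have [C2 C20 HC2] := form_le_upper.
have [C3 C30 HC3] : exists2 C : R, 0 < C & form_le mu p q'
    (fun x y => sw_kernel x y * comparable x y) C.
  have [ltpq|qp] := ltP p q; first exact: form_le_comparable_hls.
  have epq : p = q by apply/eqP; rewrite eq_le pq qp.
  have [st0|st0] := ltP 0 (s + t); first exact: form_le_comparable_near.
  apply: form_le_comparable_integrable => //; apply/eqP.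
  by rewrite eq_le st0 addrC ts0.
have mN1' := mN1; have mN2' := mN2; have mkd' := mkd.
pose K (i : 'I_3) x y : R := [tuple sw_kernel x y * (2 * N y <= N x)%R%:R;
  sw_kernel x y * (2 * N x <= N y)%R%:R; sw_kernel x y * comparable x y]`_i.
pose C (i : 'I_3) : R := [tuple C1; C2; C3]`_i.
exists (\sum_(i < 3) C i).
  by rewrite !big_ord_recl big_ord0 /C/= addr0 !addr_gt0.
apply: (form_le_sum (K := K)).
- move=> [[|[|[|i]]] i3]//; rewrite /measurable_kernel /K/= /sw_kernel.
  + by measurability.
  + by measurability.
  + by rewrite /comparable; measurability.
- by move=> [[|[|[|i]]] i3] x y//; rewrite /K/= ?/comparable mulr_ge0.
- move=> x y; rewrite sw_kernel_ge0 !big_ord_recl big_ord0 /K/= addr0.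
  rewrite -!mulrDr ler_peMr// /comparable.
  have [h1|h1] := leP (2 * N y) (N x); first by rewrite lerDl addr_ge0.
  have [h2|h2] := leP (2 * N x) (N y); first by rewrite add0r lerDl.
  by rewrite !add0r.
- by move=> [[|[|[|i]]] i3]//.
Qed.

End weighted_kernel.

End stein_weiss.

(** * The Gamma function *)

Section lebesgue_scale.
Context {R : realType}.
Local Notation leb := (@lebesgue_measure R).
Variable c : R.
Hypothesis c0 : 0 < c.

Let scale (x : measurableTypeR R) : measurableTypeR R := c * x.

Let measurable_scale : measurable_fun setT scale.
Proof. by apply: (@measurable_funM _ _ R setT (cst c) id). Qed.

Let image_measure : {measure set (measurableTypeR R) -> \bar R} :=
  measure_function_pushforward__canonical__measure_function_Measure
    leb measurable_scale.

Let lebesgue_measure_scale (A : set (measurableTypeR R)) : measurable A ->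
  leb A = mscale (NngNum (ltW c0)) image_measure A.
Proof.
apply: lebesgue_measure_unique => _ [[a b] _ <-]/=.
rewrite /mscale/= /image_measure/= /pushforward.
have -> : scale @^-1` [set` `]a, b]] = [set` `]a / c, b / c]].
  apply/seteqP; split => x /=; rewrite !in_itv/= ltr_pdivrMr// ler_pdivlMr//;
    by rewrite /scale mulrC.
rewrite !lebesgue_measure_itv/= !lte_fin ltr_pM2r ?invr_gt0//.
case: ifPn => _; last by rewrite mule0.
by rewrite -!EFinB -EFinM -mulrBl mulrCA mulfV ?mulr1 ?gt_eqF.
Qed.

Lemma integral_scale (g : R -> R) : measurable_fun setT g ->
  (forall x, 0 < x -> 0 <= g x) ->
  (\int[leb]_(x in `]0%R, +oo[) (g x)%:E =
   c%:E * \int[leb]_(x in `]0%R, +oo[) (g (c * x))%:E)%E.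
Proof.
move=> mg g0.
have g0' (x : R) : `]0%R, +oo[%classic x -> (0 <= (g x)%:E)%E.
  by rewrite /= in_itv/= andbT lee_fin => /g0.
have mEg : measurable_fun (`]0%R, +oo[%classic : set R) (EFin \o g).
  by apply/measurable_EFinP; exact: measurable_funTS.
rewrite (eq_measure_integral (mscale (NngNum (ltW c0)) image_measure)); last first.
  by move=> A mA _; exact: lebesgue_measure_scale.
rewrite ge0_integral_mscale//; congr (_ * _)%E.
rewrite (ge0_integral_pushforward measurable_scale)//; last first.
  by move=> y; rewrite inE; exact: g0'.
suff -> : scale @^-1` `]0%R, +oo[ = `]0%R, +oo[%classic by [].
by apply/seteqP; split => x /=; rewrite !in_itv/= !andbT /scale pmulr_rgt0.
Qed.

End lebesgue_scale.

Section gamma.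
Context {R : realType}.
Local Notation leb := (@lebesgue_measure R).
Implicit Types (z c u m : R).

(** The maximum of [u^m e^(- u)] is attained at [u = m]. *)
Lemma powR_le_expR m u : 0 < m -> 0 <= u ->
  u `^ m <= m `^ m * expR (u - m).
Proof.
move=> m0 u0.
have H : u / m <= expR (u / m - 1).
  by apply: le_trans (expR_ge1Dx _); rewrite addrC subrK.
have -> : u = m * (u / m) by rewrite mulrCA mulfV ?mulr1 ?gt_eqF.
rewrite powRM ?(ltW m0) ?divr_ge0 ?(ltW m0)//.
rewrite ler_wpM2l ?powR_ge0//.
apply: le_trans (powR_le (ltW m0) (divr_ge0 u0 (ltW m0)) H) _.
by rewrite -expRM mulrBl mul1r divfK ?gt_eqF// mulrCA mulfV ?mulr1 ?gt_eqF.
Qed.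

Definition gamma_integrand z c u : R := u `^ (z - 1) * expR (- (c * u)).

Lemma measurable_gamma_integrand z c (D : set R) :
  measurable_fun D (gamma_integrand z c).
Proof.
by rewrite /gamma_integrand; measurability.
Qed.

Lemma gamma_integrand_ge0 z c u : 0 <= gamma_integrand z c u.
Proof. by rewrite mulr_ge0 ?powR_ge0 ?expR_ge0. Qed.

Let abs_ball (r : R) : 0 < r ->
  (leb [set y : R | (`|y| < r)%R] <= (2 * r `^ 1)%:E)%E.
Proof.
move=> r0; rewrite powRr1 ?(ltW r0)//.
have -> : [set y : R | `|y| < r] = [set` `](- r), r[].
  by apply/seteqP; split => x /=; rewrite in_itv/= ltr_norml.
rewrite lebesgue_measure_itv/= lte_fin gtrN// -EFinB opprK lee_fin; lra.
Qed.

Let mabs : measurable_fun setT (fun y : measurableTypeR R => `|y| : R).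
Proof. exact: normr_measurable. Qed.

Lemma integral_powR_line_near (b : R) : b < 1 -> exists2 C : R, 0 < C &
  forall r : R, 0 < r ->
  (\int[leb]_(t in `]0%R, +oo[) (t `^ (- b) * (t < r)%R%:R)%:E <=
     (C * r `^ (1 - b))%:E)%E.
Proof.
move=> b1.
have [C C0 HC] := @integral_powR_near _ (measurableTypeR R) R leb 1 2 (ler0n _ 2) b b1.
exists C => // r' r0.
apply: le_trans (HC (fun y : R => `|y|) mabs (fun y => normr_ge0 y) abs_ball _ r0).
rewrite [leLHS]integral_mkcond; apply: ge0_le_integral_nonmeas => t _.
  by rewrite /patch; case: ifPn => // _; rewrite lee_fin mulr_ge0 ?powR_ge0.
rewrite /patch; case: ifPn => [|_]; last by rewrite lee_fin mulr_ge0 ?powR_ge0.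
by rewrite inE/= in_itv/= andbT => t0; rewrite gtr0_norm.
Qed.

Lemma integral_powR_line_far (b : R) : 1 < b -> exists2 C : R, 0 < C &
  forall r : R, 0 < r ->
  (\int[leb]_(t in `]0%R, +oo[) (t `^ (- b) * (r <= t)%R%:R)%:E <=
     (C * r `^ (1 - b))%:E)%E.
Proof.
move=> b1.
have [C C0 HC] := @integral_powR_far _ (measurableTypeR R) R leb 1 2 (ler0n _ 2) ltr01 b b1.
exists C => // r' r0.
apply: le_trans (HC (fun y : R => `|y|) mabs (fun y => normr_ge0 y) abs_ball _ r0).
rewrite [leLHS]integral_mkcond; apply: ge0_le_integral_nonmeas => t _.
  by rewrite /patch; case: ifPn => // _; rewrite lee_fin mulr_ge0 ?powR_ge0.
rewrite /patch; case: ifPn => [|_]; last by rewrite lee_fin mulr_ge0 ?powR_ge0.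
by rewrite inE/= in_itv/= andbT => t0; rewrite gtr0_norm.
Qed.

Lemma gamma_integral_fin z : 0 < z ->
  (\int[leb]_(t in `]0%R, +oo[) (gamma_integrand z 1 t)%:E < +oo)%E.
Proof.
move=> z0; have z1 : 1 - z < 1 by lra.
have [C1 C10 HC1] := integral_powR_line_near z1.
have [C2 C20 HC2] := @integral_powR_line_far 2 (ltr1n _ 2).
pose K := (z + 1) `^ (z + 1).
have K0 : 0 <= K by exact: powR_ge0.
have mD : measurable (`]0%R, +oo[%classic : set R) by [].
apply: (@le_lt_trans _ _ (\int[leb]_(t in `]0%R, +oo[)
   ((t `^ (- (1 - z)) * (t < 1)%R%:R)%:E +
    K%:E * (t `^ (- 2) * (1 <= t)%R%:R)%:E))%E).
  apply: ge0_le_integral_nonmeas => t.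
    by rewrite lee_fin gamma_integrand_ge0.
  rewrite /= in_itv/= andbT => t0; rewrite -EFinM -EFinD lee_fin.
  rewrite /gamma_integrand mul1r opprB.
  have [t1|t1] := ltP t 1.
    by rewrite mulr1 !mulr0 addr0 ler_piMr ?powR_ge0// expR_le1 oppr_le0 ltW.
  rewrite mulr0 mulr1 add0r.
  have -> : z - 1 = (z + 1) + (- 2) by ring.
  rewrite powRD ?(gt_eqF t0) ?implybT// mulrAC ler_wpM2r ?powR_ge0//.
  rewrite expRN ler_pdivrMr ?expR_gt0//.
  apply: le_trans (@powR_le_expR (z + 1) t _ (ltW t0)) _; first by lra.
  by rewrite ler_wpM2l// ler_expR; lra.
rewrite ge0_integralD//=; last 4 first.
- by move=> t _; rewrite lee_fin mulr_ge0 ?powR_ge0.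
- by apply: measurable_funTS; measurability.
- by move=> t _; rewrite mule_ge0// lee_fin mulr_ge0 ?powR_ge0.
- by apply: measurable_funeM; apply: measurable_funTS; measurability.
rewrite ge0_integralZl_EFin//; last 2 first.
- by move=> t _; rewrite lee_fin mulr_ge0 ?powR_ge0.
- by apply: measurable_funTS; measurability.
apply: lte_add_pinfty; first by apply: le_lt_trans (HC1 1 ltr01) _; exact: ltry.
apply: lte_mul_pinfty => //.
by apply: le_lt_trans (HC2 1 ltr01) _; exact: ltry.
Qed.

Lemma GammaE z : 0 < z -> ((Gamma z)%:E =
  \int[leb]_(t in `]0%R, +oo[) (gamma_integrand z 1 t)%:E)%E.
Proof.
move=> z0; rewrite /Gamma /Rintegral fineK; last first.
  rewrite ge0_fin_numE.
    apply: le_lt_trans (gamma_integral_fin z0).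
    apply: ge0_le_integral_nonmeas => t _.
      by rewrite lee_fin mulr_ge0 ?powR_ge0 ?expR_ge0.
    by rewrite /gamma_integrand mul1r.
  by apply: integral_ge0 => t _; rewrite lee_fin mulr_ge0 ?powR_ge0 ?expR_ge0.
by apply: eq_integral => t _; rewrite /gamma_integrand mul1r.
Qed.

Lemma Gamma_ge0 z : 0 < z -> 0 <= Gamma z.
Proof.
move=> z0; rewrite -lee_fin GammaE//; apply: integral_ge0 => t _.
by rewrite lee_fin gamma_integrand_ge0.
Qed.

Lemma gamma_integral_scale z c : 0 < z -> 0 < c ->
  (\int[leb]_(t in `]0%R, +oo[) (gamma_integrand z c t)%:E =
   (Gamma z * c `^ (- z))%:E)%E.
Proof.
move=> z0 c0; rewrite EFinM GammaE// (integral_scale (g := gamma_integrand z 1) c0)//; last first.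
- by move=> x _; exact: gamma_integrand_ge0.
- exact: measurable_gamma_integrand.
under [in RHS]eq_integral.
  move=> t; rewrite inE/= in_itv/= andbT => t0.
  rewrite (_ : gamma_integrand z 1 (c * t) = c `^ (z - 1) * gamma_integrand z c t); last first.
    by rewrite /gamma_integrand mul1r powRM ?(ltW c0) ?(ltW t0)// mulrA.
  rewrite EFinM; over.
rewrite ge0_integralZl_EFin ?powR_ge0//; last 2 first.
- by move=> x _; rewrite lee_fin gamma_integrand_ge0.
- by apply/measurable_EFinP; exact: measurable_gamma_integrand.
rewrite muleA -EFinM -[X in (X * _)%:E]powRr1 ?(ltW c0)//.
rewrite -powRD ?(gt_eqF c0) ?implybT// addrC subrK muleC muleA -EFinM.
by rewrite -powRD ?(gt_eqF c0) ?implybT// addNr powRr0 mul1e.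
Qed.

Let le_of_le_expR (a b k : R) : 0 < k -> 0 <= b ->
  (forall h : R, 0 < h -> a <= expR (k * h) * b) -> a <= b.
Proof.
move=> k0 b0 H; rewrite leNgt; apply/negP => ba.
have a0 : 0 < a by exact: le_lt_trans ba.
have [b_|b_] := eqVneq b 0.
  by have := H 1 ltr01; rewrite b_ mulr0 leNgt a0.
have {}b0 : 0 < b by rewrite lt_neqAle eq_sym b_.
have l0 : 0 < ln (a / b) by rewrite ln_gt0// ltr_pdivlMr// mul1r.
have := H (ln (a / b) / 2 / k); rewrite !divr_gt0// => /(_ isT).
rewrite [k * _]mulrC divfK ?gt_eqF// leNgt => /negP; apply.
rewrite -ltr_pdivlMr// -[in ltRHS](@lnK _ (a / b)) ?posrE ?divr_gt0// ltr_expR.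
by lra.
Qed.

(** Both sides are compared through the integral of [t^(z-1) e^(-t)] minus its
    rescaling by [e^h]: by convexity of the exponential this lies between two
    multiples of the integral of [t^z e^(-t)], and [h] is arbitrary. *)
Lemma GammaS z : 0 < z -> Gamma (z + 1) = z * Gamma z.
Proof.
move=> z0; have z10 : 0 < z + 1 by lra.
have G0 := Gamma_ge0 z0; have G1 := Gamma_ge0 z10.
have mD : measurable (`]0%R, +oo[%classic : set R) by [].
have mg a c : measurable_fun (`]0%R, +oo[%classic : set R)
    (EFin \o gamma_integrand a c).
  by apply/measurable_EFinP; exact: measurable_gamma_integrand.
have g0 a c t : (`]0%R, +oo[%classic : set R) t -> (0 <= (gamma_integrand a c t)%:E)%E.
  by rewrite lee_fin gamma_integrand_ge0.
have g0k k a c t : 0 <= k -> (0 <= k%:E * (gamma_integrand a c t)%:E)%E.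
  by move=> k0; rewrite mule_ge0 ?lee_fin ?gamma_integrand_ge0.
have mgk k a c : measurable_fun (`]0%R, +oo[%classic : set R)
    (fun t => k%:E * (gamma_integrand a c t)%:E)%E.
  by apply: measurable_funeM; exact: mg.
have powE h a : expR h `^ a = expR (a * h) by rewrite -expRM mulrC.
have low h : 0 < h ->
    Gamma z * (1 - expR (- z * h)) <= (expR h - 1) * Gamma (z + 1).
  move=> h0; have c0 := expR_gt0 h.
  have ch : 0 <= expR h - 1 by rewrite subr_ge0 ltW// expR_gt1.
  rewrite mulrBr mulr1 lerBlDr -lee_fin EFinD EFinM !GammaE//.
  rewrite -powE -gamma_integral_scale// -ge0_integralZl_EFin//; last 2 first.
  - by move=> t; exact: g0.
  - exact: mg.
  rewrite -ge0_integralD; [|by []|by move=> t _; exact: g0k|exact: mgk|exact: g0|exact: mg].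
  apply: ge0_le_integral_nonmeas => t; first exact: g0.
  rewrite /= in_itv/= andbT => t0.
  rewrite -EFinM -EFinD lee_fin /gamma_integrand addrK mul1r.
  have -> : t `^ z = t `^ (z - 1) * t.
    by rewrite -[X in _ * X]powRr1 ?(ltW t0)// -powRD ?(gt_eqF t0) ?implybT// subrK.
  rewrite [leRHS](_ : _ = t `^ (z - 1) * ((expR h - 1) * t * expR (- t) + expR (- (expR h * t)))); last by ring.
  rewrite ler_wpM2l ?powR_ge0//.
  have -> : - (expR h * t) = - t + - ((expR h - 1) * t) by ring.
  rewrite expRD [X in X + _]mulrC -mulrDr ler_peMr ?expR_ge0//.
  have := expR_ge1Dx (- ((expR h - 1) * t)); lra.
have up h : 0 < h ->
    (expR h - 1) * (Gamma (z + 1) * expR (- (z + 1) * h)) <=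
    Gamma z * (1 - expR (- z * h)).
  move=> h0; have c0 := expR_gt0 h.
  have ch : 0 <= expR h - 1 by rewrite subr_ge0 ltW// expR_gt1.
  rewrite [leRHS]mulrBr mulr1 lerBrDr -lee_fin EFinD EFinM !GammaE//.
  rewrite -!powE -!gamma_integral_scale// -ge0_integralZl_EFin//; last 2 first.
  - by move=> t; exact: g0.
  - exact: mg.
  rewrite -ge0_integralD; [|by []|by move=> t _; exact: g0k|exact: mgk|exact: g0|exact: mg].
  apply: ge0_le_integral_nonmeas => t.
    by move=> Dt; apply: adde_ge0; [exact: g0k|exact: g0].
  rewrite /= in_itv/= andbT => t0.
  rewrite -EFinM -EFinD lee_fin /gamma_integrand addrK mul1r.
  have -> : t `^ z = t `^ (z - 1) * t.
    by rewrite -[X in _ * X]powRr1 ?(ltW t0)// -powRD ?(gt_eqF t0) ?implybT// subrK.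
  rewrite [leLHS](_ : _ = t `^ (z - 1) * (((expR h - 1) * t + 1) * expR (- (expR h * t)))); last by ring.
  rewrite ler_wpM2l ?powR_ge0//.
  have -> : - t = (expR h - 1) * t + - (expR h * t) by ring.
  rewrite expRD ler_wpM2r ?expR_ge0//.
  have := expR_ge1Dx ((expR h - 1) * t); lra.
apply/eqP; rewrite eq_le; apply/andP; split.
- apply: (@le_of_le_expR _ _ (z + 1)) => //; first by rewrite mulr_ge0// ltW.
  move=> h h0; have eh : h <= expR h - 1 by have := expR_ge1Dx h; lra.
  have ezh : 1 - expR (- z * h) <= z * h.
    by have := expR_ge1Dx (- z * h); lra.
  have H : h * (Gamma (z + 1) * expR (- (z + 1) * h)) <= Gamma z * (z * h).
    apply: (@le_trans _ _ ((expR h - 1) * (Gamma (z + 1) * expR (- (z + 1) * h)))).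
      by rewrite ler_wpM2r// mulr_ge0 ?expR_ge0.
    by apply: le_trans (up _ h0) _; rewrite ler_wpM2l.
  rewrite mulrC -ler_pdivrMr ?expR_gt0// -expRN -mulNr -(ler_pM2l h0).
  by apply: le_trans H _; rewrite le_eqVlt; apply/orP; left; apply/eqP; ring.
- apply: (@le_of_le_expR _ _ (z + 1)) => //.
  move=> h h0.
  have eh : expR h - 1 <= h * expR h.
    have := expR_ge1Dx (- h); rewrite -(ler_pM2r (expR_gt0 h)) expRN mulVf ?gt_eqF ?expR_gt0//; lra.
  have ezh : z * h * expR (- z * h) <= 1 - expR (- z * h).
    have := expR_ge1Dx (z * h); rewrite -(ler_pM2r (expR_gt0 (- z * h))).
    by rewrite mulNr [in X in _ <= X]expRN mulfV ?gt_eqF ?expR_gt0//; lra.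
  have H : Gamma z * (z * h * expR (- z * h)) <= h * expR h * Gamma (z + 1).
    apply: (@le_trans _ _ (Gamma z * (1 - expR (- z * h)))); first by rewrite ler_wpM2l.
    by apply: le_trans (low _ h0) _; rewrite ler_wpM2r.
  rewrite mulrDl mul1r expRD -(ler_pM2l h0).
  move: H; rewrite mulNr expRN mulrA ler_pdivrMr ?expR_gt0// => H.
  apply: (@le_trans _ _ (Gamma z * (z * h))).
    by rewrite le_eqVlt; apply/orP; left; apply/eqP; ring.
  apply: le_trans H _.
  by rewrite le_eqVlt; apply/orP; left; apply/eqP; ring.
Qed.

End gamma.

Section series_lemmas.
Context {R : realType}.
Implicit Types (u : nat -> R).

Lemma cvg_series_expR (x : R) : series (exp_coeff x) @ \oo --> expR x.
Proof. exact: is_cvg_series_exp_coeff. Qed.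

Lemma cvg_series_nneseries u (s : R) : (forall n, 0 <= u n) ->
  series u @ \oo --> s <-> (\sum_(n <oo) (u n)%:E)%E = s%:E.
Proof.
move=> u0.
have E : (fun n => \sum_(0 <= i < n) (u i)%:E)%E = EFin \o series u.
  by apply/funext => n; rewrite /= /series/= sumEFin.
split=> [us|]; first by rewrite E; apply/cvg_lim => //; exact: cvg_EFin (nearW _ _) us.
move=> us; have := @is_cvg_nneseries R (fun n => (u n)%:E) xpredT 0%N.
have u0' n : (0 <= n)%N -> true -> (0 <= (u n)%:E)%E by rewrite lee_fin.
by move=> /(_ u0'); rewrite us E => /fine_cvgP[].
Qed.

End series_lemmas.

Section gamma_values.
Context {R : realType}.
Local Notation leb := (@lebesgue_measure R).
Implicit Types (z b w : R).

Lemma Gamma1 : Gamma (1 : R) = 1.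
Proof.
apply: EFin_inj; rewrite GammaE// -(@integral_exponential_pdf R 1 ltr01).
rewrite integral_itv_obnd_cbnd; last first.
  by apply/measurable_EFinP; exact: measurable_gamma_integrand.
rewrite integral_mkcond; apply: eq_integral => t _.
rewrite /patch; case: ifPn => [|/negP]; rewrite inE/= in_itv/= andbT => t0.
  by rewrite exponential_pdfE// /gamma_integrand subrr powRr0 !mul1r mulN1r.
by rewrite lt0_exponential_pdf// ltNge; apply/negP.
Qed.

Lemma Gamma_nat n : Gamma (n%:R + 1 : R) = n`!%:R.
Proof.
elim: n => [|n IHn]; first by rewrite add0r Gamma1.
by rewrite -natr1 GammaS ?IHn -?natr1 ?factS ?natrM ?natr1 ?ltr0n// natr1.
Qed.

Lemma Gamma_ge_interval z a b (k : R) : 0 < z -> 0 < a -> a <= b -> 0 <= k ->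
  (forall t, a <= t <= b -> k <= t `^ (z - 1) * expR (- t)) ->
  k * (b - a) <= Gamma z.
Proof.
move=> z0 a0 ab k0 H; rewrite -lee_fin GammaE//.
apply: (@le_trans _ _ (\int[leb]_(t in `[a, b]) k%:E)%E).
  rewrite integral_cst//= lebesgue_measure_itv/= lte_fin.
  case: ltP => [_|ba]; first by rewrite -EFinB -EFinM.
  by rewrite mule0 lee_fin (_ : b = a) ?subrr ?mulr0//; apply/eqP; rewrite eq_le ab ba.
rewrite [leLHS]integral_mkcond [leRHS]integral_mkcond.
apply: ge0_le_integral_nonmeas => t _.
  by rewrite /patch; case: ifPn => //; rewrite lee_fin.
rewrite /patch; case: ifPn; last first.
  by case: ifPn => //; rewrite lee_fin gamma_integrand_ge0.
rewrite inE/= in_itv/= => tab; rewrite ifT; last first.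
  by rewrite inE/= in_itv/= andbT; case/andP: tab => + _; exact: lt_le_trans.
by rewrite /gamma_integrand mul1r lee_fin; exact: H.
Qed.

(** The lower half of Stirling's formula, uniformly in [m]. On an interval of
    length the square root of [m] to the right of its maximum at [m], the
    function [t^m e^(- t)] stays within a factor of that maximum, and the
    integrand carries a further [t^(- 1/2)], which compensates for the length. For
    [m < 1] the interval from 1 to 2 does. *)
Lemma Gamma_stirling_le (m u : R) : 0 <= m -> 0 < u ->
  u `^ m * expR (- u) <= 8 * expR 1 * Gamma (m + 2^-1).
Proof.
move=> m0 u0; have e1 : 0 < expR 1 :> R by exact: expR_gt0.
have [m1|m1] := ltP m 1.
  apply: (@le_trans _ _ 1).
    rewrite expRN ler_pdivrMr ?expR_gt0// mul1r.
    have [u1|u1] := leP u 1.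
      apply: (@le_trans _ _ 1); last by rewrite -[leLHS]expR0 ler_expR ltW.
      have [->|mN0] := eqVneq m 0; first by rewrite powRr0.
      by apply: le_trans (powR_le m0 (ltW u0) u1) _; rewrite powR1.
    apply: (@le_trans _ _ (u `^ 1)); first by rewrite ler_powR// ltW.
    by rewrite powRr1 ?(ltW u0)//; apply: le_trans (expR_ge1Dx u); rewrite lerDr.
  have H : 2^-1 * expR (- 2) * (2 - 1) <= Gamma (m + 2^-1).
    apply: Gamma_ge_interval => //; first by lra.
    - by rewrite ler1n.
    - move=> t /andP[t1 t2]; have t0 : 0 < t by lra.
      apply: ler_pM; rewrite ?expR_ge0//; last by rewrite ler_expR; lra.
      apply: (@le_trans _ _ (t `^ (-1))); last by rewrite ler_powR//; lra.
      by rewrite powR_inv1 ?(ltW t0)// lef_pV2 ?posrE.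
  have E : expR (- 2) = (expR 1 * expR 1)^-1 :> R.
    by rewrite -expRD -expRN; congr expR; lra.
  have e3 : expR 1 <= 4 :> R.
    have : expR 2^-1 * expR (- 2^-1) = 1 :> R by rewrite expRxMexpNx_1.
    have := @expR_ge1Dx R (- 2^-1).
    have -> : expR 1 = expR 2^-1 * expR 2^-1 :> R by rewrite -expRD; congr expR; lra.
    set x := expR 2^-1; set y := expR (- 2^-1) => h1 h2.
    have x0 : 0 < x by exact: expR_gt0.
    have : x <= 2 by rewrite -(ler_pM2r (_ : 0 < 2^-1))//; nra.
    by move=> ?; nra.
  rewrite E (_ : 2 - 1 = 1) ?mulr1 in H; last by lra.
  apply: (@le_trans _ _ (8 * expR 1 * (2^-1 / (expR 1 * expR 1)))); last first.
    by rewrite ler_pM2l.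
  rewrite [leRHS](_ : _ = 4 / expR 1); last by field; rewrite gt_eqF.
  by rewrite ler_pdivlMr// mul1r.
have {m0} m0 : 0 < m by lra.
have um : u `^ m * expR (- u) <= m `^ m * expR (- m).
  rewrite expRN ler_pdivrMr ?expR_gt0// -mulrA -expRD addrC.
  exact: powR_le_expR (ltW u0).
apply: le_trans um _.
pose s := Num.sqrt m.
have s0 : 0 < s by rewrite sqrtr_gt0.
have ss : s * s = m by rewrite -expr2 sqr_sqrtr// ltW.
have s1 : 1 <= s by rewrite -[leLHS]sqrtr1; exact: ler_wsqrtr.
have sm : s <= m by rewrite -ss ler_peMl// ltW.
pose k := m `^ m * expR (- m) * expR (-1) * (2 * s)^-1.
have H : k * (m + s - m) <= Gamma (m + 2^-1).
  apply: Gamma_ge_interval => //; first by lra.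
  - by lra.
  - by rewrite !mulr_ge0 ?powR_ge0 ?expR_ge0 ?invr_ge0 ?mulr_ge0 ?ltW.
  move=> t /andP[t1 t2]; have t0 : 0 < t by lra.
  rewrite (_ : m + 2^-1 - 1 = m - 2^-1); last by lra.
  rewrite powRB ?(gt_eqF t0) ?implybT// powR12_sqrt ?(ltW t0)//.
  rewrite mulrAC; apply: ler_pM; rewrite ?mulr_ge0 ?powR_ge0 ?expR_ge0 ?invr_ge0 ?sqrtr_ge0//.
    rewrite mulr_ge0//; exact: ltW.
  (* with x = (t - m) / m in [0, 1], 1 + x >= e^(x / (1 + x)) >= e^(x - x^2) *)
  - pose x := (t - m) / m.
    have x0 : 0 <= x by rewrite divr_ge0 ?subr_ge0// ltW.
    have tE : t = m * (1 + x) by rewrite /x; field; rewrite gt_eqF.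
    have x1 : expR (x - x ^+ 2) <= 1 + x.
      have x10 : 0 < 1 + x by lra.
      have h1 := expR_ge1Dx (- (x / (1 + x))).
      have h2 : 1 + - (x / (1 + x)) = (1 + x)^-1 by field; rewrite gt_eqF.
      rewrite h2 expRN lef_pV2 ?posrE ?expR_gt0// in h1.
      apply: le_trans h1; rewrite ler_expR ler_pdivlMr//.
      have : 0 <= x ^+ 3 by rewrite exprn_ge0.
      by rewrite !exprS expr0; lra.
    rewrite -!mulrA -!expRD.
    have mx : m * x ^+ 2 <= 1.
      have : (t - m) * (t - m) <= s * s by apply: ler_pM; lra.
      rewrite ss tE (_ : m * (1 + x) - m = m * x); last by ring.
      rewrite (_ : m * x * (m * x) = m * (m * x ^+ 2)); last by ring.
      by rewrite -[leRHS]mulr1 ler_pM2l.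
    have -> : t `^ m = m `^ m * (1 + x) `^ m by rewrite tE powRM ?ltW//; lra.
    rewrite -mulrA ler_wpM2l ?powR_ge0//.
    apply: (@le_trans _ _ (expR (x - x ^+ 2) `^ m * expR (- t))).
      rewrite -expRM -expRD ler_expR mulrBl [x ^+ 2 * m]mulrC tE.
      by rewrite mulrDr mulr1 [m * x]mulrC; lra.
    by rewrite ler_wpM2r ?expR_ge0// powR_le ?expR_ge0// ltW.
  - rewrite lef_pV2 ?posrE ?mulr_gt0 ?sqrtr_gt0//.
    have -> : 2 * s = Num.sqrt (4 * m).
      by rewrite sqrtrM ?ler0n// (_ : 4 = 2 ^+ 2) ?sqrtr_sqr ?ger0_norm//; ring.
    by rewrite ler_sqrt; lra.
rewrite -(ler_pM2l (_ : 0 < 8 * expR 1))// in H.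
apply: le_trans H; rewrite /k; set a := m `^ m * expR (- m); rewrite expRN.
rewrite [leRHS](_ : _ = a * 4); last by field; rewrite ?gt_eqF.
rewrite ler_peMr ?mulr_ge0 ?powR_ge0 ?expR_ge0//; lra.
Qed.

Lemma Gamma_gt0 z : 0 < z -> 0 < Gamma z.
Proof.
move=> z0.
have : 0 < Gamma (z + 1).
  have zh : 0 <= z + 2^-1 by lra.
  have := Gamma_stirling_le zh (@ltr01 R); rewrite powR1 mul1r.
  rewrite (_ : z + 2^-1 + 2^-1 = z + 1); last by lra.
  move=> /(lt_le_trans (expR_gt0 _)); rewrite pmulr_rgt0// mulr_gt0 ?expR_gt0//.
by rewrite GammaS// pmulr_rgt0.
Qed.

(** The binomial series, obtained by expanding [e^(w t)] in the Gamma integral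
    with [e^(- (1 - w) t)] and integrating termwise. *)
Lemma cvg_series_Gamma_binomial b w : 0 < b -> 0 <= w < 1 ->
  series (fun l => w ^+ l * Gamma (l%:R + b) / l`!%:R) @ \oo -->
  Gamma b * (1 - w) `^ (- b).
Proof.
move=> b0 /andP[w0 w1].
have lb l : 0 < l%:R + b by rewrite ltr_wpDl.
have f0 l : 0 < l`!%:R :> R by rewrite ltr0n fact_gt0.
apply/cvg_series_nneseries.
  by move=> l; rewrite mulr_ge0 ?invr_ge0 ?ler0n// mulr_ge0 ?exprn_ge0// Gamma_ge0.
rewrite -gamma_integral_scale ?subr_gt0//.
have mD : measurable (`]0%R, +oo[%classic : set R) by [].
pose T l t : \bar R := ((w ^+ l / l`!%:R)%:E * (gamma_integrand (l%:R + b) 1 t)%:E)%E.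
have c0 l : 0 <= w ^+ l / l`!%:R by rewrite mulr_ge0 ?invr_ge0 ?exprn_ge0.
transitivity (\sum_(l <oo) \int[leb]_(t in `]0%R, +oo[) T l t)%E.
  apply: eq_eseriesr => l _; rewrite ge0_integralZl_EFin//; last 2 first.
  - by move=> t _; rewrite lee_fin gamma_integrand_ge0.
  - by apply/measurable_EFinP; exact: measurable_gamma_integrand.
  by rewrite -GammaE// -EFinM mulrAC.
rewrite -integral_nneseries//; last 2 first.
- move=> l; apply: measurable_funeM; apply/measurable_EFinP.
  exact: measurable_gamma_integrand.
- by move=> l t _; rewrite mule_ge0 ?lee_fin ?gamma_integrand_ge0.
apply: eq_integral => t; rewrite inE/= in_itv/= andbT => t0.
rewrite /T; under eq_eseriesr do rewrite -EFinM.
apply/cvg_series_nneseries.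
  by move=> l; rewrite mulr_ge0 ?gamma_integrand_ge0.
have -> : gamma_integrand b (1 - w) t = gamma_integrand b 1 t * expR (w * t).
  by rewrite /gamma_integrand -mulrA -expRD; congr (_ * expR _); ring.
rewrite (_ : (fun l => _) = (fun l => gamma_integrand b 1 t * exp_coeff (w * t) l)).
  rewrite (_ : series _ = (fun n => gamma_integrand b 1 t * series (exp_coeff (w * t)) n)).
    by apply: cvgMr; exact: cvg_series_expR.
  by apply/funext => n; rewrite /series/= mulr_sumr.
apply/funext => l; rewrite /gamma_integrand /exp_coeff/= exprMn.
rewrite -(addrA l%:R) (@powRD _ t l%:R); last by rewrite (gt_eqF t0) implybT.
by rewrite powR_mulrn ?(ltW t0)//; ring.
Qed.

End gamma_values.

(** * Absolutely convergent double series *)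

Section double_series.
Context {R : realType}.
Implicit Types (a : nat -> nat -> R) (u v r : nat -> R).

Lemma cvg_sum_nat M (u : nat -> nat -> R) (l : nat -> R) :
  (forall i, (i < M)%N -> u i @ \oo --> l i) ->
  (fun n => \sum_(0 <= i < M) u i n) @ \oo --> \sum_(0 <= i < M) l i.
Proof.
elim: M => [_|M IH H].
  by rewrite big_geq//; under eq_fun do rewrite big_geq//; exact: cvg_cst.
rewrite big_nat_recr//=; under eq_fun do rewrite big_nat_recr//=.
by apply: cvgD; [apply: IH => i iM; apply: H; exact: ltnW|exact: H].
Qed.

Lemma ge0_series_le_lim u (s : R) n : (forall k, 0 <= u k) ->
  series u @ \oo --> s -> series u n <= s.
Proof.
move=> u0 us; rewrite -(cvg_lim _ us)//; apply: nondecreasing_cvgn_le.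
  by apply: nondecreasing_series => k _ _; exact: u0.
by apply/cvg_ex; exists s.
Qed.

Definition square_sum a N := \sum_(0 <= i < N) \sum_(0 <= j < N) a i j.

Definition abs_summable2 a := exists C : R, forall M N,
  \sum_(0 <= i < M) \sum_(0 <= j < N) `|a i j| <= C.

Lemma abs_summable2_rows a b r (s : R) : (forall i j, `|a i j| <= b i j) ->
  (forall i, series (b i) @ \oo --> r i) -> series r @ \oo --> s ->
  abs_summable2 a.
Proof.
move=> ab br rs; have b0 i j : 0 <= b i j by exact: le_trans (ab i j).
have r0 i : 0 <= r i.
  by apply: le_trans (ge0_series_le_lim 0 (b0 i) (br i)); rewrite /series/= big_geq.
exists s => M N; apply: le_trans (ge0_series_le_lim M r0 rs).
apply: ler_sum => i _; apply: le_trans (ge0_series_le_lim N (b0 i) (br i)).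
by apply: ler_sum => j _.
Qed.

Lemma abs_summable2_transpose a :
  abs_summable2 a -> abs_summable2 (fun i j => a j i).
Proof. by move=> [C HC]; exists C => M N; rewrite exchange_big. Qed.

Section summable.
Variables (a : nat -> nat -> R).
Hypothesis a_sum : abs_summable2 a.

Local Notation P := (square_sum a).
Local Notation Q := (square_sum (fun i j => `|a i j|)).

Lemma square_sum_indicator (b : nat -> nat -> R) M N : (M <= N)%N ->
  square_sum b M = \sum_(0 <= i < N) \sum_(0 <= j < N)
    b i j * ((i < M)%N && (j < M)%N)%:R.
Proof.
move=> MN; rewrite /square_sum (big_nat_widen _ _ N)// big_mkcond/=.
apply: eq_bigr => i _; case: ifPn => iM/=; last first.
  by rewrite big1// => j _; rewrite mulr0.
rewrite (big_nat_widen _ _ N)// big_mkcond/=; apply: eq_bigr => j _.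
by case: ifPn => _; rewrite ?mulr1 ?mulr0.
Qed.

(** Every finite set of indices containing a square gives almost the same sum
    as that square. *)
Lemma exhaustion_dist (E : nat -> nat -> bool) M N : (M <= N)%N ->
  (forall i j, (i < M)%N -> (j < M)%N -> E i j) ->
  `|\sum_(0 <= i < N) \sum_(0 <= j < N) a i j * (E i j)%:R - P M| <= Q N - Q M.
Proof.
move=> MN HE; rewrite !(square_sum_indicator _ MN) -!sumrB.
apply: le_trans (ler_norm_sum _ _ _) _; apply: ler_sum => i _.
rewrite -!sumrB; apply: le_trans (ler_norm_sum _ _ _) _; apply: ler_sum => j _.
rewrite -mulrBr normrM -[X in _ <= X - _]mulr1 -mulrBr ler_wpM2l//.
have [/andP[iM jM]|] := boolP ((i < M)%N && (j < M)%N).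
  by rewrite HE// !subrr normr0.
by rewrite !subr0; case: (E i j); rewrite ?normr1 ?normr0.
Qed.

Lemma square_sum_cvg : exists s : R, P @ \oo --> s.
Proof.
have [C HC] := a_sum.
have cvg_sq (b : nat -> nat -> R) : (forall i j, 0 <= b i j <= 2 * `|a i j|) ->
    cvgn (square_sum b).
  move=> b0; apply: nondecreasing_is_cvgn.
    move=> m n mn; rewrite !(square_sum_indicator b mn) [leRHS](square_sum_indicator b (leqnn n)).
    apply: ler_sum_nat => i /andP[_ iN]; apply: ler_sum_nat => j /andP[_ jN].
    have /andP[b1 _] := b0 i j; rewrite iN jN/= ler_wpM2l// lern1 leq_b1//.
  exists (2 * C) => _ [n _ <-]; apply: (@le_trans _ _ (2 * Q n)); last by rewrite ler_pM2l// HC.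
  rewrite /square_sum mulr_sumr; apply: ler_sum => i _; rewrite mulr_sumr.
  by apply: ler_sum => j _; have /andP[] := b0 i j.
have c1 : cvgn (square_sum (fun i j => a i j + `|a i j|)).
  apply: cvg_sq => i j; have := ler_norm (a i j); have := ler_norm (- a i j).
  by rewrite normrN; lra.
have c2 : cvgn Q by apply: cvg_sq => i j; have := normr_ge0 (a i j); lra.
exists (limn (square_sum (fun i j => a i j + `|a i j|)) - limn Q).
rewrite (_ : P = square_sum (fun i j => a i j + `|a i j|) - Q); last first.
  apply/funext => N; rewrite /square_sum !fctE/= -sumrB; apply: eq_bigr => i _.
  by rewrite -sumrB; apply: eq_bigr => j _; rewrite addrK.
exact: cvgB.
Qed.

Lemma square_sum_tail : exists2 q : R, (forall N, Q N <= q) &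
  (fun M => q - Q M) @ \oo --> 0.
Proof.
have [C HC] := a_sum.
have ndQ : nondecreasing_seq Q.
  move=> m n mn; have := @exhaustion_dist (fun _ _ => true) m n mn (fun _ _ _ _ => isT).
  by move/(le_trans (normr_ge0 _)); rewrite subr_ge0.
have cQ : cvgn Q by apply: nondecreasing_is_cvgn => //; exists C => _ [n _ <-]; exact: HC.
exists (limn Q); first by move=> N; exact: nondecreasing_cvgn_le.
by rewrite -(subrr (limn Q)); apply: cvgB => //; exact: cvg_cst.
Qed.

Lemma cvg_series_rows r (s : R) : P @ \oo --> s ->
  (forall i, series (a i) @ \oo --> r i) -> series r @ \oo --> s.
Proof.
move=> Ps ar; have [q Qq tail] := square_sum_tail.
have H M : `|series r M - P M| <= q - Q M.
  have L : (fun N => `|\sum_(0 <= i < M) series (a i) N - P M|) @ \oo -->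
      `|series r M - P M|.
    apply: cvg_norm; apply: cvgB; last exact: cvg_cst.
    by apply: cvg_sum_nat => i _; exact: ar.
  rewrite -(cvg_lim _ L)//; apply: limr_le; first by apply/cvg_ex; eexists; exact: L.
  exists M => // N /= MN.
  have := @exhaustion_dist (fun i _ => (i < M)%N) M N MN (fun i j iM _ => iM).
  rewrite (_ : \sum_(0 <= i < M) _ =
    \sum_(0 <= i < N) \sum_(0 <= j < N) a i j * (i < M)%N%:R); last first.
    rewrite (big_nat_widen _ _ N)// big_mkcond/=; apply: eq_bigr => i _.
    case: ifPn => _; last by rewrite big1// => j _; rewrite mulr0.
    by apply: eq_bigr => j _; rewrite mulr1.
  by move/le_trans; apply; rewrite lerD2r.
have d0 : (fun M => series r M - P M) @ \oo --> 0.
  apply: norm_cvg0; apply: (squeeze_cvgr _ (cvg_cst 0) tail).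
  by apply: nearW => M; rewrite normr_ge0 H.
rewrite (_ : series r = (fun M => (series r M - P M) + P M)); last first.
  by apply/funext => M; rewrite subrK.
by rewrite -[s]add0r; exact: cvgD.
Qed.

Lemma cvg_series_triangle (s : R) : P @ \oo --> s ->
  series (fun m => \sum_(0 <= k < m.+1) a k (m - k)%N) @ \oo --> s.
Proof.
move=> Ps; have [q Qq tail] := square_sum_tail.
set v := series _.
have vE N : v N = \sum_(0 <= i < N) \sum_(0 <= j < N) a i j * (i + j < N)%N%:R.
  transitivity (\sum_(0 <= i < N) \sum_(0 <= j < N - i) a i j).
    rewrite /v /series/=; elim: N => [|N IH]; first by rewrite !big_geq.
    rewrite big_nat_recr//= IH [X in _ = X]big_nat_recr//= subSnn big_nat1.
    rewrite [X in _ + X = _]big_nat_recr//= subnn addrA; congr +%R.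
    rewrite -big_split/=; apply: eq_big_nat => i /andP[_ iN].
    by rewrite subSn 1?ltnW// big_nat_recr.
  apply: eq_big_nat => i /andP[_ iN].
  rewrite (big_nat_widen _ _ N) ?leq_subr// big_mkcond/=; apply: eq_bigr => j _.
  by rewrite ltn_subRL addnC; case: ifPn => _; rewrite ?mulr1 ?mulr0.
have half : (fun N => N./2) @ \oo --> \oo.
  apply/cvgnyPge => A; exists A.*2 => // N /= AN.
  by rewrite -[A]doubleK half_leq.
have H N : `|v N - P N./2| <= q - Q N./2.
  have hN : (N./2 <= N)%N by rewrite -[leqRHS]odd_double_half -addnn addnA leq_addl.
  have := @exhaustion_dist (fun i j => (i + j < N)%N) N./2 N hN.
  rewrite -vE => /(_ _)/le_trans; apply; last by rewrite lerD2r.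
  move=> i j iN jN; apply: (@leq_trans (N./2 + N./2)).
    by rewrite -addSn leq_add// ltnW.
  by rewrite addnn -[leqRHS]odd_double_half leq_addl.
have d0 : (fun N => v N - P N./2) @ \oo --> 0.
  apply: norm_cvg0; apply: (squeeze_cvgr _ (cvg_cst 0) (cvg_comp _ _ half tail)).
  by apply: nearW => M; rewrite normr_ge0 H.
rewrite (_ : v = (fun N => (v N - P N./2) + P N./2)); last first.
  by apply/funext => N; rewrite subrK.
by rewrite -[s]add0r; apply: cvgD d0 (cvg_comp _ _ half Ps).
Qed.

End summable.

(** Rows and diagonals both sum to the limit of the sums over squares. *)
Lemma cvg_series_diagonals a r (s : R) : abs_summable2 a ->
  (forall i, series (a i) @ \oo --> r i) -> series r @ \oo --> s ->
  series (fun m => \sum_(0 <= k < m.+1) a k (m - k)%N) @ \oo --> s.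
Proof.
move=> sa ar rs; have [s' Ps] := square_sum_cvg sa.
have -> : s = s' by apply: cvg_unique rs (cvg_series_rows sa Ps ar).
exact: cvg_series_triangle.
Qed.

(** The same for rows and columns. *)
Lemma cvg_series_exchange a r c (s : R) : abs_summable2 a ->
  (forall i, series (a i) @ \oo --> r i) ->
  (forall j, series (a ^~ j) @ \oo --> c j) -> series c @ \oo --> s ->
  series r @ \oo --> s.
Proof.
move=> sa ar ac cs; have [s' Ps] := square_sum_cvg sa.
have -> : s = s'; last exact: cvg_series_rows Ps ar.
have sa' := abs_summable2_transpose sa.
have E : square_sum (fun i j => a j i) = square_sum a.
  by apply/funext => N; rewrite /square_sum exchange_big.
have Ps' := Ps; rewrite -E in Ps'.
exact: cvg_unique cs (cvg_series_rows sa' Ps' ac).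
Qed.

End double_series.

(** * The Hille-Hardy formula *)

Section normalized_laguerre.
Context {R : realType}.
Implicit Types (nu x A : R).

Definition gam nu (k : nat) : R := Gamma (k%:R + nu + 1).

(** The Laguerre polynomial of degree [m] divided by [gam nu m]. *)
Definition lag nu (m : nat) x : R :=
  \sum_(0 <= i < m.+1) (- x) ^+ i / (i`!%:R * (m - i)`!%:R * gam nu i).

Lemma fact_gt0R k : 0 < k`!%:R :> R.
Proof. by rewrite ltr0n fact_gt0. Qed.

Lemma fact_neq0R k : k`!%:R != 0 :> R.
Proof. by rewrite gt_eqF// fact_gt0R. Qed.

Section fixed_order.
Variable nu : R.
Hypothesis nuN1 : -1 < nu.

Let arg_gt0 k : 0 < k%:R + nu + 1.
Proof. by rewrite -addrA ltr_wpDl//; have := nuN1; lra. Qed.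

Lemma gam_gt0 k : 0 < gam nu k.
Proof. by rewrite /gam Gamma_gt0. Qed.

Lemma gam_neq0 k : gam nu k != 0.
Proof. by rewrite gt_eqF// gam_gt0. Qed.

Lemma gamS k : gam nu k.+1 = (k%:R + nu + 1) * gam nu k.
Proof.
rewrite /gam -GammaS//; congr Gamma.
by rewrite -natr1; ring.
Qed.

Lemma gam_shift k : gam nu k.+1 = gam (nu + 1) k.
Proof. by rewrite /gam; congr Gamma; rewrite -natr1; ring. Qed.

Lemma gbinomE i n : gbinom ((i + n)%:R + nu) n * n`!%:R * gam nu i = gam nu (i + n).
Proof.
rewrite /gbinom divfK ?fact_neq0R//; elim: n => [|n IH].
  by rewrite big_ord0 mul1r addn0.
rewrite big_ord_recl subr0 addnS gamS -IH -mulrA; congr (_ * _).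
  by rewrite -natr1 natrD; ring.
congr (_ * _); apply: eq_bigr => k _.
by rewrite /= /bump/= add1n -!natr1; ring.
Qed.

Lemma Laguerre_polyE m x : (Laguerre_poly nu m).[x] = gam nu m * lag nu m x.
Proof.
rewrite /Laguerre_poly horner_poly /lag big_mkord mulr_sumr.
apply: eq_bigr => -[i /= im] _; rewrite ltnS in im.
have H := gbinomE i (m - i); rewrite subnKC// in H.
have -> : gbinom (m%:R + nu) (m - i) = gam nu m / ((m - i)`!%:R * gam nu i).
  by rewrite -H -(mulrA (gbinom _ _)) mulfK// mulf_neq0 ?fact_neq0R ?gam_neq0.
rewrite (exprNn x); field.
by rewrite !fact_neq0R gam_neq0.
Qed.

End fixed_order.

Lemma lag_norm_le nu m x : -1 < nu -> `|lag nu m x| <= lag nu m (- `|x|).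
Proof.
move=> nuN1; apply: le_trans (ler_norm_sum _ _ _) _; apply: ler_sum => i _.
rewrite normrM normrX normrN opprK ger0_norm//.
by rewrite invr_ge0 !mulr_ge0 ?ler0n// ltW// gam_gt0.
Qed.

(** The Chu-Vandermonde identity, by induction on [i] for all orders at once:
    raising [i] amounts to raising [nu]. *)
Lemma gam_vandermonde nu m i : -1 < nu ->
  gam nu (m + i) / (m`!%:R * gam nu i) =
  \sum_(0 <= j < m.+1) 'C(i, j)%:R * (gam nu m / ((m - j)`!%:R * gam nu j)).
Proof.
elim: i nu => [|i IH] nu nuN1.
  rewrite addn0 big_nat_recl// subn0 bin0 mul1r big1 ?addr0// => j _.
  by rewrite bin_small// mul0r.
have nu1 : -1 < nu + 1 by lra.
rewrite addnS !gam_shift IH//.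
have c_sum j : (j < m)%N ->
    gam (nu + 1) m / ((m - j)`!%:R * gam (nu + 1) j) =
    gam nu m / ((m - j)`!%:R * gam nu j) +
    gam nu m / ((m - j.+1)`!%:R * gam nu j.+1).
  move=> jm; rewrite -!gam_shift !gamS//.
  have -> : (m - j = (m - j.+1).+1)%N by rewrite subnSK.
  have mE : m%:R = (m - j.+1)%:R + j%:R + 1 :> R.
    by rewrite -natrD natr1 -addnS subnK.
  rewrite factS natrM -natr1 mE.
  field; rewrite fact_neq0R gam_neq0//=.
  rewrite natr1 pnatr_eq0/= gt_eqF//.
  have : 0 <= j%:R :> R by rewrite ler0n.
  by lra.
rewrite [in RHS]big_nat_recl// bin0 mul1r subn0.
under [in RHS]eq_bigr do rewrite binS natrD mulrDl.
rewrite big_split/= addrA.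
rewrite [X in _ = X + _](_ : _ = \sum_(0 <= j < m.+1) 'C(i, j)%:R *
   (gam nu m / ((m - j)`!%:R * gam nu j))); last first.
  by rewrite [RHS]big_nat_recl// bin0 mul1r subn0.
rewrite [in LHS]big_nat_recr//= [in RHS]big_nat_recr//= addrAC -big_split/=.
congr (_ + _).
  by apply: eq_big_nat => j /andP[_ jm]; rewrite c_sum// mulrDr.
by rewrite subnn fact0 !mul1r !mulfV ?gam_neq0.
Qed.

Lemma cvg_series_shift (u : nat -> R) (s : R) j : series u @ \oo --> s ->
  series (fun i => if (j <= i)%N then u (i - j)%N else 0) @ \oo --> s.
Proof.
move=> us; rewrite -(cvg_shiftn j).
rewrite (_ : (fun n => _) = series u)//; apply/funext => n.
rewrite /series/= addnC (big_cat_nat _ (n := j))//= ?leq_addr//.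
rewrite big_nat_cond big1 ?add0r; last first.
  by move=> i /andP[/andP[_ ij] _]; rewrite leqNgt ij.
rewrite -{1}(addn0 j) addnC big_addn addKn.
by apply: eq_bigr => i _; rewrite leq_addl addnK.
Qed.

(** Kummer's transformation: by Vandermonde's identity the coefficients are those
    of the product of [e^(- A)] with the polynomial. *)
Lemma cvg_series_kummer nu m A : -1 < nu ->
  series (fun i => (- A) ^+ i * gam nu (m + i) / (i`!%:R * gam nu i)) @ \oo -->
  m`!%:R * gam nu m * expR (- A) * lag nu m A.
Proof.
move=> nuN1.
pose c j : R := (- A) ^+ j * gam nu m * m`!%:R / (j`!%:R * (m - j)`!%:R * gam nu j).
pose v j i : R := if (j <= i)%N then exp_coeff (- A) (i - j)%N else 0.
have -> : m`!%:R * gam nu m * expR (- A) * lag nu m A =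
    \sum_(0 <= j < m.+1) c j * expR (- A).
  rewrite /lag mulr_sumr; apply: eq_bigr => j _; rewrite /c; ring.
rewrite (_ : series _ = fun n => \sum_(0 <= j < m.+1) c j * series (v j) n).
  apply: (cvg_sum_nat (u := fun j n => c j * series (v j) n)) => j _.
  by apply: cvgMr; apply: cvg_series_shift; exact: cvg_series_expR.
apply/funext => n; rewrite /series/=.
under [RHS]eq_bigr do rewrite mulr_sumr.
rewrite exchange_big/=; apply: eq_bigr => i _.
have -> : (- A) ^+ i * gam nu (m + i) / (i`!%:R * gam nu i) =
   (- A) ^+ i * m`!%:R / i`!%:R * (gam nu (m + i) / (m`!%:R * gam nu i)).
  by field; rewrite !fact_neq0R gam_neq0.
rewrite gam_vandermonde// mulr_sumr; apply: eq_bigr => j _.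
rewrite /v; case: leqP => [ji|ij]; last by rewrite bin_small// mul0r !mulr0.
rewrite /c /exp_coeff/=.
have -> : (- A) ^+ i = (- A) ^+ j * (- A) ^+ (i - j) by rewrite -exprD subnKC.
have -> : i`!%:R = 'C(i, j)%:R * j`!%:R * (i - j)`!%:R :> R.
  by rewrite -(bin_fact ji) !natrM mulrA.
have C0 : 'C(i, j)%:R != 0 :> R by rewrite pnatr_eq0 -lt0n bin_gt0.
field.
by rewrite !fact_neq0R gam_neq0 ?C0.
Qed.

End normalized_laguerre.

Section hille_hardy.
Context {R : realType}.
Variable nu : R.
Hypothesis nu_ge : - 2^-1 <= nu.
Implicit Types (A B X Y w : R).

Local Notation g := (gam nu).
Local Notation lag := (lag nu).

Let nuN1 : -1 < nu. Proof. by have := nu_ge; lra. Qed.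

Lemma gam_lower k : (8 * expR 1 * expR 1)^-1 <= g k.
Proof.
have m0 : 0 <= k%:R + (nu + 2^-1).
  by rewrite addr_ge0//; have := nu_ge; lra.
have := Gamma_stirling_le m0 (@ltr01 R); rewrite powR1 mul1r.
rewrite (_ : k%:R + (nu + 2^-1) + 2^-1 = k%:R + nu + 1); last by field.
rewrite -/(g k) expRN => H.
by rewrite invfM -ler_pdivlMl// ?invrK// invr_gt0.
Qed.

Lemma invr_fact_gam_ge0 k : 0 <= (k`!%:R * g k)^-1.
Proof. by rewrite invr_ge0 mulr_ge0// ltW// gam_gt0. Qed.

(** The power series of the modified Bessel function of order [nu], without its
    leading power: its value at z^2 / 4 is (z / 2)^(- nu) I_nu (z). *)
Definition bessel_series A : R := limn (series (fun j => A ^+ j / (j`!%:R * g j))).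

Lemma cvg_bessel_series A :
  series (fun j => A ^+ j / (j`!%:R * g j)) @ \oo --> bessel_series A.
Proof.
suff : cvgn (series (fun j => A ^+ j / (j`!%:R * g j))) by [].
apply: normed_cvg.
pose K : R := 8 * expR 1 * expR 1.
have Kgt0 : 0 < K by rewrite !mulr_gt0 ?expR_gt0.
have K0 : 0 <= K by exact: ltW.
apply: (@series_le_cvg _ _ (fun j => K * exp_coeff `|A| j)) => [j|j|j|].
- exact: normr_ge0.
- by rewrite mulr_ge0 ?exp_coeff_ge0 ?normr_ge0.
- rewrite [leLHS]/= normrM normrX (ger0_norm (invr_fact_gam_ge0 j)).
  rewrite [leLHS](_ : _ = (g j)^-1 * (`|A| ^+ j / j`!%:R)); last first.
    by rewrite invfM mulrA mulrC.
  rewrite /exp_coeff/= ler_wpM2r ?divr_ge0 ?exprn_ge0//.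
  by rewrite -[leRHS]invrK lef_pV2 ?posrE ?gam_gt0 ?invr_gt0//; exact: gam_lower.
- apply/cvg_ex; exists (K * expR `|A|).
  rewrite (_ : series _ = fun n => K * series (exp_coeff `|A|) n).
    by apply: cvgMr; exact: cvg_series_expR.
  by apply/funext => n; rewrite /series/= mulr_sumr.
Qed.

Lemma cvg_series_scale (u : nat -> R) (c s : R) : series u @ \oo --> s ->
  series (fun n => c * u n) @ \oo --> c * s.
Proof.
move=> us; rewrite (_ : series _ = fun n => c * series u n); first exact: cvgMr.
by apply/funext => n; rewrite /series/= mulr_sumr.
Qed.

(** The coefficients of [lag] are the diagonals of the product of the exponential
    and the Bessel series. *)
Lemma lag_generating_bessel A B :
  series (fun i => (- B) ^+ i * lag i A) @ \oo -->
  expR (- B) * bessel_series (A * B).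
Proof.
pose a A B k l : R := (A * B) ^+ k / (k`!%:R * g k) * exp_coeff (- B) l.
have row A' B' k : series (a A' B' k) @ \oo -->
    expR (- B') * ((A' * B') ^+ k / (k`!%:R * g k)).
  by rewrite mulrC; apply: cvg_series_scale; exact: cvg_series_expR.
have tot A' B' : series (fun k => expR (- B') * ((A' * B') ^+ k / (k`!%:R * g k))) @ \oo -->
    expR (- B') * bessel_series (A' * B').
  by apply: cvg_series_scale; exact: cvg_bessel_series.
have sa : abs_summable2 (a A B).
  apply: (abs_summable2_rows (b := a (- `|A|) (- `|B|)) _ (row _ _) (tot _ _)).
  move=> i j; rewrite /a mulrNN !normrM normrX normrM opprK.
  rewrite (ger0_norm (invr_fact_gam_ge0 i)).
  by rewrite /exp_coeff/= ?normrM ?normrX ?normrN [`|_^-1|]ger0_norm// invr_ge0.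
have := cvg_series_diagonals sa (row _ _) (tot _ _).
rewrite (_ : series _ = series (fun i => (- B) ^+ i * lag i A))//.
congr series; apply/funext => i; rewrite /lag mulr_sumr.
apply: eq_big_nat => k; rewrite ltnS => /andP[_ ki].
rewrite /a /exp_coeff/=.
have -> : (- B) ^+ i = (- B) ^+ k * (- B) ^+ (i - k) by rewrite -exprD subnKC.
have -> : (A * B) ^+ k = (- A) ^+ k * (- B) ^+ k by rewrite -exprMn mulrNN.
field; rewrite !fact_neq0R gam_neq0//.
Qed.

Section parameter.
Variable w : R.
Hypothesis w01 : 0 <= w < 1.

Let w0 : 0 <= w. Proof. by case/andP: w01. Qed.
Let w1 : 0 < 1 - w. Proof. by rewrite subr_gt0; case/andP: w01. Qed.

(** Expanding [lag] in powers of [X] leaves binomial series in [w]; what they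
    leave is the series of Kummer's transformation in degree [i]. *)
Lemma lag_generating_gam i X :
  series (fun m => w ^+ m * g (m + i) * lag m X) @ \oo -->
  (1 - w) `^ (- (i%:R + nu + 1)) *
    (i`!%:R * g i * expR (- (X * w / (1 - w))) * lag i (X * w / (1 - w))).
Proof.
pose a X k l : R := (- X * w) ^+ k / (k`!%:R * g k) *
  (w ^+ l * Gamma (l%:R + ((k + i)%:R + nu + 1)) / l`!%:R).
pose r X k : R := (1 - w) `^ (- (i%:R + nu + 1)) *
  ((- (X * w / (1 - w))) ^+ k * g (i + k) / (k`!%:R * g k)).
have b0 k : 0 < (k + i)%:R + nu + 1 by rewrite -addrA ltr_wpDl//; have := nuN1; lra.
have row X' k : series (a X' k) @ \oo --> r X' k.
  suff <- : (- X' * w) ^+ k / (k`!%:R * g k) *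
      (Gamma ((k + i)%:R + nu + 1) * (1 - w) `^ (- ((k + i)%:R + nu + 1))) =
      r X' k.
    by apply: cvg_series_scale; exact: cvg_series_Gamma_binomial.
  rewrite /r (addnC k i) -/(g (i + k)).
  rewrite (_ : - ((i + k)%:R + nu + 1) = - (i%:R + nu + 1) + - k%:R); last first.
    by rewrite natrD; ring.
  rewrite powRD; last by rewrite (gt_eqF w1) implybT.
  rewrite (powRN _ k%:R) powR_mulrn ?(ltW w1)// -exprVn.
  by rewrite -!mulNr [in RHS]exprMn; ring.
have tot X' : series (r X') @ \oo --> (1 - w) `^ (- (i%:R + nu + 1)) *
    (i`!%:R * g i * expR (- (X' * w / (1 - w))) * lag i (X' * w / (1 - w))).
  by apply: cvg_series_scale; exact: cvg_series_kummer.
have G0 l k : 0 <= Gamma (l%:R + ((k + i)%:R + nu + 1)).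
  by rewrite Gamma_ge0// ltr_wpDl.
have sa : abs_summable2 (a X).
  apply: (abs_summable2_rows (b := a (- `|X|)) _ (row _) (tot _)).
  move=> k l; rewrite /a opprK !normrM !normrX normrM normrN.
  rewrite (ger0_norm w0) (ger0_norm (G0 _ _)) (ger0_norm (invr_fact_gam_ge0 k)).
  by rewrite [`|_^-1|]ger0_norm// invr_ge0.
have := cvg_series_diagonals sa (row _) (tot _).
rewrite (_ : series _ = series (fun m => w ^+ m * g (m + i) * lag m X))//.
congr series; apply/funext => m; rewrite /lag mulr_sumr.
apply: eq_big_nat => k; rewrite ltnS => /andP[_ km].
rewrite /a exprMn.
have -> : Gamma ((m - k)%:R + ((k + i)%:R + nu + 1)) = g (m + i).
  by rewrite /gam; congr Gamma; rewrite !addrA -natrD addnA subnK.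
have -> : w ^+ m = w ^+ k * w ^+ (m - k) by rewrite -exprD subnKC.
by field; rewrite !fact_neq0R gam_neq0.
Qed.

(** The Hille-Hardy formula. Kummer's transformation turns one of the two
    polynomials into a series, after which the sum over [m] is a generating
    function and the remaining sum is again a product of simple series. *)
Theorem hille_hardy X Y :
  series (fun m => w ^+ m * m`!%:R * g m * lag m X * lag m Y) @ \oo -->
  (1 - w) `^ (- (nu + 1)) * expR (- ((X + Y) * w / (1 - w))) *
    bessel_series (X * Y * w / (1 - w) ^+ 2).
Proof.
pose a X Y m i : R := w ^+ m * lag m X * ((- Y) ^+ i * g (m + i) / (i`!%:R * g i)).
pose r X Y m : R := w ^+ m * lag m X * (m`!%:R * g m * expR (- Y) * lag m Y).
pose c X Y i : R := (- Y) ^+ i / (i`!%:R * g i) *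
  ((1 - w) `^ (- (i%:R + nu + 1)) *
    (i`!%:R * g i * expR (- (X * w / (1 - w))) * lag i (X * w / (1 - w)))).
pose s X Y : R := (1 - w) `^ (- (nu + 1)) * expR (- (X * w / (1 - w))) *
  (expR (- (Y / (1 - w))) * bessel_series (X * w / (1 - w) * (Y / (1 - w)))).
have row X' Y' m : series (a X' Y' m) @ \oo --> r X' Y' m.
  by apply: cvg_series_scale; exact: cvg_series_kummer.
have col X' Y' i : series ((a X' Y')^~ i) @ \oo --> c X' Y' i.
  have := cvg_series_scale (c := (- Y') ^+ i / (i`!%:R * g i))
    (@lag_generating_gam i X').
  rewrite (_ : series _ = series ((a X' Y')^~ i))//; congr series.
  by apply/funext => m; rewrite /a; ring.
have tot X' Y' : series (c X' Y') @ \oo --> s X' Y'.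
  have := cvg_series_scale
    (c := (1 - w) `^ (- (nu + 1)) * expR (- (X' * w / (1 - w))))
    (@lag_generating_bessel (X' * w / (1 - w)) (Y' / (1 - w))).
  rewrite (_ : series _ = series (c X' Y'))//; congr series.
  apply/funext => i; rewrite /c.
  rewrite (_ : - (i%:R + nu + 1) = - (nu + 1) + - i%:R); last by ring.
  rewrite powRD; last by rewrite (gt_eqF w1) implybT.
  rewrite (powRN _ i%:R) powR_mulrn ?(ltW w1)//.
  have -> : (- (Y' / (1 - w))) ^+ i = (- Y') ^+ i / (1 - w) ^+ i.
    by rewrite -mulNr exprMn exprVn.
  by field; rewrite !fact_neq0R gam_neq0// expf_neq0 ?gt_eqF.
have sa : abs_summable2 (a X Y).
  apply: (@abs_summable2_transpose _ (fun i m => a X Y m i)).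
  apply: (abs_summable2_rows (b := fun i m => a (- `|X|) (- `|Y|) m i) _
    (col _ _) (tot _ _)).
  move=> i m; rewrite /a opprK !normrM !normrX normrN (ger0_norm w0).
  rewrite (ger0_norm (ltW (gam_gt0 nuN1 _))).
  rewrite (ger0_norm (invr_fact_gam_ge0 i)).
  rewrite ler_wpM2r//.
    rewrite mulr_ge0 ?invr_ge0 ?mulr_ge0 ?exprn_ge0//; exact: ltW (gam_gt0 _ _).
  by rewrite ler_wpM2l ?exprn_ge0// lag_norm_le.
have := cvg_series_exchange sa (row _ _) (col _ _) (tot _ _).
move=> /(cvg_series_scale (c := expR Y)).
rewrite (_ : series _ = series (fun m => w ^+ m * m`!%:R * g m * lag m X * lag m Y)); last first.
  congr series; apply/funext => m; rewrite /r expRN.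
  by field; rewrite gt_eqF ?expR_gt0.
rewrite (_ : expR Y * _ = (1 - w) `^ (- (nu + 1)) *
  expR (- ((X + Y) * w / (1 - w))) * bessel_series (X * Y * w / (1 - w) ^+ 2))//.
rewrite /s (_ : X * w / (1 - w) * (Y / (1 - w)) = X * Y * w / (1 - w) ^+ 2); last first.
  by field; rewrite gt_eqF.
have -> : - ((X + Y) * w / (1 - w)) = Y + - (X * w / (1 - w)) + - (Y / (1 - w)).
  by field; rewrite gt_eqF.
by rewrite !expRD; ring.
Qed.

End parameter.

End hille_hardy.

(** * The heat kernel *)

Section one_dimension.
Context {R : realType}.
Implicit Types (nu t x y u : R).

(** Termwise: [u^(n + nu + 1/2) / gam nu n] is at most a multiple of [e^u] by
    Stirling's bound, whatever [nu], which leaves an exponential series. This is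
    where uniformity in the order comes from. *)
Lemma le_bessel_series nu u : - 2^-1 <= nu -> 0 < u ->
  0 <= u `^ (nu + 2^-1) * bessel_series nu (u * u) <= 8 * expR 1 * expR (2 * u).
Proof.
move=> nu_ge u0; have nuN1 : -1 < nu by lra.
have := cvg_series_scale (c := u `^ (nu + 2^-1)) (@cvg_bessel_series _ _ nu_ge (u * u)).
set v := (fun n => _) => vs.
have v0 n : 0 <= v n.
  by rewrite mulr_ge0 ?powR_ge0// divr_ge0 ?exprn_ge0 ?mulr_ge0// ltW// ?gam_gt0.
have vb n : v n <= 8 * expR 1 * expR u * exp_coeff u n.
  have m0 : 0 <= n%:R + (nu + 2^-1) by rewrite addr_ge0//; lra.
  have := Gamma_stirling_le m0 u0.
  rewrite (_ : n%:R + (nu + 2^-1) + 2^-1 = n%:R + nu + 1); last by field.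
  rewrite -/(gam nu n) expRN ler_pdivrMr ?expR_gt0//.
  rewrite powRD ?(gt_eqF u0) ?implybT// powR_mulrn ?(ltW u0)// => H.
  rewrite /v /exp_coeff/= exprMn.
  have g0 := gam_gt0 nuN1 n; have f0 : 0 < n`!%:R :> R by rewrite ltr0n fact_gt0.
  rewrite [leLHS](_ : _ = u ^+ n / n`!%:R * (u ^+ n * u `^ (nu + 2^-1) / gam nu n)); last first.
    by field; rewrite !gt_eqF.
  rewrite [leRHS]mulrC ler_wpM2l ?divr_ge0 ?exprn_ge0 ?(ltW u0) ?(ltW f0)//.
  by rewrite ler_pdivrMr// (le_trans H)// le_eqVlt; apply/orP; left; apply/eqP; ring.
apply/andP; split.
  by apply: le_trans (ge0_series_le_lim 0 v0 vs); rewrite /series/= big_geq.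
have -> : 8 * expR 1 * expR (2 * u) = 8 * expR 1 * expR u * expR u.
  by rewrite -[RHS]mulrA -expRD; congr (_ * expR _); ring.
have es := cvg_series_scale (c := 8 * expR 1 * expR u) (@cvg_series_expR _ u).
rewrite -(cvg_lim _ vs)// -(cvg_lim _ es)//.
apply: ler_lim; [by apply/cvg_ex; eexists; exact: vs|by apply/cvg_ex; eexists; exact: es|].
by apply: nearW => n; apply: ler_sum => k _; exact: vb.
Qed.

(** With [w = e^(-4t)]: half the inverse of sinh (2t), and coth (2t). *)
Definition csch2t t := expR (- (2 * t)) / (1 - expR (- (4 * t))) : R.
Definition coth2t t := (1 + expR (- (4 * t))) / (1 - expR (- (4 * t))) : R.

Let expR4 t : expR (- (4 * t)) = expR (- (2 * t)) ^+ 2.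
Proof. by rewrite -expRM_natl; congr expR; ring. Qed.

Lemma expR4_lt1 t : 0 < t -> 0 <= expR (- (4 * t)) < 1.
Proof. by move=> t0; rewrite expR_ge0 expR_lt1; lra. Qed.

Lemma csch2t_gt0 t : 0 < t -> 0 < csch2t t.
Proof.
by move=> t0; rewrite divr_gt0 ?expR_gt0// subr_gt0; case/andP: (expR4_lt1 t0).
Qed.

Lemma csch2t_le_coth2t t : 0 < t -> 2 * csch2t t <= coth2t t.
Proof.
move=> t0; have /andP[_ w1] := expR4_lt1 t0.
rewrite /csch2t /coth2t mulrA ler_wpM2r ?invr_ge0 ?subr_ge0 ?(ltW w1)//.
rewrite expR4; have := sqr_ge0 (1 - expR (- (2 * t))).
by rewrite !expr2; lra.
Qed.

Definition heat_term1 nu t x y (k : nat) : R :=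
  expR (- (t * (4 * k%:R + 2 * nu + 2))) *
    (Laguerre_fun1 nu k x * Laguerre_fun1 nu k y).

Definition heat_factor nu t x y : R := 2 * expR (- (2 * t)) `^ (nu + 1) *
  (x * y) `^ (nu + 2^-1) * expR (- ((x ^+ 2 + y ^+ 2) / 2)).

Lemma heat_term1E nu t x y k : - 2^-1 <= nu -> 0 < x -> 0 < y ->
  heat_term1 nu t x y k = heat_factor nu t x y *
    (expR (- (4 * t)) ^+ k * k`!%:R * gam nu k * lag nu k (x ^+ 2) *
     lag nu k (y ^+ 2)).
Proof.
move=> nu_ge x0 y0; have nuN1 : -1 < nu by lra.
have g0 := gam_gt0 nuN1 k.
rewrite /heat_term1 /Laguerre_fun1 !Laguerre_polyE// Gamma_nat -/(gam nu k).
set sq := Num.sqrt _.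
have sqE : sq * sq = 2 * k`!%:R / gam nu k.
  by rewrite -expr2 sqr_sqrtr// divr_ge0 ?(ltW g0)// mulr_ge0.
have -> : - (t * (4 * k%:R + 2 * nu + 2)) = k%:R * - (4 * t) + - (2 * t) * (nu + 1).
  by ring.
rewrite expRD expRM_natl expRM /heat_factor powRM ?(ltW x0) ?(ltW y0)//.
have -> : - ((x ^+ 2 + y ^+ 2) / 2) = - (x ^+ 2 / 2) + - (y ^+ 2 / 2) by ring.
rewrite [in RHS]expRD.
transitivity (expR (- (4 * t)) ^+ k * expR (- (2 * t)) `^ (nu + 1) * (sq * sq) *
  (gam nu k * lag nu k (x ^+ 2)) * (gam nu k * lag nu k (y ^+ 2)) *
  (x `^ (nu + 2^-1) * y `^ (nu + 2^-1)) *
  (expR (- (x ^+ 2 / 2)) * expR (- (y ^+ 2 / 2)))); first by ring.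
by rewrite sqE; field; rewrite gt_eqF.
Qed.

Lemma heat_term1_summable nu t x y : - 2^-1 <= nu -> 0 < t -> 0 < x -> 0 < y ->
  exists B, forall M, \sum_(0 <= k < M) `|heat_term1 nu t x y k| <= B.
Proof.
move=> nu_ge t0 x0 y0; have nuN1 : -1 < nu by lra.
have w01 := expR4_lt1 t0; have /andP[w0 w1] := w01.
have F0 : 0 <= heat_factor nu t x y.
  by rewrite !mulr_ge0 ?powR_ge0 ?expR_ge0.
have S := cvg_series_scale (c := heat_factor nu t x y)
  (@hille_hardy _ _ nu_ge _ w01 (- x ^+ 2) (- y ^+ 2)).
eexists => M; apply: le_trans (ge0_series_le_lim M _ S) => [|k].
- apply: ler_sum => k _; rewrite heat_term1E// normrM (ger0_norm F0).
  rewrite ler_wpM2l// !normrM normrX (ger0_norm w0).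
  rewrite (ger0_norm (ltW (gam_gt0 nuN1 k))) [`|k`!%:R|]ger0_norm//.
  have g0 := ltW (gam_gt0 nuN1 k).
  apply: ler_pM; rewrite ?mulr_ge0 ?exprn_ge0//.
    rewrite ler_wpM2l ?mulr_ge0 ?exprn_ge0//.
    by have := lag_norm_le k (x ^+ 2) nuN1; rewrite [`|x ^+ 2|]ger0_norm ?sqr_ge0.
  by have := lag_norm_le k (y ^+ 2) nuN1; rewrite [`|y ^+ 2|]ger0_norm ?sqr_ge0.
- have lag0 z : 0 <= z -> 0 <= lag nu k (- z).
    move=> z0; have := lag_norm_le k z nuN1; rewrite (ger0_norm z0).
    exact: le_trans.
  rewrite mulr_ge0// mulr_ge0 ?lag0 ?sqr_ge0// mulr_ge0 ?lag0 ?sqr_ge0//.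
  by rewrite !mulr_ge0 ?exprn_ge0// ltW// gam_gt0.
Qed.

(** In the Hille-Hardy formula the powers depending on [nu] are exactly those that
    the bound on the Bessel series absorbs. That bound contributes [e^(2u)] with
    [u = x y csch2t t]; as [2 csch2t <= coth2t] and [x y >= 0], it completes the
    Gaussian in [x] and [y] to one in [x - y]. *)
Lemma heat_kernel1_le nu t x y : - 2^-1 <= nu -> 0 < t -> 0 < x -> 0 < y ->
  exists2 S, series (heat_term1 nu t x y) @ \oo --> S &
    0 <= S <= 16 * expR 1 * csch2t t `^ 2^-1 *
              expR (- (coth2t t * (x - y) ^+ 2 / 2)).
Proof.
move=> nu_ge t0 x0 y0; have nuN1 : -1 < nu by lra.
have w01 := expR4_lt1 t0; have /andP[w0 w1] := w01.
have w10 : 0 < 1 - expR (- (4 * t)) by rewrite subr_gt0.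
have k0 := csch2t_gt0 t0.
have S := cvg_series_scale (c := heat_factor nu t x y)
  (@hille_hardy _ _ nu_ge _ w01 (x ^+ 2) (y ^+ 2)).
eexists.
  rewrite (_ : heat_term1 nu t x y = fun k => heat_factor nu t x y *
    (expR (- (4 * t)) ^+ k * k`!%:R * gam nu k * lag nu k (x ^+ 2) *
     lag nu k (y ^+ 2))); first exact: S.
  by apply/funext => k; rewrite heat_term1E.
pose u := x * y * csch2t t.
have u0 : 0 < u by rewrite mulr_gt0// mulr_gt0.
have uE : x ^+ 2 * y ^+ 2 * expR (- (4 * t)) / (1 - expR (- (4 * t))) ^+ 2 = u * u.
  by rewrite /u /csch2t expR4 !expr2; field; rewrite -expr2 -expR4 gt_eqF.
rewrite uE.
have E : heat_factor nu t x y * ((1 - expR (- (4 * t))) `^ (- (nu + 1)) *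
    expR (- ((x ^+ 2 + y ^+ 2) * expR (- (4 * t)) / (1 - expR (- (4 * t))))) *
    bessel_series nu (u * u)) =
  2 * csch2t t `^ 2^-1 * (u `^ (nu + 2^-1) * bessel_series nu (u * u)) *
  expR (- (coth2t t * (x ^+ 2 + y ^+ 2) / 2)).
  have -> : - (coth2t t * (x ^+ 2 + y ^+ 2) / 2) = - ((x ^+ 2 + y ^+ 2) / 2) +
     - ((x ^+ 2 + y ^+ 2) * expR (- (4 * t)) / (1 - expR (- (4 * t)))).
    by rewrite /coth2t; field; rewrite gt_eqF.
  have kE : csch2t t `^ 2^-1 * csch2t t `^ (nu + 2^-1) =
      expR (- (2 * t)) `^ (nu + 1) * (1 - expR (- (4 * t))) `^ (- (nu + 1)).
    rewrite -powRD ?(gt_eqF k0) ?implybT//.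
    rewrite (_ : 2^-1 + (nu + 2^-1) = nu + 1); last by field.
    rewrite /csch2t powRM ?expR_ge0 //; last by rewrite invr_ge0 ltW.
    congr (_ * _).
    by rewrite -(powR_inv1 (ltW w10)) -powRrM mulN1r.
  rewrite /u [in RHS]powRM ?(mulr_ge0 (ltW x0) (ltW y0)) ?(ltW k0)//.
  rewrite [in RHS]expRD /heat_factor.
  transitivity (2 * (csch2t t `^ 2^-1 * csch2t t `^ (nu + 2^-1)) *
    (x * y) `^ (nu + 2^-1) * bessel_series nu (x * y * csch2t t * (x * y * csch2t t)) *
    (expR (- ((x ^+ 2 + y ^+ 2) / 2)) *
     expR (- ((x ^+ 2 + y ^+ 2) * expR (- (4 * t)) / (1 - expR (- (4 * t))))))); last by ring.
  by rewrite kE; ring.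
rewrite E.
have /andP[b0 b1] := le_bessel_series nu_ge u0.
apply/andP; split.
  by rewrite mulr_ge0 ?expR_ge0// mulr_ge0// mulr_ge0 ?powR_ge0.
apply: (@le_trans _ _ (2 * csch2t t `^ 2^-1 * (8 * expR 1 * expR (2 * u)) *
  expR (- (coth2t t * (x ^+ 2 + y ^+ 2) / 2)))).
  by rewrite ler_wpM2r ?expR_ge0// ler_wpM2l// mulr_ge0 ?powR_ge0.
rewrite [leLHS](_ : _ = 16 * expR 1 * csch2t t `^ 2^-1 *
  (expR (2 * u) * expR (- (coth2t t * (x ^+ 2 + y ^+ 2) / 2)))); last by ring.
rewrite ler_wpM2l ?mulr_ge0 ?powR_ge0 ?expR_ge0// -expRD ler_expR.
have H : 0 <= (coth2t t - 2 * csch2t t) * (x * y).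
  by rewrite mulr_ge0 ?subr_ge0 ?csch2t_le_coth2t// mulr_ge0 ?ltW.
by move: H; rewrite /u !expr2; lra.
Qed.

End one_dimension.

Section product_of_series.
Context {R : realType} (n : nat).
Variable a : 'I_n -> nat -> R.

Definition simplex_sum m : R :=
  \sum_(k : {ffun 'I_n -> 'I_m.+1} | (\sum_(i < n) k i == m)%N)
    \prod_(i < n) a i (k i).

Lemma simplex_sum_widen m N : (m < N)%N -> simplex_sum m =
  \sum_(f : {ffun 'I_n -> 'I_N} | (\sum_(i < n) f i == m)%N)
    \prod_(i < n) a i (f i).
Proof.
move=> mN; rewrite [RHS](reindex_onto
  (fun k : {ffun 'I_n -> 'I_m.+1} => [ffun i => widen_ord mN (k i)])
  (fun f : {ffun 'I_n -> 'I_N} => [ffun i => inord (f i) : 'I_m.+1]))/=; last first.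
  move=> f /eqP fm; apply/ffunP => i; rewrite !ffunE; apply: val_inj => /=.
  by rewrite inordK// ltnS -fm (bigD1 i)//= leq_addr.
apply: eq_big => [k|k _].
  rewrite (_ : [ffun i => _] = k) ?eqxx ?andbT.
    by congr (_ == _); apply: eq_bigr => i _; rewrite ffunE.
  by apply/ffunP => i; rewrite !ffunE; apply: val_inj; rewrite /= inordK.
by apply: eq_bigr => i _; rewrite ffunE.
Qed.

Lemma series_simplex_sum M : series simplex_sum M =
  \sum_(f : {ffun 'I_n -> 'I_M} | (\sum_(i < n) f i < M)%N)
    \prod_(i < n) a i (f i).
Proof.
rewrite /series/= big_mkord.
transitivity (\sum_(m < M) \sum_(f : {ffun 'I_n -> 'I_M})
    (if (\sum_(i < n) f i == m)%N then \prod_(i < n) a i (f i) else 0)).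
  by apply: eq_bigr => m _; rewrite (simplex_sum_widen (ltn_ord m)) big_mkcond.
rewrite exchange_big/= [RHS]big_mkcond/=; apply: eq_bigr => f _.
case: ifPn => fM; last first.
  rewrite big1// => m _; case: eqP => // fm.
  by rewrite fm ltn_ord in fM.
rewrite (bigD1 (Ordinal fM))//= eqxx [X in _ + X]big1 ?addr0// => m.
by rewrite -val_eqE/= eq_sym => /negbTE ->.
Qed.

Lemma box_sum (b : 'I_n -> nat -> R) M K : (K <= M)%N ->
  \sum_(f : {ffun 'I_n -> 'I_M} | [forall i, (f i < K)%N])
    \prod_(i < n) b i (f i) = \prod_(i < n) series (b i) K.
Proof.
move=> KM.
rewrite (eq_bigl (fun f : {ffun 'I_n -> 'I_M} =>
   f \in family (fun _ : 'I_n => [pred k : 'I_M | (k < K)%N]))); last first.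
  by move=> f; apply/forallP/familyP => H i; have := H i.
rewrite -(bigA_distr_big_dep _ (fun i (k : 'I_M) => b i k)).
apply: eq_bigr => i _; rewrite /series/= (big_nat_widen _ _ M)// big_mkord.
by apply: eq_bigl.
Qed.

Lemma box_sum_full (b : 'I_n -> nat -> R) M :
  \sum_(f : {ffun 'I_n -> 'I_M}) \prod_(i < n) b i (f i) =
  \prod_(i < n) series (b i) M.
Proof.
rewrite -(box_sum b (leqnn M)); apply: eq_bigl => f.
by apply/esym/forallP => i.
Qed.

Lemma cvg_prod_ord (u : 'I_n -> nat -> R) (l : 'I_n -> R) :
  (forall i, u i @ \oo --> l i) ->
  (fun N => \prod_(i < n) u i N) @ \oo --> \prod_(i < n) l i.
Proof.
move=> ul; elim: (index_enum _) => [|i s IH].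
  by rewrite big_nil; under eq_fun do rewrite big_nil; exact: cvg_cst.
by rewrite big_cons; under eq_fun do rewrite big_cons; exact: cvgM.
Qed.

(** The simplex [|f| < M] lies between the boxes of side [M / n] and [M]. *)
Lemma cvg_series_simplex_sum (S : 'I_n -> R) : (0 < n)%N ->
  (forall i, exists B, forall M, \sum_(0 <= k < M) `|a i k| <= B) ->
  (forall i, series (a i) @ \oo --> S i) ->
  series simplex_sum @ \oo --> \prod_(i < n) S i.
Proof.
move=> n0 aB aS; pose c i k := `|a i k|.
have cvgc i : cvgn (series (c i)).
  have [B HB] := aB i; apply: nondecreasing_is_cvgn.
    by apply: nondecreasing_series => k _ _; exact: normr_ge0.
  by exists B => _ [M _ <-]; exact: HB.
pose L := \prod_(i < n) limn (series (c i)).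
have cL : (fun M => \prod_(i < n) series (c i) M) @ \oo --> L.
  by apply: cvg_prod_ord => i; exact: cvgc.
have half : (fun M => M %/ n)%N @ \oo --> \oo.
  apply/cvgnyPge => A; exists (A * n)%N => // M /= AM.
  by rewrite leq_divRL.
have tail : (fun M => \prod_(i < n) series (c i) M -
    \prod_(i < n) series (c i) (M %/ n)%N) @ \oo --> 0.
  rewrite -(subrr L); apply: cvgB => //.
  exact: (cvg_comp _ _ half cL).
have H M : `|series simplex_sum M - \prod_(i < n) series (a i) M| <=
    \prod_(i < n) series (c i) M - \prod_(i < n) series (c i) (M %/ n)%N.
  rewrite series_simplex_sum -(box_sum_full a) -(box_sum_full c).
  rewrite -(box_sum c (leq_div M n)).
  rewrite big_mkcond [X in _ <= _ - X]big_mkcond -!sumrB.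
  apply: le_trans (ler_norm_sum _ _ _) _; apply: ler_sum => f _.
  have pE : `|\prod_(i < n) a i (f i)| = \prod_(i < n) c i (f i).
    by rewrite normr_prod.
  have p0 : 0 <= \prod_(i < n) c i (f i) by rewrite -pE.
  case: ifPn => fM; first by rewrite subrr normr0; case: ifP => _; rewrite ?subrr ?subr0.
  rewrite sub0r normrN pE ifF ?subr0//; apply/negbTE; apply: contra fM.
  move=> /forallP fK; apply: (@leq_trans (\sum_(i < n) (M %/ n))%N); last first.
    by rewrite sum_nat_const card_ord mulnC leq_trunc_div.
  rewrite (bigD1 (Ordinal n0))//= [X in (_ < X)%N](bigD1 (Ordinal n0))//=.
  by rewrite -addSn leq_add//; apply: leq_sum => i _; rewrite ltnW.
have d0 : (fun M => series simplex_sum M - \prod_(i < n) series (a i) M) @ \oo --> 0.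
  apply: norm_cvg0; apply: (squeeze_cvgr _ (cvg_cst 0) tail).
  by apply: nearW => M; rewrite normr_ge0 H.
rewrite (_ : series _ = (fun M => (series simplex_sum M -
   \prod_(i < n) series (a i) M) + \prod_(i < n) series (a i) M)); last first.
  by apply/funext => M; rewrite subrK.
rewrite -[X in _ --> X]add0r; apply: cvgD => //.
exact: cvg_prod_ord.
Qed.

End product_of_series.

Section heat_kernel_bound.
Context {R : realType} {n : nat}.
Implicit Types (alpha : 'I_n -> R) (x y : 'R[R]^n).

(** The eigenvalue is a sum over the coordinates, so the series over [m] is the
    Cauchy product of the one-dimensional series. *)
Lemma heat_kernel_le alpha t x y : (0 < n)%N -> (forall i, - 2^-1 <= alpha i) ->
  0 < t -> Rplus x -> Rplus y ->
  `|heat_kernel alpha t x y| <= (16 * expR 1) ^+ n * csch2t t `^ (n%:R / 2) *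
    expR (- (coth2t t * (\sum_(i < n) (tnth x i - tnth y i) ^+ 2) / 2)).
Proof.
move=> n0 al t0 x0 y0.
pose a i := heat_term1 (alpha i) t (tnth x i) (tnth y i).
have aP i := heat_kernel1_le (al i) t0 (x0 i) (y0 i).
pose S i := s2val (cid2 (aP i)).
have aS i : series (a i) @ \oo --> S i by exact: (s2valP (cid2 (aP i))).
have SB i : 0 <= S i <= 16 * expR 1 * csch2t t `^ 2^-1 *
    expR (- (coth2t t * (tnth x i - tnth y i) ^+ 2 / 2)).
  exact: (s2valP' (cid2 (aP i))).
have aB i := heat_term1_summable (al i) t0 (x0 i) (y0 i).
have H := cvg_series_simplex_sum n0 aB aS.
rewrite /heat_kernel (_ : (fun m => _) = simplex_sum a); last first.
  apply/funext => m; rewrite /heat_coef /simplex_sum mulr_sumr.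
  apply: eq_bigr => k /eqP km; rewrite /Laguerre_fun -big_split/=.
  rewrite /a /heat_term1 [RHS]big_split/=; congr (_ * _).
  rewrite -expR_sum; congr expR; rewrite /eigenvalue_LH.
  rewrite sumrN; congr (- _); rewrite -mulr_sumr; congr (_ * _).
  have := congr1 (GRing.natmul (1 : R)) km; rewrite natr_sum => mE.
  rewrite [RHS]big_split [X in _ = X + _]big_split/= -!mulr_sumr sumr_const.
  by rewrite card_ord -[2 *+ n]mulr_natr mE.
rewrite (cvg_lim _ H)// normr_prod.
apply: (@le_trans _ _ (\prod_(i < n) (16 * expR 1 * csch2t t `^ 2^-1 *
    expR (- (coth2t t * (tnth x i - tnth y i) ^+ 2 / 2))))).
  apply: ler_prod => i _; have /andP[S0 S1] := SB i.
  by rewrite normr_ge0/= ger0_norm.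
rewrite big_split/= prodr_const card_ord -expR_sum exprMn.
rewrite -[(csch2t t `^ _) ^+ n]powR_mulrn ?powR_ge0// -powRrM [2^-1 * _]mulrC.
by rewrite ler_wpM2l ?mulr_ge0 ?exprn_ge0 ?expR_ge0 ?powR_ge0// ler_expR sumrN -mulr_suml -mulr_sumr.
Qed.

End heat_kernel_bound.

(** * The potential kernel *)

Section heat_integral.
Context {R : realType}.
Local Notation leb := (@lebesgue_measure R).

Lemma integral_two_powers (b1 b2 : R) : b1 < 1 -> 1 < b2 ->
  exists2 C : R, 0 < C & forall (phi : R -> R) (A1 A2 rho : R),
    0 <= A1 -> 0 <= A2 -> 0 < rho -> (forall t, 0 < t -> 0 <= phi t) ->
    (forall t, 0 < t -> t < rho -> phi t <= A1 * t `^ (- b1)) ->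
    (forall t, 0 < t -> rho <= t -> phi t <= A2 * t `^ (- b2)) ->
    (\int[leb]_(t in `]0%R, +oo[) (phi t)%:E <=
       (C * (A1 * rho `^ (1 - b1) + A2 * rho `^ (1 - b2)))%:E)%E.
Proof.
move=> b11 b21; have [C1 C10 HC1] := integral_powR_line_near b11.
have [C2 C20 HC2] := integral_powR_line_far b21.
exists (C1 + C2); first by rewrite addr_gt0.
move=> phi A1 A2 rho A10 A20 rho0 phi0 H1 H2.
have mD : measurable (`]0%R, +oo[%classic : set R) by [].
pose F1 (t : R) : R := t `^ (- b1) * (t < rho)%R%:R.
pose F2 (t : R) : R := t `^ (- b2) * (rho <= t)%R%:R.
have F10 t : 0 <= F1 t by rewrite mulr_ge0 ?powR_ge0.
have F20 t : 0 <= F2 t by rewrite mulr_ge0 ?powR_ge0.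
have mF1 : measurable_fun (`]0%R, +oo[%classic : set R) (EFin \o F1).
  by apply: measurable_funTS; rewrite /comp /F1; measurability.
have mF2 : measurable_fun (`]0%R, +oo[%classic : set R) (EFin \o F2).
  by apply: measurable_funTS; rewrite /comp /F2; measurability.
apply: (@le_trans _ _ (\int[leb]_(t in `]0%R, +oo[)
   (A1%:E * (F1 t)%:E + A2%:E * (F2 t)%:E))%E).
  apply: ge0_le_integral_nonmeas => t; rewrite /= in_itv/= andbT => t0.
    by rewrite lee_fin phi0.
  rewrite -!EFinM -EFinD lee_fin /F1 /F2.
  have [tr|tr] := ltP t rho; first by rewrite mulr1 !mulr0 addr0 H1.
  by rewrite mulr1 !mulr0 add0r H2.
rewrite ge0_integralD//; last 4 first.
- by move=> t _; rewrite mule_ge0 ?lee_fin.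
- exact: measurable_funeM.
- by move=> t _; rewrite mule_ge0 ?lee_fin.
- exact: measurable_funeM.
rewrite !ge0_integralZl_EFin//; [|by move=> t _; rewrite lee_fin..].
rewrite mulrDl EFinD leeD//.
- apply: (@le_trans _ _ (A1%:E * (C1 * rho `^ (1 - b1))%:E)%E).
    by rewrite lee_wpmul2l ?lee_fin// HC1.
  rewrite -EFinM lee_fin mulrCA ler_wpM2l ?(ltW C10)//.
  by rewrite lerDl mulr_ge0 ?powR_ge0.
- apply: (@le_trans _ _ (A2%:E * (C2 * rho `^ (1 - b2))%:E)%E).
    by rewrite lee_wpmul2l ?lee_fin// HC2.
  rewrite -EFinM lee_fin mulrCA ler_wpM2l ?(ltW C20)//.
  by rewrite lerDr mulr_ge0 ?powR_ge0.
Qed.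

Lemma expRN_le_powR (mu x : R) : 0 < mu -> 0 < x ->
  expR (- x) <= mu `^ mu * x `^ (- mu).
Proof.
move=> mu0 x0; rewrite powRN ler_pdivlMr ?powR_gt0// mulrC expRN.
rewrite ler_pdivrMr ?expR_gt0//; apply: le_trans (powR_le_expR mu0 (ltW x0)) _.
by rewrite ler_wpM2l ?powR_ge0// ler_expR gerDl oppr_le0 ltW.
Qed.

Lemma csch2t_le (t : R) : 0 < t -> csch2t t <= (2 * t)^-1.
Proof.
move=> t0; have /andP[_ w1] := expR4_lt1 t0.
rewrite ler_pdivrMr ?subr_gt0// [leRHS]mulrC ler_pdivlMr ?mulr_gt0//.
have -> : expR (- (4 * t)) = expR (- (2 * t)) * expR (- (2 * t)).
  by rewrite -expRD; congr expR; lra.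
have := expR_ge1Dx (2 * t); have e0 := expR_gt0 (2 * t).
rewrite [expR (- (2 * t))]expRN; set e := expR (2 * t) in e0 *.
move=> he; rewrite mulrC ler_pdivrMr// mulrBl mul1r mulfVK ?gt_eqF//.
have : e^-1 <= 1 by rewrite invf_le1//; lra.
lra.
Qed.

Lemma csch2t_le_expR (t : R) : 1 <= t -> csch2t t <= 2 * expR (- (2 * t)).
Proof.
move=> t1; have t0 : 0 < t by lra.
have /andP[_ w1] := expR4_lt1 t0.
rewrite ler_pdivrMr ?subr_gt0// [leRHS]mulrAC ler_peMl ?expR_ge0//.
have : expR (- (4 * t)) <= 2^-1.
  rewrite expRN lef_pV2 ?posrE ?expR_gt0//.
  by have := expR_ge1Dx (4 * t); lra.
lra.
Qed.

Lemma coth2t_ge (t : R) : 0 < t -> 1 <= coth2t t /\ (4 * t)^-1 <= coth2t t.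
Proof.
move=> t0; have /andP[w0 w1] := expR4_lt1 t0.
have w10 : 0 < 1 - expR (- (4 * t)) by rewrite subr_gt0.
split; first by rewrite ler_pdivlMr// mul1r; lra.
apply: (@le_trans _ _ (1 - expR (- (4 * t)))^-1).
  rewrite lef_pV2 ?posrE ?mulr_gt0//.
  by have := expR_ge1Dx (- (4 * t)); lra.
by rewrite /coth2t ler_peMl ?invr_ge0 ?(ltW w10)// lerDl.
Qed.

Lemma powR_sqr (r a : R) : 0 < r -> (r ^+ 2) `^ a = r `^ (2 * a).
Proof. by move=> r0; rewrite -powR_mulrn ?(ltW r0)// -powRrM. Qed.

Section bounds.
Variables (delta sigma lam : R).
Hypotheses (delta0 : 0 < delta) (sigma0 : 0 < sigma) (lam0 : 0 < lam).

Let phi (r t : R) : R := csch2t t `^ delta * expR (- (coth2t t * r ^+ 2 / 2)) *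
   t `^ (sigma - 1).

Let phi_ge0 r t : 0 <= phi r t.
Proof. by rewrite !mulr_ge0 ?powR_ge0 ?expR_ge0. Qed.

Let csch_powR_le (t : R) : 0 < t -> csch2t t `^ delta <= 2 `^ (- delta) * t `^ (- delta).
Proof.
move=> t0; rewrite -powRM ?(ltW t0)//.
rewrite (powRN _ delta) -[X in _ <= X^-1]powRr1 ?powR_ge0// -powRN.
rewrite -powRrM mulrN1 powRN -powRN.
rewrite -[leRHS](_ : ((2 * t)^-1) `^ delta = _).
  by rewrite powR_le ?(ltW delta0) ?csch2t_le// ltW// csch2t_gt0.
by rewrite -powR_inv1 ?mulr_ge0 ?(ltW t0)// -powRrM mulN1r.
Qed.

Let exp_le (mu r t : R) : 0 < mu -> 0 < r -> 0 < t ->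
  expR (- (coth2t t * r ^+ 2 / 2)) <=
  (mu `^ mu * 2 `^ mu) * (coth2t t `^ (- mu) * r `^ (- (2 * mu))).
Proof.
move=> mu0 r0 t0; have [h1 _] := coth2t_ge t0.
have h0 : 0 < coth2t t by lra.
have x0 : 0 < coth2t t * r ^+ 2 / 2 by rewrite divr_gt0// mulr_gt0// exprn_gt0.
apply: le_trans (expRN_le_powR mu0 x0) _.
have r20 : 0 <= r ^+ 2 by exact: sqr_ge0.
have i20 : 0 <= 2^-1 :> R by rewrite invr_ge0.
rewrite (powRM _ (mulr_ge0 (ltW h0) r20) i20) (powRM _ (ltW h0) r20).
rewrite powR_sqr// mulrN -(@powR_inv1 _ 2)// -powRrM mulN1r opprK.
by rewrite le_eqVlt; apply/orP; left; apply/eqP; ring.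
Qed.

Let coth_powR_le (mu t : R) : 0 <= mu -> 0 < t ->
  coth2t t `^ (- mu) <= 1 /\ coth2t t `^ (- mu) <= 4 `^ mu * t `^ mu.
Proof.
move=> mu0 t0; have [h1 h2] := coth2t_ge t0.
have h0 : 0 < coth2t t by lra.
have one_le (a : R) : 1 <= a -> 1 <= a `^ mu.
  by move=> a1; rewrite -[leLHS](congr1 (@^~ mu) (@powR1 R)) powR_le.
split; first by rewrite powRN invf_le1 ?powR_gt0// one_le.
have t40 : 0 <= 4 * t by rewrite mulr_ge0// ltW.
rewrite powRN -powRM ?(ltW t0)// -[leLHS]mul1r ler_pdivrMr ?powR_gt0//.
rewrite -(powRM _ t40 (ltW h0)) one_le// mulrC -ler_pdivrMr ?mulr_gt0//.
by rewrite mul1r.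
Qed.

(** The Gaussian is at most a multiple of [coth2t^(- lam / 2) r^(- lam)]. What is
    left does not involve [r]; it is integrable at 0 because [coth2t] is at least
    [1 / (4 t)], and at infinity because of the decay of [csch2t]. *)
Let heat_integral_le_strict : 2 * delta - 2 * sigma < lam ->
  exists2 C : R, 0 < C & forall r : R, 0 < r ->
  (\int[leb]_(t in `]0%R, +oo[) (phi r t)%:E <= (C * r `^ (- lam))%:E)%E.
Proof.
move=> lamlt; pose mu := lam / 2.
have mu0 : 0 < mu by rewrite divr_gt0.
have b1 : 1 + delta - sigma - mu < 1 by rewrite /mu; have := lamlt; lra.
have [C C0 HC] := integral_two_powers b1 (ltr1n _ 2).
pose K := mu `^ mu * 2 `^ mu.
have K0 : 0 < K by rewrite mulr_gt0 ?powR_gt0.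
pose A1 := K * 4 `^ mu * 2 `^ (- delta).
pose m := sigma + 1.
have m0 : 0 < m by rewrite addr_gt0.
pose A2 := K * 2 `^ delta * (m / (2 * delta)) `^ m.
have A10 : 0 < A1 by rewrite !mulr_gt0 ?powR_gt0.
have A20 : 0 < A2 by rewrite !mulr_gt0 ?powR_gt0 ?divr_gt0 ?mulr_gt0.
exists (C * (A1 + A2)); first by rewrite mulr_gt0 ?addr_gt0.
move=> r r0; have rl : r `^ (- (2 * mu)) = r `^ (- lam).
  by rewrite /mu mulrCA mulfV ?mulr1.
have rl0 : 0 <= r `^ (- lam) by exact: powR_ge0.
apply: le_trans (HC (phi r) (A1 * r `^ (- lam)) (A2 * r `^ (- lam)) 1 _ _ _ _ _ _) _ => //.
- by rewrite mulr_ge0 ?(ltW A10).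
- by rewrite mulr_ge0 ?(ltW A20).
- move=> t t0 t1; have [_ h4] := coth_powR_le (ltW mu0) t0.
  have -> : - (1 + delta - sigma - mu) = mu + (- delta + (sigma - 1)) by ring.
  rewrite (@powRD _ t mu) ?(gt_eqF t0) ?implybT//.
  rewrite (@powRD _ t (- delta)) ?(gt_eqF t0) ?implybT//.
  apply: (@le_trans _ _ ((2 `^ (- delta) * t `^ (- delta)) *
     (K * (4 `^ mu * t `^ mu * r `^ (- lam))) * t `^ (sigma - 1))).
    rewrite ler_wpM2r ?powR_ge0//; apply: ler_pM; rewrite ?powR_ge0 ?expR_ge0//.
      exact: csch_powR_le.
    apply: le_trans (exp_le mu0 r0 t0) _; rewrite rl ler_wpM2l ?(ltW K0)//.
    by rewrite ler_wpM2r.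
  by rewrite le_eqVlt; apply/orP; left; apply/eqP; rewrite /A1; ring.
- move=> t t0 t1; have [h1 _] := coth_powR_le (ltW mu0) t0.
  have cs : csch2t t `^ delta <= 2 `^ delta * expR (- (2 * t)) `^ delta.
    rewrite -powRM ?expR_ge0// powR_le ?(ltW delta0) ?csch2t_le_expR//.
    by rewrite ltW// csch2t_gt0.
  have te : expR (- (2 * t)) `^ delta * t `^ (sigma - 1) <=
      (m / (2 * delta)) `^ m * t `^ (- 2).
    have -> : sigma - 1 = m + (- 2) by rewrite /m; ring.
    rewrite powRD ?(gt_eqF t0) ?implybT// mulrA ler_wpM2r ?powR_ge0//.
    have u0 : 0 <= 2 * delta * t by rewrite !mulr_ge0 ?(ltW delta0) ?(ltW t0).
    have := powR_le_expR m0 u0.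
    have d20 : 0 <= 2 * delta by rewrite mulr_ge0 ?(ltW delta0).
    rewrite powRM ?(ltW t0)// => H.
    have -> : expR (- (2 * t)) `^ delta = (expR (2 * delta * t))^-1.
      by rewrite -expRM -expRN; congr expR; ring.
    rewrite mulrC ler_pdivrMr ?expR_gt0//.
    rewrite powRM ?invr_ge0 ?(ltW m0)// -(powR_inv1 d20) -powRrM mulN1r powRN.
    rewrite mulrAC ler_pdivlMr ?powR_gt0 ?mulr_gt0// mulrC.
    by apply: le_trans H _; rewrite ler_wpM2l ?powR_ge0// ler_expR gerDl oppr_le0 ltW.
  apply: (@le_trans _ _ ((2 `^ delta * expR (- (2 * t)) `^ delta) *
     (K * (1 * r `^ (- lam))) * t `^ (sigma - 1))).
    rewrite ler_wpM2r ?powR_ge0//; apply: ler_pM; rewrite ?powR_ge0 ?expR_ge0//.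
    apply: le_trans (exp_le mu0 r0 t0) _; rewrite rl ler_wpM2l ?(ltW K0)//.
    by rewrite ler_wpM2r.
  apply: (@le_trans _ _ (K * 2 `^ delta * r `^ (- lam) *
     (expR (- (2 * t)) `^ delta * t `^ (sigma - 1)))).
    by rewrite le_eqVlt; apply/orP; left; apply/eqP; ring.
  apply: (@le_trans _ _ (K * 2 `^ delta * r `^ (- lam) *
     ((m / (2 * delta)) `^ m * t `^ (- 2)))).
    by rewrite ler_wpM2l ?mulr_ge0 ?powR_ge0 ?(ltW K0).
  by rewrite le_eqVlt; apply/orP; left; apply/eqP; rewrite /A2; ring.
- rewrite lee_fin (congr1 (@^~ _) (@powR1 R)) (congr1 (@^~ _) (@powR1 R)).
  by rewrite le_eqVlt; apply/orP; left; apply/eqP; ring.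
Qed.

(** At the critical exponent the same integral diverges logarithmically at 0, and
    is cut at [t = r^2]: below it the Gaussian is estimated as before, but with
    twice the power, and above it by 1. *)
Let heat_integral_le_critical : lam = 2 * delta - 2 * sigma ->
  exists2 C : R, 0 < C & forall r : R, 0 < r ->
  (\int[leb]_(t in `]0%R, +oo[) (phi r t)%:E <= (C * r `^ (- lam))%:E)%E.
Proof.
move=> lamE.
have b1 : 1 + delta - sigma - lam < 1 by have := lam0; lra.
have b2 : 1 < 1 + delta - sigma by have := lam0; lra.
have [C C0 HC] := integral_two_powers b1 b2.
pose K := lam `^ lam * 2 `^ lam.
have K0 : 0 < K by rewrite mulr_gt0 ?powR_gt0.
pose A1 := K * 4 `^ lam * 2 `^ (- delta).
pose A2 : R := 2 `^ (- delta).
have A10 : 0 < A1 by rewrite !mulr_gt0 ?powR_gt0.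
have A20 : 0 < A2 by rewrite powR_gt0.
exists (C * (A1 + A2)); first by rewrite mulr_gt0 ?addr_gt0.
move=> r r0.
apply: le_trans (HC (phi r) (A1 * r `^ (- (2 * lam))) A2 (r ^+ 2) _ _ _ _ _ _) _ => //.
- by rewrite mulr_ge0 ?powR_ge0 ?(ltW A10).
- exact: ltW.
- by rewrite exprn_gt0.
- move=> t t0 t1; have [_ h4] := coth_powR_le (ltW lam0) t0.
  have -> : - (1 + delta - sigma - lam) = lam + (- delta + (sigma - 1)) by ring.
  rewrite (@powRD _ t lam) ?(gt_eqF t0) ?implybT//.
  rewrite (@powRD _ t (- delta)) ?(gt_eqF t0) ?implybT//.
  apply: (@le_trans _ _ ((2 `^ (- delta) * t `^ (- delta)) *
     (K * (4 `^ lam * t `^ lam * r `^ (- (2 * lam)))) * t `^ (sigma - 1))).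
    rewrite ler_wpM2r ?powR_ge0//; apply: ler_pM; rewrite ?powR_ge0 ?expR_ge0//.
      exact: csch_powR_le.
    apply: le_trans (exp_le lam0 r0 t0) _; rewrite ler_wpM2l ?(ltW K0)//.
    by rewrite ler_wpM2r ?powR_ge0.
  by rewrite le_eqVlt; apply/orP; left; apply/eqP; rewrite /A1; ring.
- move=> t t0 t1; have [h1 _] := coth2t_ge t0.
  have -> : - (1 + delta - sigma) = - delta + (sigma - 1) by ring.
  rewrite (@powRD _ t) ?(gt_eqF t0) ?implybT// mulrA ler_wpM2r ?powR_ge0//.
  rewrite -[leRHS]mulr1; apply: ler_pM; rewrite ?powR_ge0 ?expR_ge0//.
    exact: csch_powR_le.
  by rewrite expR_le1 oppr_le0 divr_ge0// mulr_ge0 ?sqr_ge0//; lra.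
- rewrite lee_fin !powR_sqr// -[X in _ <= X]mulrA ler_wpM2l ?(ltW C0)//.
  rewrite (_ : 2 * (1 - (1 + delta - sigma - lam)) = lam); last by rewrite lamE; ring.
  rewrite (_ : 2 * (1 - (1 + delta - sigma)) = - lam); last by rewrite lamE; ring.
  rewrite -mulrA -powRD ?(gt_eqF r0) ?implybT//.
  rewrite (_ : - (2 * lam) + lam = - lam); last by ring.
  by rewrite mulrDl.
Qed.

Lemma heat_integral_le : 2 * delta - 2 * sigma <= lam ->
  exists2 C : R, 0 < C & forall r : R, 0 < r ->
  (\int[leb]_(t in `]0%R, +oo[) (csch2t t `^ delta *
     expR (- (coth2t t * r ^+ 2 / 2)) * t `^ (sigma - 1))%:E <=
     (C * r `^ (- lam))%:E)%E.
Proof.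
rewrite le_eqVlt => /orP[/eqP|]; last exact: heat_integral_le_strict.
by move/esym; exact: heat_integral_le_critical.
Qed.

End bounds.

End heat_integral.

Section potential_kernel_bound.
Context {R : realType} {n : nat}.
Local Notation leb := (@lebesgue_measure R).
Implicit Types (alpha : 'I_n -> R) (x y : 'R[R]^n).

(** The heat kernel bound has the same constant for all [alpha], and only its
    absolute value matters, so the measurability of the heat kernel in [t] does
    not come up. *)
Lemma potential_kernel_le (sigma lam : R) : (0 < n)%N -> 0 < sigma -> 0 < lam ->
  n%:R - 2 * sigma <= lam ->
  exists2 C : R, 0 < C & forall alpha x y r, (forall i, - 2^-1 <= alpha i) ->
    Rplus x -> Rplus y -> 0 < r ->
    r ^+ 2 <= \sum_(i < n) (tnth x i - tnth y i) ^+ 2 ->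
    (`|potential_kernel alpha sigma x y| <= (C * r `^ (- lam))%:E)%E.
Proof.
move=> n0 sigma0 lam0 lamn.
have delta0 : 0 < n%:R / 2 :> R by rewrite divr_gt0// ltr0n.
have lamd : 2 * (n%:R / 2) - 2 * sigma <= lam by rewrite mulrCA mulfV// mulr1.
have [C C0 HC] := heat_integral_le delta0 sigma0 lam0 lamd.
have G0 : 0 < Gamma sigma by exact: Gamma_gt0.
pose Kn : R := (16 * expR 1) ^+ n.
have Kn0 : 0 < Kn by rewrite exprn_gt0// mulr_gt0 ?expR_gt0.
exists ((Gamma sigma)^-1 * (Kn * C)); first by rewrite !mulr_gt0 ?invr_gt0.
move=> alpha x y r al x0 y0 r0 rxy.
have mD : measurable (`]0%R, +oo[%classic : set R) by [].
rewrite /potential_kernel abseM [`|_%:E|%E]gee0_abs ?lee_fin ?invr_ge0 ?(ltW G0)//.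
rewrite -mulrA [leRHS]EFinM lee_wpmul2l ?lee_fin ?invr_ge0 ?(ltW G0)//.
pose phi t : R := csch2t t `^ (n%:R / 2) * expR (- (coth2t t * r ^+ 2 / 2)) *
   t `^ (sigma - 1).
apply: (@le_trans _ _ (\int[leb]_(t in `]0%R, +oo[) (Kn%:E * (phi t)%:E))%E).
  apply: abse_integral_le_nonmeas => t; rewrite /= in_itv/= andbT => t0.
  rewrite -EFinM lee_fin normrM (ger0_norm (powR_ge0 t _)) /phi mulrA.
  rewrite ler_wpM2r ?powR_ge0//.
  apply: le_trans (heat_kernel_le n0 al t0 x0 y0) _.
  rewrite -mulrA ler_wpM2l ?(ltW Kn0)// ler_wpM2l ?powR_ge0// ler_expR lerN2.
  rewrite ler_wpM2r ?invr_ge0// ler_wpM2l//.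
  by have [h1 _] := coth2t_ge t0; lra.
rewrite ge0_integralZl_EFin ?(ltW Kn0)//; last 2 first.
- by move=> t _; rewrite lee_fin !mulr_ge0 ?powR_ge0 ?expR_ge0.
- apply: measurable_funTS; rewrite /phi /csch2t /coth2t.
  by measurability.
rewrite -mulrA [leRHS]EFinM lee_wpmul2l ?lee_fin ?(ltW Kn0)//.
exact: HC.
Qed.

End potential_kernel_bound.

(** * Sequence norms *)

Section lr_norm.
Context {R : realType}.
Implicit Types (r : \bar R) (u v : nat -> \bar R).
Local Open Scope ereal_scope.

Lemma lr_norm_fin (r : R) u : (0 < r)%R ->
  lr_norm r%:E u = (\sum_(0 <= k <oo) `|u k| `^ r) `^ r^-1.
Proof. by move=> r0; rewrite /lr_norm Lnorm_counting. Qed.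

Lemma ae_counting (P : nat -> Prop) :
  (\forall j \ae (@counting nat R), P j) <-> forall j, P j.
Proof.
split=> [[A [mA A0 PA]] j|P_]; last by apply/aeW.
have A_ : A = set0.
  move: A0; rewrite /counting; case: asboolP => // fA /eqP.
  rewrite eqe pnatr_eq0 finmap.cardfs_eq0 => /eqP A0.
  by rewrite -(fset_setK fA) A0 set_fset0.
by apply: contrapT => Pj; have := PA j Pj; rewrite A_.
Qed.

Lemma lr_normy u : lr_norm +oo u = ereal_sup (range (fun k => `|u k|)).
Proof.
have cT : 0 < @counting nat R [set: nat].
  rewrite /counting; case: asboolP => // fT.
  by exfalso; exact: infinite_nat.
rewrite /lr_norm unlock cT; apply/eqP; rewrite eq_le; apply/andP; split.
  by apply/ess_supP/ae_counting => j; apply: ereal_sup_ubound; exists j.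
apply: ge_ereal_sup => _ [j _ <-].
by have /ae_counting := ess_sup_ge (@counting nat R) (abse \o u); exact.
Qed.

Lemma lr_norm_le r u v : 1 <= r -> (forall k, `|u k| <= `|v k|) ->
  lr_norm r u <= lr_norm r v.
Proof.
case: r => [r| |]// r1 uv.
  have r0 : (0 < r)%R by rewrite lee_fin in r1; exact: lt_le_trans r1.
  have e0 : 0 <= (\sum_(0 <= k <oo) `|u k| `^ r).
    by apply: nneseries_ge0 => k _ _; exact: poweR_ge0.
  have sum_le : \sum_(0 <= k <oo) `|u k| `^ r <= \sum_(0 <= k <oo) `|v k| `^ r.
    apply: lee_nneseries => k _; first by move=> _; exact: poweR_ge0.
    by apply: gt0_ler_poweR; rewrite ?(ltW r0)// in_itv/= leey abse_ge0.
  rewrite !lr_norm_fin// gt0_ler_poweR ?invr_ge0 ?(ltW r0)// in_itv/= leey andbT//.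
  exact: le_trans sum_le.
rewrite !lr_normy; apply: ge_ereal_sup => _ [j _ <-].
by apply: le_trans (uv j) _; apply: ereal_sup_ubound; exists j.
Qed.

Lemma le_lr_norm r u j : 1 <= r -> `|u j| <= lr_norm r u.
Proof.
case: r => [r| |]// r1; last by rewrite lr_normy; apply: ereal_sup_ubound; exists j.
have r0 : (0 < r)%R by rewrite lee_fin in r1; exact: lt_le_trans r1.
have le_sum : `|u j| `^ r <= \sum_(0 <= k <oo) `|u k| `^ r.
  apply: le_trans (nneseries_lim_ge j.+1 _); last by move=> *; exact: poweR_ge0.
  rewrite big_nat_recr//= leeDr// sume_ge0// => k _; exact: poweR_ge0.
rewrite lr_norm_fin//.
rewrite -[leLHS]poweRe1// -(@mulfV _ r) ?gt_eqF// poweRrM//.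
rewrite gt0_ler_poweR ?invr_ge0 ?(ltW r0)// in_itv/= leey andbT ?poweR_ge0//.
by apply: le_trans le_sum; exact: poweR_ge0.
Qed.

Lemma measurable_lr_norm d (T : measurableType d) r (f : nat -> T -> R) : 1 <= r ->
  (forall j, measurable_fun setT (f j)) ->
  measurable_fun setT (fun y => lr_norm r (fun j => (f j y)%:E)).
Proof.
move=> r1 mf.
have mfj j : measurable_fun setT (fun y => `|(f j y)%:E|).
  exact/measurableT_comp/measurable_EFinP/mf.
case: r r1 => [r| |]// r1.
  have r0 : (0 < r)%R by rewrite lee_fin in r1; exact: lt_le_trans r1.
  under eq_fun do rewrite lr_norm_fin//.
  apply: (measurableT_comp (measurable_poweR r^-1)).
  apply: (ge0_emeasurable_sum (P := xpredT)) => [k y _ _|k _]; first exact: poweR_ge0.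
  exact: (measurableT_comp (measurable_poweR r)).
rewrite (_ : (fun _ => _) = fun y => esups (fun j => `|(f j y)%:E|) 0%N).
  exact: measurable_fun_esups.
apply/funext => y; rewrite lr_normy /esups; congr ereal_sup.
by apply/seteqP; split => _ [j _ <-]; exists j.
Qed.

End lr_norm.

Section lr_norm_integral.
Context d (T : measurableType d) (R : realType).
Variable mu : {measure set T -> \bar R}.
Variables (k : T -> R) (f : nat -> T -> R).
Hypotheses (mk : measurable_fun setT k) (k0 : forall y, 0 <= k y).
Hypothesis mf : forall j, measurable_fun setT (f j).

(** A geometric mean with weights [(r - 1) / r] and [1 / r]. *)
Let young (r u v : R) : 1 <= r -> 0 <= u -> 0 <= v ->
  u `^ (r - 1) * v <= u `^ r + v `^ r.
Proof.
move=> r1 u0 v0; have r0 : 0 < r by lra.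
have := @geometric_mean3_le R (u `^ r) (v `^ r) 0 ((r - 1) / r) r^-1 0.
rewrite powRr0 mulr1 !addr0 -!powRrM mulfV ?gt_eqF// powRr1//.
rewrite (_ : r * ((r - 1) / r) = r - 1); last by rewrite mulrC divfK ?gt_eqF.
apply; rewrite ?powR_ge0 ?invr_ge0 ?(ltW r0)//.
  by rewrite divr_ge0 ?(ltW r0)//; lra.
by rewrite -[X in _ + X]mul1r -mulrDl subrK mulfV ?gt_eqF.
Qed.

Local Open Scope ereal_scope.
Let F j := \int[mu]_y (k y * `|f j y|)%:E.
Let S r y := lr_norm r (fun j => (f j y)%:E).
Let I r := \int[mu]_y ((k y)%:E * S r y).

Let F0 j : 0 <= F j.
Proof. by apply: integral_ge0 => y _; rewrite lee_fin mulr_ge0. Qed.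

Let S0 r y : 0 <= S r y. Proof. exact: Lnorm_ge0. Qed.

Let FI r : 1 <= r -> forall j, F j <= I r.
Proof.
move=> r1 j; apply: ge0_le_integral_nonmeas => y _; first by rewrite lee_fin mulr_ge0.
by rewrite EFinM lee_wpmul2l ?lee_fin//; exact: (@le_lr_norm _ r (fun j => (f j y)%:E)).
Qed.

(** Hoelder's inequality for sequences, up to the factor 2 that Young's costs. *)
Let weighted_sum_le (r : R) N (G : nat -> R) y : (1 <= r)%R -> (forall j, 0 <= G j)%R ->
  (\sum_(j < N) G j `^ r <= 1)%R ->
  (\sum_(j < N) G j `^ (r - 1) * `|f j y|)%:E%R <= 2%:E * S r%:E y.
Proof.
move=> r1 G0 G1; have r0 : (0 < r)%R by exact: lt_le_trans r1.
case SE : (S r%:E y) (S0 r%:E y) => [w| |]//; last first.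
  by rewrite gt0_muley ?leey// lte_fin.
rewrite lee_fin => w0.
have fw j : (`|f j y| <= w)%R.
  have := @le_lr_norm _ r%:E (fun j => (f j y)%:E) j.
  by rewrite -/(S r%:E y) SE => /(_ r1); rewrite lee_fin.
rewrite -EFinM lee_fin.
have [w_|w_] := eqVneq w 0%R.
  rewrite w_ mulr0 big1// => j _.
  suff -> : `|f j y|%R = 0%R by rewrite mulr0.
  by apply/eqP; rewrite eq_le normr_ge0 -[leRHS]w_ fw.
have {w_ w0}w0 : (0 < w)%R by rewrite lt_neqAle eq_sym w_.
have wr : (\sum_(j < N) `|f j y| `^ r <= w `^ r)%R.
  rewrite -lee_fin -poweR_EFin -SE /S lr_norm_fin// -poweRrM mulVf ?gt_eqF// poweRe1; last first.
    by apply: nneseries_ge0 => j _ _; exact: poweR_ge0.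
  apply: le_trans (nneseries_lim_ge N _); last by move=> *; exact: poweR_ge0.
  by rewrite big_mkord -sumEFin; apply: lee_sum => j _.
apply: (@le_trans _ _ (\sum_(j < N) w * (G j `^ r + (`|f j y| / w) `^ r))%R).
  apply: ler_sum => j _.
  have := young r1 (G0 j) (divr_ge0 (normr_ge0 (f j y)) (ltW w0)).
  move/(ler_wpM2l (ltW w0)) => H; apply: le_trans H.
  by rewrite [leRHS]mulrC -[leRHS]mulrA divfK ?gt_eqF.
rewrite -mulr_sumr big_split/= mulrC ler_wpM2r ?(ltW w0)//.
rewrite (_ : 2 = 1 + 1)%R// lerD//.
under eq_bigr do rewrite powRM ?invr_ge0 ?(ltW w0)//.
rewrite -mulr_suml -powR_inv1 ?(ltW w0)// -powRrM mulN1r powRN.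
by rewrite ler_pdivrMr ?powR_gt0// mul1r.
Qed.

Let integral_fin_sum_le (r : R) N : (1 <= r)%R -> I r%:E < +oo ->
  \sum_(j < N) F j `^ r <= (2%:E * I r%:E) `^ r.
Proof.
move=> r1 Ioo; have r0 : (0 < r)%R by exact: lt_le_trans r1.
have Ffin j : F j \is a fin_num.
  by rewrite ge0_fin_numE//; exact: le_lt_trans (FI (r := r%:E) r1 j) Ioo.
pose phi j := fine (F j).
have phiE j : F j = (phi j)%:E by rewrite fineK.
have phi0 j : (0 <= phi j)%R by rewrite fine_ge0.
under eq_bigr do rewrite phiE poweR_EFin.
rewrite sumEFin; set U := (\sum_(j < N) phi j `^ r)%R.
have U0 : (0 <= U)%R by apply: sumr_ge0 => j _; exact: powR_ge0.
have [->|U_] := eqVneq U 0%R; first exact: poweR_ge0.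
have {U_}U0 : (0 < U)%R by rewrite lt_neqAle eq_sym U_.
pose M := (U `^ r^-1)%R; have M0 : (0 < M)%R by exact: powR_gt0.
have MU : (M `^ r)%R = U by rewrite -powRrM mulVf ?gt_eqF// powRr1// ltW.
suff MI : M%:E <= 2%:E * I r%:E.
  rewrite -MU -poweR_EFin; apply: gt0_ler_poweR; rewrite ?(ltW r0)// in_itv/= leey andbT//.
    by rewrite lee_fin ltW.
  by apply: le_trans MI; rewrite lee_fin ltW.
pose G j := (phi j / M)%R.
have G0 j : (0 <= G j)%R by rewrite divr_ge0// ltW.
have G1 : (\sum_(j < N) G j `^ r = 1)%R.
  under eq_bigr do rewrite powRM ?invr_ge0 ?(ltW M0)//.
  rewrite -mulr_suml -powR_inv1 ?(ltW M0)// -powRrM mulN1r powRN MU.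
  by rewrite mulfV ?gt_eqF.
have -> : M%:E = \sum_(j < N) (G j `^ (r - 1))%:E * F j.
  under eq_bigr do rewrite phiE -EFinM.
  rewrite sumEFin; congr EFin; rewrite -[LHS]mulr1 -[X in (_ * X)%R]G1 mulr_sumr.
  apply: eq_bigr => j _.
  rewrite (_ : phi j = M * G j)%R; last by rewrite mulrC divfK ?gt_eqF.
  by rewrite -(mulr_powRB1 (G0 j) r0) [RHS]mulrCA; congr (_ * _)%R; rewrite mulrC.
have mfj j : measurable_fun setT (fun y => `|f j y|)%R.
  exact: measurableT_comp.
under eq_bigr => j _.
  rewrite -ge0_integralZl_EFin ?powR_ge0//; last 2 first.
  - by move=> y _; rewrite lee_fin mulr_ge0.
  - by apply/measurable_EFinP; exact: measurable_funM.
  over.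
rewrite -ge0_integral_sum//; last 2 first.
- by move=> j; apply: measurable_funeM; apply/measurable_EFinP; exact: measurable_funM.
- by move=> j y _; rewrite -EFinM lee_fin mulr_ge0 ?powR_ge0// mulr_ge0.
have mS : measurable_fun setT (S r%:E) by exact: measurable_lr_norm.
rewrite /I -ge0_integralZl_EFin//; last 2 first.
- by move=> y _; rewrite mule_ge0// lee_fin.
- by apply: emeasurable_funM => //; exact/measurable_EFinP.
apply: ge0_le_integral_nonmeas => y _.
  by apply: sume_ge0 => j _; rewrite -EFinM lee_fin mulr_ge0 ?powR_ge0// mulr_ge0.
rewrite muleCA; under eq_bigr do rewrite -EFinM mulrCA EFinM.
rewrite -ge0_sume_distrr; last first.
  by move=> j _; rewrite lee_fin mulr_ge0 ?powR_ge0.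
rewrite lee_wpmul2l ?lee_fin// sumEFin weighted_sum_le// G1//.
Qed.

(** Minkowski's integral inequality up to a factor 2. The partial sums of the
    left side are tested against their own (r - 1)-st powers, after which the
    sequences can be compared under the integral. *)
Lemma lr_norm_integral_le r : 1 <= r ->
  lr_norm r F <= 2%:E * \int[mu]_y ((k y)%:E * lr_norm r (fun j => (f j y)%:E)).
Proof.
move=> r1; rewrite -/(I r).
have I0 : 0 <= I r by apply: integral_ge0 => y _; rewrite mule_ge0// lee_fin.
have [Ioo|] := ltP (I r) +oo; last first.
  by rewrite leye_eq => /eqP ->; rewrite gt0_muley ?leey// lte_fin.
case: r r1 I0 Ioo => [r| |]// r1 I0 Ioo; last first.
  rewrite lr_normy; apply: ge_ereal_sup => _ [j _ <-].
  rewrite gee0_abs//; apply: le_trans (FI r1 j) _.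
  by rewrite lee_pemull// lee_fin ler1n.
have r0 : (0 < r)%R by rewrite lee_fin in r1; exact: lt_le_trans r1.
have I20 : 0 <= 2%:E * I r%:E by rewrite mule_ge0// lee_fin.
rewrite lr_norm_fin// -[leRHS]poweRe1// -[X in _ <= _ `^ X](@mulfV _ r) ?gt_eqF// poweRrM.
apply: gt0_ler_poweR; rewrite ?invr_ge0 ?(ltW r0)// ?in_itv/= ?leey ?andbT ?poweR_ge0//.
  by apply: nneseries_ge0 => j _ _; exact: poweR_ge0.
apply: lime_le; first by apply: is_cvg_nneseries => j _ _; exact: poweR_ge0.
apply: nearW => N; rewrite big_mkord.
under eq_bigr do rewrite gee0_abs//.
exact: integral_fin_sum_le.
Qed.

End lr_norm_integral.

(** * The supremum distance on Euclidean space *)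

Section sup_distance.
Context {R : realType}.

(** The supremum norm, because its balls are boxes, whose measure is a product. *)
Definition sup_dist n (x y : 'R[R]^n) : R :=
  \big[Num.max/0]_(i < n) `|tnth x i - tnth y i|.

Section basic.
Context {n : nat}.
Implicit Types x y z : 'R[R]^n.

Lemma sup_dist_lt x y (r : R) : 0 < r ->
  (sup_dist x y < r) <-> (forall i, `|tnth x i - tnth y i| < r).
Proof.
move=> r0; rewrite /sup_dist; split=> [/bigmax_ltP[_ h] i|h]; first exact: h.
by apply/bigmax_ltP; split.
Qed.

Lemma le_sup_dist x y i : `|tnth x i - tnth y i| <= sup_dist x y.
Proof. exact: (le_bigmax 0 (fun i => `|tnth x i - tnth y i|)). Qed.

Lemma sup_dist_le x y (r : R) : 0 <= r ->
  (forall i, `|tnth x i - tnth y i| <= r) -> sup_dist x y <= r.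
Proof. by move=> r0 h; apply: bigmax_le. Qed.

Lemma sup_dist_ge0 x y : 0 <= sup_dist x y.
Proof. by rewrite /sup_dist; elim/big_ind: _ => // a b a0 b0; rewrite le_max a0. Qed.

Lemma sup_distC x y : sup_dist x y = sup_dist y x.
Proof. by apply: eq_bigr => i _; exact: distrC. Qed.

Lemma sup_dist_triangle x y z : sup_dist x z <= sup_dist x y + sup_dist y z.
Proof.
apply: sup_dist_le => [|i]; first by rewrite addr_ge0 ?sup_dist_ge0.
by apply: le_trans (ler_distD (tnth y i) _ _) _; rewrite lerD ?le_sup_dist.
Qed.

Lemma sup_dist_sqr_le x y :
  sup_dist x y ^+ 2 <= \sum_(i < n) (tnth x i - tnth y i) ^+ 2.
Proof.
have s0 : 0 <= \sum_(i < n) (tnth x i - tnth y i) ^+ 2.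
  by apply: sumr_ge0 => i _; exact: sqr_ge0.
rewrite -[leRHS]sqr_sqrtr// ler_pXn2r ?nnegrE ?sup_dist_ge0 ?sqrtr_ge0//.
apply: sup_dist_le => [|i]; first exact: sqrtr_ge0.
rewrite -sqrtr_sqr ler_wsqrtr// (bigD1 i)//= lerDl.
by apply: sumr_ge0 => j _; exact: sqr_ge0.
Qed.

Lemma measurable_sup_dist : measurable_kernel (@sup_dist n).
Proof.
rewrite /measurable_kernel /sup_dist.
elim: (index_enum _) => [|i s IH].
  by under eq_fun do rewrite big_nil; exact: measurable_cst.
under eq_fun do rewrite big_cons.
apply: measurable_maxr => //; apply: measurableT_comp => //.
by apply: measurable_funB; apply: (measurableT_comp (measurable_tnth i)).
Qed.

End basic.

Lemma measurable_sup_ball n (x : 'R[R]^n) (r : R) : 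
  measurable [set y | (sup_dist x y < r)%R].
Proof.
rewrite -[X in measurable X]setTI.
rewrite (_ : [set y | _] = sup_dist x @^-1` `]-oo, r[).
  exact: (measurable_kernel1 x (@measurable_sup_dist n)).
by apply/seteqP; split => y /=; rewrite in_itv.
Qed.

Lemma lebesgue_sup_ball n (x : 'R[R]^n) (r : R) : 0 < r ->
  lebesgue n [set y | (sup_dist x y < r)%R] = ((2 * r) ^+ n)%:E.
Proof.
move=> r0; elim: n x => [x|n IH].
  rewrite (_ : [set _ | _] = setT) /= ?diracT//.
  by apply/seteqP; split=> // y _ /=; rewrite /sup_dist big_ord0.
case/tupleP => a x.
rewrite /= /lebesgue_cons /pushforward.
rewrite (_ : _ @^-1` _ = `]a - r, a + r[ `*` [set y | (sup_dist x y < r)%R]).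
  rewrite product_measure1E//; last exact: measurable_sup_ball.
  rewrite IH exprS EFinM; congr (_ * _)%E.
  rewrite -[LHS]/(lebesgue_measure (`]a - r, a + r[%classic : set R)).
  rewrite lebesgue_measure_itv/= lte_fin ltrD2l gtrN//.
  by rewrite -EFinB; congr EFin; ring.
apply/seteqP; split => -[b y]/=; rewrite in_itv/= -ltr_distlC.
  move=> /(sup_dist_lt _ _ r0) H; split.
    by have := H ord0; rewrite !tnth0.
  by apply/(sup_dist_lt _ _ r0) => i; have := H (lift ord0 i); rewrite !tnthS.
case=> ab /(sup_dist_lt _ _ r0) H; apply/(sup_dist_lt _ _ r0) => i.
by case: (unliftP ord0 i) => [j|] ->; rewrite ?tnthS ?tnth0.
Qed.

Lemma ball_regular_sup_dist n (x : 'R[R]^n) :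
  ball_regular (lebesgue n) n%:R (2 ^+ n) (sup_dist x).
Proof.
split=> [|y|r r0]; [|exact: sup_dist_ge0|].
  exact: (measurable_kernel1 x (@measurable_sup_dist n)).
by rewrite lebesgue_sup_ball// powR_mulrn ?(ltW r0)// exprMn.
Qed.

Lemma lebesgue_sup_dist0 n (x : 'R[R]^n) : (0 < n)%N ->
  lebesgue n [set y | sup_dist x y = 0] = 0.
Proof.
move=> n0; apply/eqP; rewrite eq_le measure_ge0 andbT.
have md := measurable_kernel1 x (@measurable_sup_dist n).
apply/lee_addgt0Pr => e e0; rewrite add0e.
pose r := Num.min e 1 / 2.
have r0 : 0 < r by rewrite divr_gt0// lt_min e0 ltr01.
have r1 : 2 * r <= 1 by rewrite mulrC divfK// ge_min lexx orbT.
apply: (@le_trans _ _ ((2 * r) ^+ n)%:E); last first.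
  rewrite lee_fin; apply: le_trans (ler_iXnr n0 _ r1) _.
    by rewrite mulr_ge0 ?(ltW r0).
  by rewrite mulrC divfK// ge_min lexx.
rewrite -(@lebesgue_sup_ball _ x)//; apply: le_measure; rewrite ?inE.
- by rewrite -[X in measurable X]setTI; exact: (md measurableT [set 0]).
- exact: measurable_sup_ball.
- by move=> y /= ->.
Qed.

End sup_distance.

Section euclidean_norm.
Context {R : realType} {n : nat}.
Implicit Types x : 'R[R]^n.

Definition origin : 'R[R]^n := [tuple 0 | i < n].

Let originE x i : `|tnth origin i - tnth x i| = `|tnth x i|.
Proof. by rewrite tnth_mktuple sub0r normrN. Qed.

Lemma sup_dist_origin_gt0 x : (0 < n)%N -> Rplus x -> 0 < sup_dist origin x.
Proof.
move=> n0 /(_ (Ordinal n0)) x0; apply: lt_le_trans (le_sup_dist _ _ (Ordinal n0)).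
by rewrite originE normr_gt0 gt_eqF.
Qed.

Lemma sup_dist_origin_le_enorm x : sup_dist origin x <= enorm x.
Proof.
apply: sup_dist_le => [|i]; first exact: sqrtr_ge0.
rewrite originE -sqrtr_sqr ler_wsqrtr// (bigD1 i)//= lerDl.
by apply: sumr_ge0 => j _; exact: sqr_ge0.
Qed.

Lemma enorm_le_sup_dist_origin x : enorm x <= n%:R * sup_dist origin x.
Proof.
have N0 := @sup_dist_ge0 _ _ origin x.
rewrite -[leRHS]ger0_norm ?mulr_ge0// -sqrtr_sqr ler_wsqrtr//.
apply: (@le_trans _ _ (\sum_(i < n) sup_dist origin x ^+ 2)).
  apply: ler_sum => i _; rewrite -(ger0_norm N0) -normrX -[leLHS]ger0_norm ?sqr_ge0//.
  by rewrite !normrX lerXn2r ?nnegrE ?normr_ge0// -(originE x) ger0_norm// le_sup_dist.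
rewrite sumr_const card_ord -[leLHS]mulr_natl exprMn ler_wpM2r ?sqr_ge0//.
by case: n => [|m]; rewrite ?expr0n// -natrX ler_nat leq_pmull.
Qed.

Lemma measurable_enorm : measurable_fun setT (@enorm R n).
Proof.
have sqE x : enorm x = (\sum_(i < n) tnth x i ^+ 2) `^ 2^-1.
  by rewrite powR12_sqrt//; apply: sumr_ge0 => i _; exact: sqr_ge0.
rewrite (_ : @enorm R n = fun x => (\sum_(i < n) tnth x i ^+ 2) `^ 2^-1); last exact/funext.
apply: measurable_fun_powR; apply: measurable_sum => i.
by apply: measurable_funX; exact: measurable_tnth.
Qed.

Lemma measurable_Rplus : measurable (@Rplus R n).
Proof.
rewrite (_ : Rplus = \bigcap_(i in [set: 'I_n]) [set x | 0 < tnth x i]).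
  apply: fin_bigcap_measurable; first exact: finite_finset.
  move=> i _; rewrite -[X in measurable X]setTI.
  rewrite (_ : [set x | _] = (@tnth n R)^~ i @^-1` `]0, +oo[).
    exact: (measurable_tnth i).
  by apply/seteqP; split => x /=; rewrite in_itv/= andbT.
by apply/seteqP; split => x /= h; [move=> i _; exact: h|move=> i; exact: (h i I)].
Qed.

End euclidean_norm.

(** * The fractional integral as a weighted convolution *)

Definition min_powers {R : realType} (l0 l1 l2 r : R) : R :=
  Num.min (r `^ (- l0)) (Num.min (r `^ (- l1)) (r `^ (- l2))).

Section min_powers.
Context {R : realType} (l0 l1 l2 : R).

Lemma min_powers_ge0 r : 0 <= min_powers l0 l1 l2 r.
Proof. by rewrite /min_powers !le_min !powR_ge0. Qed.

Lemma min_powers0 : 0 < l0 -> 0 < l1 -> 0 < l2 -> min_powers l0 l1 l2 0 = 0.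
Proof.
by move=> *; rewrite /min_powers !powR0 ?minxx// oppr_eq0 gt_eqF.
Qed.

Lemma measurable_min_powers : measurable_fun setT (min_powers l0 l1 l2).
Proof.
by rewrite /min_powers; repeat apply: measurable_minr; measurability.
Qed.

Lemma min_powers_le r : [/\ min_powers l0 l1 l2 r <= r `^ (- l0),
  min_powers l0 l1 l2 r <= r `^ (- l1) & min_powers l0 l1 l2 r <= r `^ (- l2)].
Proof. by rewrite /min_powers; split; rewrite !ge_min lexx ?orbT. Qed.

End min_powers.

Section domination.
Context {R : realType} {n : nat}.
Implicit Types (alpha : 'I_n -> R) (x y : 'R[R]^n).
Hypothesis n0 : (0 < n)%N.

(** The kernel is below every admissible power of the distance. Besides [lam], one
    exponent below [n] and one above make the majorant integrable, which the
    power [lam] alone is not when [lam = n]. *)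
Lemma potential_kernel_le_min_powers (sigma lam : R) : 0 < sigma -> 0 < lam ->
  n%:R - 2 * sigma <= lam ->
  exists2 C : R, 0 < C & exists l1 l2 : R, [/\ 0 < l1 < n%:R, n%:R < l2 &
    forall alpha x y, (forall i, - 2^-1 <= alpha i) -> Rplus x -> Rplus y ->
    0 < sup_dist x y ->
    (`|potential_kernel alpha sigma x y| <=
      (C * min_powers lam l1 l2 (sup_dist x y))%:E)%E].
Proof.
move=> sigma0 lam0 lamn; have nR0 : 0 < n%:R :> R by rewrite ltr0n.
pose l1 : R := Num.max (n%:R - 2 * sigma) (n%:R / 2).
have l10 : 0 < l1 by rewrite lt_max divr_gt0 ?orbT.
have l1n : l1 < n%:R by rewrite gt_max; apply/andP; split; lra.
have l1s : n%:R - 2 * sigma <= l1 by rewrite le_max lexx.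
pose l2 : R := n%:R + 1.
have l20 : 0 < l2 by rewrite /l2; lra.
have l2s : n%:R - 2 * sigma <= l2 by rewrite /l2; lra.
have [C0 C00 H0] := @potential_kernel_le R n _ _ n0 sigma0 lam0 lamn.
have [C1 C10 H1] := @potential_kernel_le R n _ _ n0 sigma0 l10 l1s.
have [C2 C20 H2] := @potential_kernel_le R n _ _ n0 sigma0 l20 l2s.
exists (C0 + C1 + C2); first by rewrite !addr_gt0.
exists l1, l2; split; [by rewrite l10|by rewrite ltrDl|].
move=> alpha x y al x0 y0 d0.
have := H0 _ _ _ _ al x0 y0 d0 (sup_dist_sqr_le x y).
have := H1 _ _ _ _ al x0 y0 d0 (sup_dist_sqr_le x y).
have := H2 _ _ _ _ al x0 y0 d0 (sup_dist_sqr_le x y).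
case: potential_kernel => [a| |]//=; rewrite !lee_fin => h2 h1 h0.
have C012 : 0 <= C0 + C1 + C2 by rewrite !addr_ge0// ltW.
rewrite /min_powers !minr_pMr//.
rewrite !le_min; apply/and3P; split.
- by apply: le_trans h0 _; rewrite ler_wpM2r ?powR_ge0//; lra.
- by apply: le_trans h1 _; rewrite ler_wpM2r ?powR_ge0//; lra.
- by apply: le_trans h2 _; rewrite ler_wpM2r ?powR_ge0//; lra.
Qed.

(** The kernel need not be finite on the diagonal, which is a null set. *)
Lemma abse_integral_kernel_le (K : 'R[R]^n -> \bar R) (k f : 'R[R]^n -> R) x :
  measurable_fun setT k -> (forall y, 0 <= k y) -> measurable_fun Rplus f ->
  (forall y, Rplus y -> 0 < sup_dist x y -> (`|K y| <= (k y)%:E)%E) ->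
  (`|\int[lebesgue n]_(y in Rplus) (K y * (f y)%:E)| <=
   \int[lebesgue n]_y (k y * `|(f \_ Rplus) y|)%:E)%E.
Proof.
move=> mk k0 mf Kk; set f' := f \_ Rplus.
have mf' : measurable_fun setT f'.
  by apply/(measurable_restrictT _ measurable_Rplus).
have md : measurable_fun setT (sup_dist x).
  exact: (measurable_kernel1 x (@measurable_sup_dist R n)).
have mkf : measurable_fun setT (fun y => (k y * `|f' y|)%:E).
  apply/measurable_EFinP/measurable_funM => //.
  exact: measurableT_comp.
pose g y := (if sup_dist x y == 0%R then +oo else (k y * `|f' y|)%:E)%E.
have mg : measurable_fun setT g.
  apply: measurable_fun_ifT => //.
  by apply: measurable_fun_eqr.
apply: (@le_trans _ _ (\int[lebesgue n]_(y in Rplus) g y)%E).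
  apply: abse_integral_le_nonmeas => y y0; rewrite /g.
  case: eqVneq => [_|d0]; first exact: leey.
  have -> : f' y = f y by rewrite /f' patchE mem_set.
  rewrite abseM EFinM; apply: lee_wpmul2r => //.
  by apply: Kk => //; rewrite lt_neqAle eq_sym d0 sup_dist_ge0.
have kf0 y : (0 <= (k y * `|f' y|)%:E)%E by rewrite lee_fin mulr_ge0.
have -> : (\int[lebesgue n]_(y in Rplus) g y =
    \int[lebesgue n]_(y in Rplus) (k y * `|f' y|)%:E)%E.
  apply: ge0_ae_eq_integral.
  - exact: measurable_Rplus.
  - exact: measurable_funTS.
  - exact: measurable_funTS.
  - by move=> y _; rewrite /g; case: ifP.
  - by [].
  exists [set y | sup_dist x y = 0]; split.
  - by rewrite -[X in measurable X]setTI; exact: (md measurableT [set 0]).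
  - exact: lebesgue_sup_dist0.
  - by move=> y /= /not_implyP[_]; rewrite /g; case: eqVneq.
by apply: ge0_subset_integral => //; exact: measurable_Rplus.
Qed.

End domination.

(** * The vector-valued estimate *)

Section vector_valued.
Context {R : realType} {n : nat}.
Implicit Types (x y : 'R[R]^n).
Hypothesis n0 : (0 < n)%N.
Variables (p q q' s t C0 C : R) (kappa : R -> R).
Hypotheses (p1 : 1 < p) (q1 : 1 < q) (qq' : q^-1 + q'^-1 = 1).
Hypotheses (C00 : 0 < C0) (Cgt0 : 0 < C).
Hypotheses (mkappa : measurable_fun setT kappa) (kappa_ge0 : forall r, 0 <= kappa r).
Let K := sw_kernel (@sup_dist R n) origin s t kappa.
Hypothesis formC : form_le (lebesgue n) p q' K C.

Let p0 : 0 < p. Proof. exact: lt_trans p1. Qed.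
Let q0 : 0 < q. Proof. exact: lt_trans q1. Qed.

Local Notation mu := (@lebesgue R n).
Local Notation N := (@sup_dist R n origin).

Let mN : measurable_fun setT N.
Proof. exact: (measurable_kernel1 origin (@measurable_sup_dist R n)). Qed.

Let mk : measurable_kernel (fun x y => kappa (sup_dist x y)).
Proof. exact: (measurableT_comp mkappa (@measurable_sup_dist R n)). Qed.

Let K_ge0 x y : 0 <= K x y.
Proof. by rewrite /K /sw_kernel !mulr_ge0 ?powR_ge0. Qed.

Let mK : measurable_kernel K.
Proof.
rewrite /K /measurable_kernel /sw_kernel.
have mN1 : measurable_fun setT (fun z : 'R[R]^n * 'R[R]^n => N z.1).
  exact: (measurableT_comp mN measurable_fst).
have mN2 : measurable_fun setT (fun z : 'R[R]^n * 'R[R]^n => N z.2).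
  exact: (measurableT_comp mN measurable_snd).
have mk' := mk; rewrite /measurable_kernel in mk'.
by measurability.
Qed.

Let enorm_powR_le x w : Rplus x -> enorm x `^ w <= n%:R `^ `|w| * N x `^ w.
Proof.
move=> x0; have N0 := sup_dist_origin_gt0 n0 x0.
have Ne := sup_dist_origin_le_enorm x; have eN := enorm_le_sup_dist_origin x.
have n1 : 1 <= n%:R :> R by rewrite ler1n.
apply: powR_le_comparable => //; first exact: lt_le_trans Ne.
exact: le_trans Ne (ler_peMl (le_trans (ltW N0) Ne) n1).
Qed.

Let powR_le_enorm x w : Rplus x -> N x `^ w <= n%:R `^ `|w| * enorm x `^ w.
Proof.
move=> x0; have N0 := sup_dist_origin_gt0 n0 x0.
have Ne := sup_dist_origin_le_enorm x; have eN := enorm_le_sup_dist_origin x.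
have n1 : 1 <= n%:R :> R by rewrite ler1n.
apply: powR_le_comparable => //; first exact: lt_le_trans Ne.
exact: le_trans Ne (ler_peMl (le_trans (ltW N0) Ne) n1).
Qed.

(** Moved onto the kernel, the weights turn it into the Stein-Weiss kernel, up to
    the comparison of the Euclidean norm with the supremum norm. *)
Lemma weighted_integral_le (h : 'R[R]^n -> R) : measurable_fun setT h ->
  (forall y, 0 <= h y) -> (forall y, ~ Rplus y -> h y = 0) ->
  (\int[mu]_(x in Rplus) ((\int[mu]_y (C0 * kappa (sup_dist x y) * h y)%:E) `^ q *
     (enorm x `^ (- (s * q)))%:E) <=
   (C0 `^ q * n%:R `^ `|- (s * q)| * C `^ q)%:E *
   ((n%:R `^ `|t * p|)%:E *
     \int[mu]_(y in Rplus) (h y `^ p * enorm y `^ (t * p))%:E) `^ (q / p))%E.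
Proof.
move=> mh h0 hN.
pose H y := h y * N y `^ t.
have mH : measurable_fun setT H by rewrite /H; measurability.
have H0 y : 0 <= H y by rewrite mulr_ge0 ?powR_ge0.
pose c : R := C0 `^ q * n%:R `^ `|- (s * q)|.
have c0 : 0 <= c by rewrite mulr_ge0 ?powR_ge0.
have mki := measurable_kernel_integral mu mK K_ge0 mH H0.
apply: (@le_trans _ _ (\int[mu]_x (c%:E * kernel_integral mu K H x `^ q))%E).
  apply: le_trans (ge0_subset_integral mu measurable_Rplus measurableT _ _ (@subsetT _ _)); last 2 first.
  - apply: measurable_funeM; exact: (measurableT_comp (measurable_poweR q)).
  - by move=> x _; rewrite mule_ge0 ?lee_fin ?poweR_ge0.
  apply: ge0_le_integral_nonmeas => x x0.
    by rewrite mule_ge0 ?poweR_ge0// lee_fin powR_ge0.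
  set J := (\int[mu]_y (kappa (sup_dist x y) * h y)%:E)%E.
  have J0 : (0 <= J)%E by apply: integral_ge0 => y _; rewrite lee_fin mulr_ge0.
  have mJ : measurable_fun setT (fun y => (kappa (sup_dist x y) * h y)%:E).
    apply/measurable_EFinP/measurable_funM => //.
    exact: (measurable_kernel1 x mk).
  have -> : (\int[mu]_y (C0 * kappa (sup_dist x y) * h y)%:E = C0%:E * J)%E.
    under eq_integral do rewrite -mulrA EFinM.
    rewrite ge0_integralZl_EFin ?(ltW C00)//.
    by move=> y _; rewrite lee_fin mulr_ge0.
  have -> : (kernel_integral mu K H x = (N x `^ (- s))%:E * J)%E.
    rewrite /kernel_integral /J -ge0_integralZl_EFin ?powR_ge0//; last first.
      by move=> y _; rewrite lee_fin mulr_ge0.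
    apply: eq_integral => y _; rewrite -EFinM; congr EFin.
    have [y0|yN] := pselect (Rplus y); last by rewrite /H hN// mul0r !mulr0.
    have Ny := sup_dist_origin_gt0 n0 y0; have Nx := sup_dist_origin_gt0 n0 x0.
    rewrite /K /sw_kernel /H Nx Ny/= mulr1.
    rewrite (_ : _ * _ * _ * (_ * _) = N x `^ (- s) *
      (kappa (sup_dist x y) * h y) * (N y `^ (- t) * N y `^ t)); last by ring.
    by rewrite -powRD ?(gt_eqF Ny) ?implybT// addNr powRr0 mulr1.
  rewrite !poweRM ?lee_fin ?powR_ge0 ?(ltW C00)//.
  rewrite !poweR_EFin -powRrM mulNr muleAC -!EFinM muleA -EFinM muleC [leRHS]muleC.
  apply: lee_wpmul2l; first exact: poweR_ge0.
  rewrite lee_fin -mulrA ler_wpM2l ?powR_ge0//.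
  exact: enorm_powR_le.
rewrite ge0_integralZl_EFin//; last 2 first.
- by move=> x _; exact: poweR_ge0.
- exact: (measurableT_comp (measurable_poweR q)).
rewrite [X in (_ <= X * _)%E]EFinM -[leRHS]muleA; apply: lee_wpmul2l; first by rewrite lee_fin.
have := kernel_integral_Lp p0 q1 qq' Cgt0 mK K_ge0 formC mH H0.
move/le_trans; apply; apply: lee_wpmul2l; first by rewrite lee_fin powR_ge0.
have int0 : (0 <= \int[mu]_(y in Rplus) (h y `^ p * enorm y `^ (t * p))%:E)%E.
  by apply: integral_ge0 => y _; rewrite lee_fin mulr_ge0 ?powR_ge0.
have me := @measurable_enorm R n.
apply: gt0_ler_poweR; rewrite ?divr_ge0 ?(ltW p0) ?(ltW q0)// ?in_itv/= ?leey ?andbT.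
- by apply: integral_ge0 => y _; rewrite lee_fin powR_ge0.
- by rewrite mule_ge0// lee_fin powR_ge0.
rewrite -ge0_integralZl_EFin ?powR_ge0//; last 3 first.
- exact: measurable_Rplus.
- by move=> y _; rewrite lee_fin mulr_ge0 ?powR_ge0.
- by apply: measurable_funTS; measurability.
rewrite [leRHS]integral_mkcond; apply: ge0_le_integral_nonmeas => y _.
  by rewrite lee_fin powR_ge0.
rewrite patchE; case: ifPn => [|]; rewrite ?inE ?notin_setE => y0.
  rewrite -EFinM lee_fin /H powRM ?powR_ge0// -powRrM mulrCA ler_wpM2l ?powR_ge0//.
  exact: powR_le_enorm.
by rewrite /H hN// mul0r powR0// gt_eqF.
Qed.

Definition vector_valued_constant : R :=
  (C0 `^ q * n%:R `^ `|- (s * q)| * C `^ q) `^ q^-1 *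
  (n%:R `^ `|t * p| * 2 `^ p) `^ p^-1.

Lemma vector_valued_constant_gt0 : 0 < vector_valued_constant.
Proof.
have nR0 : 0 < n%:R :> R by rewrite ltr0n.
by rewrite /vector_valued_constant mulr_gt0 ?powR_gt0 ?mulr_gt0 ?powR_gt0.
Qed.

(** The kernel does not depend on the index, so Minkowski's inequality brings the
    sequence norm inside the operator. It is real-valued almost everywhere as
    soon as the right side is finite. *)
Lemma vector_valued_le (r : \bar R) (f : nat -> 'R[R]^n -> R)
    (g : nat -> 'R[R]^n -> \bar R) : (1 <= r)%E ->
  (forall j, measurable_fun Rplus (f j)) ->
  (forall j x, Rplus x -> (`|g j x| <=
    \int[mu]_y (C0 * kappa (sup_dist x y) * `|(f j \_ Rplus) y|)%:E)%E) ->
  (wLnorm q (- (s * q)) (fun x => lr_norm r (fun j => g j x)) <=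
   vector_valued_constant%:E *
   wLnorm p (t * p) (fun x => lr_norm r (fun j => (f j x)%:E)))%E.
Proof.
move=> r1 mf gf; pose f' j := f j \_ Rplus.
have mf' j : measurable_fun setT (f' j).
  by apply/(measurable_restrictT _ measurable_Rplus).
pose S y := lr_norm r (fun j => (f' j y)%:E).
have mS : measurable_fun setT S by exact: measurable_lr_norm.
have S0 y : (0 <= S y)%E by exact: Lnorm_ge0.
have SN y : ~ Rplus y -> S y = 0.
  move=> yN; rewrite -[RHS](@Lnorm0 _ _ _ (@counting nat R) r); last first.
    by rewrite gt_eqF// (lt_le_trans _ r1).
  by congr Lnorm; apply/funext => j; rewrite /f' patchE memNset.
have me := @measurable_enorm R n.
set W := wLnorm p _ _; pose I := (\int[mu]_(y in Rplus) (S y `^ p * (enorm y `^ (t * p))%:E))%E.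
have WE : W = (I `^ p^-1)%E.
  rewrite /W /wLnorm; congr (_ `^ _)%E; apply: eq_integral => y; rewrite inE => y0.
  rewrite gee0_abs ?Lnorm_ge0//; congr (lr_norm _ _ `^ _ * _)%E.
  by apply/funext => j; rewrite /f' patchE mem_set.
have I0 : (0 <= I)%E.
  by apply: integral_ge0 => y _; rewrite mule_ge0 ?poweR_ge0// lee_fin powR_ge0.
have [Ioo|] := ltP I +oo%E; last first.
  rewrite leye_eq => /eqP IE; rewrite WE IE poweRyr ?gt_eqF ?invr_gt0//.
  by rewrite gt0_muley ?leey// lte_fin vector_valued_constant_gt0.
have mI : measurable_fun Rplus (fun y => S y `^ p * (enorm y `^ (t * p))%:E)%E.
  apply: measurable_funTS; apply: emeasurable_funM.
    exact: (measurableT_comp (measurable_poweR p)).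
  by measurability.
have Sfin : {ae mu, forall y, S y \is a fin_num}.
  have : mu.-integrable Rplus (fun y => S y `^ p * (enorm y `^ (t * p))%:E)%E.
    apply/integrableP; split => //.
    rewrite (_ : \int[_]_(_ in _) _ = I)%E//; apply: eq_integral => y _.
    by rewrite gee0_abs// mule_ge0 ?poweR_ge0// lee_fin powR_ge0.
  move/(integrable_ae measurable_Rplus); apply: filterS => y.
  have [y0|yN _] := pselect (Rplus y); last by rewrite SN.
  move/(_ y0); case: (S y) (S0 y) => // _.
  rewrite poweRyr ?gt_eqF// gt0_mulye// lte_fin powR_gt0//.
  exact: lt_le_trans (sup_dist_origin_gt0 n0 y0) (sup_dist_origin_le_enorm y).
pose h y := 2 * fine (S y).
have mh : measurable_fun setT h by apply: measurable_funM => //; exact: measurableT_comp.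
have h0 y : 0 <= h y by rewrite mulr_ge0 ?fine_ge0.
have hN y : ~ Rplus y -> h y = 0 by move=> yN; rewrite /h SN// mulr0.
have gh x : Rplus x -> (lr_norm r (fun j => g j x) <=
    \int[mu]_y (C0 * kappa (sup_dist x y) * h y)%:E)%E.
  move=> x0; pose k y := C0 * kappa (sup_dist x y).
  have k0 y : 0 <= k y by rewrite mulr_ge0 ?(ltW C00).
  have mkx : measurable_fun setT k.
    by apply: measurable_funM => //; exact: (measurable_kernel1 x mk).
  apply: (@le_trans _ _ (lr_norm r (fun j => \int[mu]_y (k y * `|f' j y|)%:E)%E)).
    apply: lr_norm_le => // j; apply: le_trans (gf j x x0) _; exact: lee_abs.
  apply: le_trans (lr_norm_integral_le mu mkx k0 mf' r1) _.
  rewrite -ge0_integralZl_EFin//; last 2 first.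
  - by move=> y _; rewrite mule_ge0 ?lee_fin//; exact: S0.
  - by apply: emeasurable_funM => //; exact/measurable_EFinP.
  rewrite le_eqVlt; apply/orP; left; apply/eqP; apply: ge0_ae_eq_integral => //.
  - apply: measurable_funeM; apply: emeasurable_funM => //; exact/measurable_EFinP.
  - by apply/measurable_EFinP; exact: measurable_funM.
  - by move=> y _; rewrite mule_ge0// mule_ge0 ?lee_fin//; exact: S0.
  - by move=> y _; rewrite lee_fin; exact: mulr_ge0 (k0 y) (h0 y).
  move: Sfin; apply: filterS => y Sy _.
  rewrite /h -[lr_norm _ _]/(S y) -[in LHS](fineK Sy) -!EFinM.
  by congr EFin; rewrite /k; ring.
have c0 : 0 <= C0 `^ q * n%:R `^ `|- (s * q)| * C `^ q by rewrite !mulr_ge0 ?powR_ge0.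
have c1 : 0 <= n%:R `^ `|t * p| * 2 `^ p by rewrite !mulr_ge0 ?powR_ge0.
have H : (\int[mu]_(x in Rplus) (`|lr_norm r (fun j => g j x)| `^ q *
     (enorm x `^ (- (s * q)))%:E) <=
   (C0 `^ q * n%:R `^ `|- (s * q)| * C `^ q)%:E *
   ((n%:R `^ `|t * p| * 2 `^ p)%:E * I) `^ (q / p))%E.
  apply: (@le_trans _ _ (\int[mu]_(x in Rplus)
     ((\int[mu]_y (C0 * kappa (sup_dist x y) * h y)%:E) `^ q *
     (enorm x `^ (- (s * q)))%:E))%E).
    apply: ge0_le_integral_nonmeas => x x0.
      by rewrite mule_ge0 ?poweR_ge0// lee_fin powR_ge0.
    apply: lee_wpmul2r; first by rewrite lee_fin powR_ge0.
    rewrite gee0_abs ?Lnorm_ge0//.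
    have Jx0 : (0 <= \int[mu]_y (C0 * kappa (sup_dist x y) * h y)%:E)%E.
      by apply: integral_ge0 => y _; rewrite lee_fin !mulr_ge0 ?(ltW C00)// fine_ge0.
    by apply: gt0_ler_poweR; rewrite ?(ltW q0)// ?in_itv/= ?leey ?andbT ?Lnorm_ge0// gh.
  apply: le_trans (weighted_integral_le mh h0 hN) _.
  apply: lee_wpmul2l; first by rewrite lee_fin.
  rewrite EFinM -muleA; set A := (\int[mu]_(y in Rplus) _)%E; suff -> : A = ((2 `^ p)%:E * I)%E by [].
  rewrite /A /I -ge0_integralZl_EFin ?powR_ge0//; last 2 first.
  - exact: measurable_Rplus.
  - by move=> y _; rewrite mule_ge0 ?poweR_ge0// lee_fin powR_ge0.
  apply: ae_eq_integral.
  - exact: measurable_Rplus.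
  - by apply: measurable_funTS; measurability.
  - exact: measurable_funeM.
  move: Sfin; apply: filterS => y Sy _.
  rewrite /h -{2}(fineK Sy) powRM ?fine_ge0// poweR_EFin -!EFinM; congr EFin; ring.
rewrite WE /wLnorm /vector_valued_constant.
set D1 := _ * C `^ q in c0 H *; set D2 := _ * 2 `^ p in c1 H *.
have R0 : (0 <= D1%:E * (D2%:E * I) `^ (q / p))%E by rewrite mule_ge0 ?poweR_ge0// lee_fin.
have -> : ((D1 `^ q^-1 * D2 `^ p^-1)%:E * I `^ p^-1 =
    (D1%:E * (D2%:E * I) `^ (q / p)) `^ q^-1)%E.
  rewrite [in RHS]poweRM ?lee_fin ?poweR_ge0// -poweRrM.
  rewrite [q / p]mulrC -mulrA mulfV ?gt_eqF// mulr1 poweRM ?lee_fin//.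
  by rewrite !poweR_EFin EFinM muleA.
apply: gt0_ler_poweR; rewrite ?invr_ge0 ?(ltW q0)// ?in_itv/= ?leey ?andbT//.
by apply: integral_ge0 => x _; rewrite mule_ge0 ?poweR_ge0// lee_fin powR_ge0.
Qed.

End vector_valued.

(** The exponent is positive by the bounds on [s] and [t]. *)
Lemma vector_valued_bound_of_exponent (R : realType) (n : nat) (alpha : 'I_n -> R)
    (sigma p p' q s t : R) :
  (0 < n)%N -> (forall i, - 2^-1 <= alpha i) -> 0 < sigma ->
  1 < p -> p <= q -> p^-1 + p'^-1 = 1 ->
  t < n%:R / p' -> s < n%:R / q -> 0 <= t + s ->
  n%:R - 2 * sigma <= sw_exponent n%:R q p' s t ->
  exists2 C : R, 0 < C &
    forall (a : R) (r : \bar R), 1 <= a -> (1 <= r)%E ->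
      vector_valued_bound alpha a sigma p q s t r C.
Proof.
move=> n0 al sigma0 p1 pq pp' tp' sq ts0 lamn.
have nR0 : 0 < n%:R :> R by rewrite ltr0n.
have q1 : 1 < q by exact: lt_le_trans pq.
pose q' := (1 - q^-1)^-1.
have qq' : q^-1 + q'^-1 = 1 by rewrite /q' invrK addrC subrK.
set lam := sw_exponent _ _ _ _ _ in lamn.
have lam0 : 0 < lam by rewrite /lam /sw_exponent; lra.
have [C0 C00 [l1 [l2 [/andP[l10 l1n] l2n HK]]]] :=
  potential_kernel_le_min_powers n0 sigma0 lam0 lamn.
pose kappa := min_powers lam l1 l2.
have l20 : 0 < l2 by exact: lt_trans l2n.
have mkappa : measurable_fun setT kappa by exact: measurable_min_powers.
have kappa0 : forall r, 0 <= kappa r by exact: min_powers_ge0.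
have [C C1 HC] : exists2 C : R, 0 < C &
    form_le (lebesgue n) p q' (sw_kernel (@sup_dist R n) origin s t kappa) C.
  apply: (@form_le_stein_weiss _ _ _ (lebesgue n) n%:R (2 ^+ n) (@sup_dist R n)
    origin _ _ _ _ _ _ p q p' q' s t kappa) => //.
  - exact: measurable_sup_dist.
  - exact: ball_regular_sup_dist.
  - exact: sup_distC.
  - exact: sup_dist_triangle.
  - exact: min_powers0.
  - by move=> r _; have [] := min_powers_le lam l1 l2 r.
  - move=> _; exists l1 => //; exists l2 => // r _.
    by have [] := min_powers_le lam l1 l2 r.
exists (@vector_valued_constant R n p q s t C0 C).
  exact: (vector_valued_constant_gt0 n0).
move=> a r a1 r1 f fLp.
apply: (vector_valued_le n0 p1 q1 qq' C00 C1 mkappa kappa0 HC r1) => [j|j x x0].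
  by have [] := fLp j.
apply: (@abse_integral_kernel_le _ _ n0 _ (fun y => C0 * kappa (sup_dist x y))).
- apply: measurable_funM => //; apply: (measurableT_comp mkappa).
  exact: (measurable_kernel1 x (@measurable_sup_dist R n)).
- by move=> y; rewrite mulr_ge0 ?(ltW C00).
- by have [] := fLp j.
move=> y y0 d0; apply: HK; [|exact: x0|exact: y0|exact: d0] => i.
apply: le_trans (al i) _; rewrite lerDl mulr_ge0//.
exact: le_trans a1.
Qed.

Theorem theorem2p1 (R : realType) (n : nat) (alpha : 'I_n -> R)
    (sigma p p' q s t : R)
    (hn : (1 <= n)%N)
    (halpha : forall i, - 2^-1 <= alpha i)
    (hsigma : 0 < sigma)
    (hp : 1 < p) (hpq : p <= q)
    (hp' : p^-1 + p'^-1 = 1)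
    (ht : t < n%:R / p')
    (hs : s < n%:R / q)
    (hts : 0 <= t + s) :
  (n%:R / 2 <= sigma ->
     exists2 C : R, 0 < C &
       forall (a : R) (r : \bar R), 1 <= a -> (1 <= r)%E ->
         vector_valued_bound alpha a sigma p q s t r C)
  /\
  (sigma < n%:R / 2 ->
   p^-1 - (2 * sigma - t - s) / n%:R <= q^-1 ->
     exists2 C : R, 0 < C &
       forall (a : R) (r : \bar R), 1 <= a -> (1 <= r)%E ->
         vector_valued_bound alpha a sigma p q s t r C).
Proof.
have nR0 : 0 < n%:R :> R by rewrite ltr0n.
split=> [sigman|_ pq]; apply: (vector_valued_bound_of_exponent (p' := p')) => //.
  by rewrite /sw_exponent; lra.
move: pq; rewrite -(ler_pM2l nR0) mulrBr [n%:R * (_ / _)]mulrC divfK ?gt_eqF//.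
rewrite /sw_exponent; have -> : p'^-1 = 1 - p^-1 by rewrite -hp' addrC addKr.
lra.
Qed.
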